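(* Let $d=1$, $\Phi(x)=-\log|x|$, and let $V(x)$ be a potential that is $C^{3}(\mathbb{R})$, symmetric ($V(x)=V(-x)$), strictly convex, and satisfies $\liminf_{|x|\to\infty}\frac{V(x)}{\log|x|}>1$. For $R>0$ consider the constrained minimisation problem $$\mathcal{E}[\rho_R]=\inf_{\rho\in\mathcal{P}([-R,R])}\mathcal{E}[\rho],\qquad \mathcal{E}[\rho]=-\frac{1}{2}\iint_{\mathbb{R}\times\mathbb{R}}\log|x-y|\,\mathrm{d}\rho(x)\mathrm{d}\rho(y)+\int_{\mathbb{R}} V(x)\,\mathrm{d}\rho(x),$$ where $\mathcal{P}([-R,R])$ is the set of probability measures supported in $[-R,R]$. Then: i) there exists a unique probability measure solving this constrained minimisation problem, and it takes the form $$\mathrm{d}\rho_R(x)= \begin{cases} \displaystyle\frac{1}{\pi}\frac{P_R(x)}{\sqrt{R^2-x^2}}\,\mathbf{1}_{|x|< R}\,\mathrm{d} x & \text{if } R< R_{\star} \text{ (pushed phase)},\\[2mm] \displaystyle\frac{1}{\pi}Q(x)\sqrt{R_{\star}^2-x^2}\,\mathbf{1}_{|x|\leq R_{\star}}\,\mathrm{d} x & \text{if } R\geq R_{\star} \text{ (pulled phase)}, \end{cases}$$ where $P_R(x)$ and $Q(x)=\lim_{R\uparrow R_{\star}}P_{R}(x)/(R^2-x^2)$ are nonnegative on $[-R,R]$ and $[-R_{\star},R_{\star}]$, respectively. ii) Explicitly, let $c_n(R)$ denote the Chebyshev coefficients of $V(Rx)$, $$c_n(R)=\frac{1}{h_n}\int_{-1}^1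 \frac{V(R x)T_n(x)}{\sqrt{1-x^2}}\,\mathrm{d} x,$$ with $T_n$ the Chebyshev polynomials of the first kind and $h_0=\pi$, $h_n=\pi/2$ for $n\geq1$. Then the equilibrium measure above is uniquely determined by $$P_R(x)=1-\sum_{n\geq1}n\,c_n(R)\,T_{n}(x/R),$$ and the critical radius $R_{\star}$ is the smallest positive solution of $$\sum_{n\geq1}n\,c_{n}(R_{\star})=1.$$
   Context: $\mathbf{1}_{F}$ denotes the indicator of the set defined by the formula $F$. The Chebyshev polynomials satisfy $\int_{-1}^1 T_n(x)T_m(x)(1-x^2)^{-1/2}\mathrm{d}x=\delta_{nm}h_n$. In the pulled phase ($R\ge R_\star$) the hard walls at $\pm R$ are not active and $\rho_R$ equals the unconstrained global minimiser, supported on $[-R_\star,R_\star]$.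
   Formalization: Existence of the limit Q(x) and its nonnegativity are asserted for |x|<R_* only: at x=±R_* the limit would need P_R(x) at points outside [-R,R], where its Chebyshev series need not converge; the density vanishes at these two points. *)

(* Defs.v *)
From HB Require Import structures.
From mathcomp Require Import all_boot all_order all_algebra.
From mathcomp Require Import all_classical all_reals all_analysis.
Set Implicit Arguments. Unset Strict Implicit. Unset Printing Implicit Defensive.
Import Order.TTheory GRing.Theory Num.Theory.
Import numFieldNormedType.Exports.
Local Open Scope classical_set_scope.
Local Open Scope ring_scope.

Section Defs.
Variable R : realType.

Definition C3 (V : R -> R) : Prop :=
  (forall x, derivable V x 1) /\
  (forall x, derivable (derive1n 1 V) x 1) /\
  (forall x, derivable (derive1n 2 V) x 1) /\
  continuous (derive1n 3 V).

Definition strictly_convex (V : R -> R) : Prop :=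
  forall x y t : R, x != y -> 0 < t < 1 ->
    V (t * x + (1 - t) * y) < t * V x + (1 - t) * V y.

(* liminf_{|x| -> oo} V(x)/log|x| > 1, unfolded *)
Definition growth_gt_log (V : R -> R) : Prop :=
  exists a : R, 1 < a /\ exists M : R, forall x : R, M < `|x| -> a < V x / ln `|x|.

Fixpoint chebT2 (n : nat) (x : R) : R * R :=
  match n with
  | 0 => (1, x)
  | n'.+1 => let p := chebT2 n' x in (p.2, 2 * x * p.2 - p.1)
  end.
Definition chebT (n : nat) (x : R) : R := (chebT2 n x).1.

Definition cheb_h (n : nat) : R := if n == 0%N then pi else pi / 2.

Definition cheb_coef (V : R -> R) (r : R) (n : nat) : R :=
  (cheb_h n)^-1 *
  Rintegral lebesgue_measure `]-1, 1[%classic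
    (fun x => V (r * x) * chebT n x / Num.sqrt (1 - x ^+ 2)).

Definition P_partial (V : R -> R) (r x : R) (N : nat) : R :=
  \sum_(1 <= n < N) (n%:R * cheb_coef V r n * chebT n (x / r)).

Definition P_R (V : R -> R) (r x : R) : R := 1 - limn (P_partial V r x).

Definition S_partial (V : R -> R) (r : R) (N : nat) : R :=
  \sum_(1 <= n < N) (n%:R * cheb_coef V r n).

Definition crit_eq (V : R -> R) (r : R) : Prop :=
  cvgn (S_partial V r) /\ limn (S_partial V r) = 1.

Definition Q_fun (V : R -> R) (Rs x : R) : R :=
  lim ((fun r => P_R V r x / (r ^+ 2 - x ^+ 2)) @ at_left Rs).

Definition logK (x y : R) : \bar R :=
  if x == y then +oo%E else (- ln `|x - y|)%:E.

Definition energy (V : R -> R) (mu : probability R R) : \bar R :=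
  ((2^-1)%:E * (\int[mu]_x (\int[mu]_y logK x y)) + \int[mu]_x (V x)%:E)%E.

Definition supported_in (r : R) (mu : probability R R) : Prop :=
  mu (~` `[-r, r]%classic) = 0%E.

Definition constrained_minimiser (V : R -> R) (r : R) (mu : probability R R) : Prop :=
  supported_in r mu /\
  energy V mu = ereal_inf [set energy V nu | nu in [set nu | supported_in r nu]].

Definition eq_density (V : R -> R) (Rs r x : R) : R :=
  if r < Rs then
    (if `|x| < r then pi^-1 * (P_R V r x / Num.sqrt (r ^+ 2 - x ^+ 2)) else 0)
  else
    (if `|x| <= Rs then pi^-1 * (Q_fun V Rs x * Num.sqrt (Rs ^+ 2 - x ^+ 2)) else 0).

End Defs.

(* Main.v *)
(** Write x = r cos t. Then V(r cos t) = c_0 + sum c_n cos(n t), and n c_n is the n-th sine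
    coefficient of g(t) = r sin t V'(r cos t), which decays like 1/n^2 as V is C^3; all the
    series below therefore converge uniformly and may be computed as Abel limits against
    Poisson kernels. In particular sum n c_n = S(r), the mean of r cos t V'(r cos t), which is
    continuous in r, vanishes at 0 and is unbounded because V' is odd, nondecreasing and nonzero, so
    R_star = inf {r >= 0 | S(r) >= 1}. For cos phi >= 0 one has
    sum n c_n cos(n phi) <= S(r) by monotonicity of V', hence P_r >= 0 for r <= R_star.

    Let s = min(r, R_star) and let rho have density P_s(x) / (pi sqrt(s^2 - x^2)); its n-th
    Chebyshev moment on [-s, s] is - n c_n / 2. Since
    - ln |x - y| = ln(2/s) + sum (2/n) T_n(x/s) T_n(y/s) on [-s, s], the potential of rho is
    C - V there, and it is at least C - V on [-r, r] when S(s) = 1. For the same reason the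
    logarithmic energy of any nu on [-r, r] is at least ln(2/r) + sum (2/n) a_n(nu)^2 with
    a_n(nu) = int T_n(x/r) dnu. Expanding the squares around a_n(rho) yields
    E(nu) >= E(rho) + sum (a_n(nu) - a_n(rho))^2 / n, so rho is a minimiser, and it is the only
    one because a probability measure on [-r, r] is determined by its Chebyshev moments. *)
Require Import Defs.
From HB Require Import structures.
From mathcomp Require Import all_boot all_order all_algebra.
From mathcomp Require Import all_classical all_reals all_analysis.
From mathcomp Require Import measurable_realfun.
From mathcomp Require Import ring lra.
Import Order.TTheory GRing.Theory Num.Theory.
Import numFieldNormedType.Exports.
Local Open Scope classical_set_scope.
Local Open Scope ring_scope.
Set Implicit Arguments. Unset Strict Implicit. Unset Printing Implicit Defensive.

(** * Poisson kernels and their trigonometric sums *)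

(** The obstacle is that [logK] is infinite on the diagonal and energies may be infinite, so the
    Chebyshev expansion of the kernel cannot simply be integrated term by term. Every comparison
    goes through two finite substitutes: the smoothed kernel [Lker d x y], which is - ln of the
    square root of (x - y)^2 + d^2, and the truncated Abel sum [kN]. Up to geometric errors, [kN]
    lies above [Lker] at scale 2 s (1 - q) and, after a shift by ln q, below [Lker] at scale s (1 -
    q)^2 / 2. Bounds on finite moment sums thus pass to the true kernel; only the upper bound on the
    potential of rho needs a limit, taken by monotone convergence.

    The sign statements come from testing the monotone function V' against a positive kernel of mean
    one, or against a kernel with a single sign change. Outside [-s, s] the logarithm is expanded in
    powers of p, where x = s (p + 1/p) / 2; differentiating in p brings in the critical equation.
    The Abel estimates depend on the coefficients only through their decay constant, so that one q
    serves all angles at once. *)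

Section TrigSums.
Variable R : realType.
Implicit Types (q a t : R) (N n : nat).

Lemma chebT2_cos n t :
  chebT2 n (cos t) = (cos (n%:R * t), cos (n.+1%:R * t)).
Proof.
elim: n => [|n IH]; first by rewrite /= mul0r cos0 mul1r.
rewrite /= IH /=; congr pair.
have -> : n.+2%:R * t = n.+1%:R * t + t by rewrite -natr1; ring.
have -> : n%:R * t = n.+1%:R * t - t by rewrite -natr1; ring.
by rewrite (cosD _ t) (cosB _ t); ring.
Qed.

Lemma chebT_cos n t : chebT n (cos t) = cos (n%:R * t).
Proof. by rewrite /chebT chebT2_cos. Qed.

Lemma chebTE n (x : R) : `|x| <= 1 -> chebT n x = cos (n%:R * acos x).
Proof. by move=> x1; rewrite -chebT_cos acosK// in_itv/= -ler_norml. Qed.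

Lemma continuous_chebT n : continuous (@chebT R n).
Proof.
have : continuous (fun x : R => (chebT2 n x).1) /\
       continuous (fun x : R => (chebT2 n x).2).
  elim: n => [|n [IH1 IH2]]; first by split=> x; [exact: cvg_cst|exact: cvg_id].
  split => //= x; apply: cvgB; last exact: IH1.
  by apply: cvgM; [apply: cvgM; [exact: cvg_cst|exact: cvg_id]|exact: IH2].
by case.
Qed.

(** The squared modulus of 1 - q e^(it), the common denominator of the two Poisson kernels. *)
Definition poisD q t := 1 - 2 * q * cos t + q ^+ 2.

Lemma poisD_ge q t : 0 <= q -> (1 - q) ^+ 2 <= poisD q t.
Proof. by move=> q0; rewrite /poisD; have := cos_le1 t; nra. Qed.

Lemma poisD_gt0 q t : 0 <= q < 1 -> 0 < poisD q t.
Proof.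
move=> /andP[q0 q1]; apply: lt_le_trans (poisD_ge t q0).
by rewrite exprn_gt0// subr_gt0.
Qed.

(** Real part of a geometric sum in q e^(it). Multiplying by [poisD] instead of dividing keeps the
    induction polynomial. *)
Lemma sum_cosE q t N : poisD q t * (\sum_(1 <= n < N.+1) q ^+ n * cos (n%:R * t)) =
  q * cos t - q ^+ 2 - q ^+ N.+1 * cos (N.+1%:R * t) + q ^+ N.+2 * cos (N%:R * t).
Proof.
elim: N => [|N IH].
  by rewrite big_geq// mul1r mul0r cos0 /poisD; ring.
rewrite big_nat_recr//= mulrDr IH /poisD.
have -> : N.+2%:R * t = N.+1%:R * t + t by rewrite -natr1; ring.
have -> : N%:R * t = N.+1%:R * t - t by rewrite -natr1; ring.
by rewrite (cosD _ t) (cosB _ t) !exprS; ring.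
Qed.

Lemma sum_sinE q t N : poisD q t * (\sum_(1 <= n < N.+1) q ^+ n * sin (n%:R * t)) =
  q * sin t - q ^+ N.+1 * sin (N.+1%:R * t) + q ^+ N.+2 * sin (N%:R * t).
Proof.
elim: N => [|N IH].
  by rewrite big_geq// mul1r mul0r sin0 /poisD; ring.
rewrite big_nat_recr//= mulrDr IH /poisD.
have -> : N.+2%:R * t = N.+1%:R * t + t by rewrite -natr1; ring.
have -> : N%:R * t = N.+1%:R * t - t by rewrite -natr1; ring.
by rewrite (sinD _ t) (sinB _ t) !exprS; ring.
Qed.

(** The Poisson kernel 1 + 2 sum q^n cos(n t); [cpois] is half of its conjugate kernel, sum q^n
    sin(n t). *)
Definition pois q t := (1 - q ^+ 2) / poisD q t.
Definition cpois q t := q * sin t / poisD q t.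

Lemma trig_err q N (u v d : R) : 0 <= q < 1 -> `|u| <= 1 -> `|v| <= 1 ->
  (1 - q) ^+ 2 <= d ->
  `|(- q ^+ N.+1 * u + q ^+ N.+2 * v) / d| <= 2 * q ^+ N / (1 - q) ^+ 2.
Proof.
move=> /andP[q0 q1] u1 v1 hd.
have d0 : 0 < (1 - q) ^+ 2 by rewrite exprn_gt0// subr_gt0.
have d1 : 0 < d by exact: lt_le_trans hd.
rewrite normrM normfV (gtr0_norm d1) ler_pdivrMr// [leRHS]mulrAC ler_pdivlMr//.
have qN : 0 <= q ^+ N by exact: exprn_ge0.
have h : `|- q ^+ N.+1 * u + q ^+ N.+2 * v| <= 2 * q ^+ N.
  apply: le_trans (ler_normD _ _) _; rewrite !normrM normrN.
  rewrite !(ger0_norm (exprn_ge0 _ q0)) !exprS.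
  have qu : q * `|u| <= 1 by rewrite mulr_ile1// ltW.
  have qv : q * `|v| <= 1 by rewrite mulr_ile1// ltW.
  have qqv : q * (q * `|v|) <= 1 by rewrite mulr_ile1// ?mulr_ge0// ltW.
  have := ler_wpM2l qN qu; have := ler_wpM2l qN qqv.
  set Q := q ^+ N; rewrite (ger0_norm q0); lra.
apply: ler_pM => //; exact: ltW.
Qed.

Lemma sum_cos_pois q t N : 0 <= q < 1 ->
  `|1 + 2 * (\sum_(1 <= n < N.+1) q ^+ n * cos (n%:R * t)) - pois q t| <=
  4 * q ^+ N / (1 - q) ^+ 2.
Proof.
move=> q01; have D0 := poisD_gt0 t q01.
have -> : 1 + 2 * (\sum_(1 <= n < N.+1) q ^+ n * cos (n%:R * t)) - pois q t =
  2 * ((- q ^+ N.+1 * cos (N.+1%:R * t) + q ^+ N.+2 * cos (N%:R * t)) / poisD q t).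
  have /(canRL (mulKf (lt0r_neq0 D0))) -> := sum_cosE q t N.
  by move: (lt0r_neq0 D0); rewrite /pois /poisD => D1; field.
rewrite normrM ger0_norm//.
have := @trig_err q N _ _ _ q01 (cos_max (N.+1%:R * t)) (cos_max (N%:R * t)) (poisD_ge t (proj1 (andP q01))).
set e := `|_|; move=> h.
have -> : 4 * q ^+ N / (1 - q) ^+ 2 = 2 * (2 * q ^+ N / (1 - q) ^+ 2).
  by rewrite !mulrA; congr (_ * _ * _); rewrite -natrM.
by rewrite ler_wpM2l.
Qed.

Lemma sum_sin_cpois q t N : 0 <= q < 1 ->
  `|\sum_(1 <= n < N.+1) q ^+ n * sin (n%:R * t) - cpois q t| <=
  2 * q ^+ N / (1 - q) ^+ 2.
Proof.
move=> q01; have D0 := poisD_gt0 t q01.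
have -> : \sum_(1 <= n < N.+1) q ^+ n * sin (n%:R * t) - cpois q t =
  (- q ^+ N.+1 * sin (N.+1%:R * t) + q ^+ N.+2 * sin (N%:R * t)) / poisD q t.
  have /(canRL (mulKf (lt0r_neq0 D0))) -> := sum_sinE q t N.
  by move: (lt0r_neq0 D0); rewrite /cpois /poisD => D1; field.
apply: trig_err => //; [exact: sin_max|exact: sin_max|].
exact: poisD_ge (proj1 (andP q01)).
Qed.

Lemma continuous_poisD q : continuous (poisD q).
Proof.
move=> t; apply: cvgD; last exact: cvg_cst.
apply: cvgB; first exact: cvg_cst.
by apply: cvgM; [exact: cvg_cst|exact: continuous_cos].
Qed.

Lemma continuous_pois q : 0 <= q < 1 -> continuous (pois q).
Proof.
move=> q01 t; apply: cvgM; first exact: cvg_cst.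
by apply: cvgV; [rewrite gt_eqF// poisD_gt0|exact: continuous_poisD].
Qed.

Lemma continuous_cpois q : 0 <= q < 1 -> continuous (cpois q).
Proof.
move=> q01 t; apply: cvgM.
  by apply: cvgM; [exact: cvg_cst|exact: continuous_sin].
by apply: cvgV; [rewrite gt_eqF// poisD_gt0|exact: continuous_poisD].
Qed.

Lemma pois_ge0 q t : 0 <= q < 1 -> 0 <= pois q t.
Proof.
move=> q01; rewrite divr_ge0 ?(ltW (poisD_gt0 _ _))// subr_ge0.
by move: q01 => /andP[q0 /ltW q1]; rewrite expr_le1.
Qed.

Lemma is_derive_lnpoisD (t q : R) : 0 <= q < 1 ->
  is_derive q 1 (fun q : R => - 2^-1 * ln (poisD q t)) ((cos t - q) / poisD q t).
Proof.
move=> q01; have D0 := poisD_gt0 t q01.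
have h1 : is_derive q 1 (fun q : R => poisD q t) (- 2 * cos t + 2 * q).
  rewrite /poisD; apply: is_derive_eq; rewrite /GRing.scale/=; ring.
have h2 : is_derive (poisD q t) 1 (@ln R) (poisD q t)^-1 by exact: is_derive1_ln.
have h3 : is_derive q 1 (fun q : R => ln (poisD q t)) ((poisD q t)^-1 * (- 2 * cos t + 2 * q)).
  exact: (@is_derive1_comp R _ (fun q : R => poisD q t)).
apply: is_derive_eq; rewrite /GRing.scale/=; field.
by rewrite gt_eqF.
Qed.

Lemma is_derive_sumq (u : nat -> R) (q : R) N :
  is_derive q 1 (fun q : R => \sum_(1 <= n < N.+1) q ^+ n / n%:R * u n)
    (\sum_(1 <= n < N.+1) q ^+ n.-1 * u n).
Proof.
elim: N => [|N IH].
  rewrite big_geq//; under [X in is_derive _ _ X]funext do rewrite big_geq//.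
  exact: is_derive_cst.
rewrite big_nat_recr//=.
under [X in is_derive _ _ X]funext do rewrite big_nat_recr//=.
apply: is_deriveD.
have : is_derive q 1 (fun x : R => x ^+ N.+1) (N.+1%:R * q ^+ N).
  apply: DeriveDef; first exact: exprn_derivable.
  by rewrite exp_derive /GRing.scale/= mulr1.
move=> h.
have -> : (fun x : R => x ^+ N.+1 / N.+1%:R * u N.+1) = (fun x => (u N.+1 / N.+1%:R) * x ^+ N.+1).
  by apply/funext => x; rewrite mulrC mulrA mulrAC -!mulrA.
apply: is_derive_eq; rewrite /GRing.scale/=; by field; rewrite nat1r pnatr_eq0.
Qed.

(** Real part of the Taylor series of - ln(1 - z) at z = q e^(it). Both sides vanish at q = 0 and
    their q-derivatives differ by the remainder of a geometric sum, so the mean value theorem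
    carries the error bound over. *)
Lemma lnpoisD_sum (q t : R) N : 0 <= q < 1 ->
  `|- 2^-1 * ln (poisD q t) - \sum_(1 <= n < N.+2) q ^+ n / n%:R * cos (n%:R * t)|
    <= 2 * q ^+ N / (1 - q) ^+ 2.
Proof.
move=> /andP[q0 q1].
pose F (x : R) := - 2^-1 * ln (poisD x t) - \sum_(1 <= n < N.+2) x ^+ n / n%:R * cos (n%:R * t).
pose dF (x : R) := (cos t - x) / poisD x t - \sum_(1 <= n < N.+2) x ^+ n.-1 * cos (n%:R * t).
have F0 : F 0 = 0.
  rewrite /F /poisD !(mulr0, mul0r) expr0n/= subr0 addr0 ln1 mulr0 sub0r.
  rewrite big_nat_cond big1 ?oppr0// => n /andP[/andP[n0 _] _].
  by rewrite expr0n eqn0Ngt n0 !mul0r.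
have dFE (x : R) : 0 <= x < 1 -> is_derive x 1 F (dF x).
  move=> x01; apply: is_deriveB; first exact: is_derive_lnpoisD.
  exact: is_derive_sumq.
have [||c] := @MVT_segment R F dF 0 q q0.
- by move=> x; rewrite in_itv/= => /andP[x0 xq]; apply: dFE; rewrite ltW//= (lt_trans xq).
- apply: derivable_within_continuous => x; rewrite in_itv/= => /andP[x0 xq].
  by apply: ex_derive; apply: dFE; rewrite x0/= (le_lt_trans xq).
rewrite in_itv/= => /andP[c0 cq]; rewrite F0 !subr0 -/(F q) => ->.
have c01 : 0 <= c < 1 by rewrite c0 (le_lt_trans cq).
have D0 := poisD_gt0 t c01.
have dFb : `|dF c| <= 2 * c ^+ N / (1 - c) ^+ 2.
  (* The powers c^(n-1) of the derivative are recovered from [sum_cosE] by dividing by c; the value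
     at c = 0 is computed directly. *)
  case: (eqVneq c 0) => [c00|cn0]; last first.
    have -> : dF c = (- c ^+ N.+1 * - cos (N.+2%:R * t) + c ^+ N.+2 * - cos (N.+1%:R * t)) / poisD c t.
      have S1 : \sum_(1 <= n < N.+2) c ^+ n.-1 * cos (n%:R * t) =
          c^-1 * \sum_(1 <= n < N.+2) c ^+ n * cos (n%:R * t).
        rewrite mulr_sumr; apply: eq_big_nat => -[//|n _] /=.
        by rewrite exprS !mulrA mulVf// mul1r.
      rewrite /dF S1.
      have /(canRL (mulKf (lt0r_neq0 D0))) -> := sum_cosE c t N.+1.
      by rewrite !exprS; move: (lt0r_neq0 D0); rewrite /poisD => D1; field; rewrite D1.
    apply: trig_err => //; rewrite ?normrN ?cos_max//.
    exact: poisD_ge.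
  rewrite c00 /dF /poisD !(mulr0, mul0r) expr0n/= !subr0 addr0 divr1 expr1n divr1.
  rewrite big_nat_recl//= expr0 !mul1r.
  case: N {F F0 dF dFE} => [|N].
    by rewrite big_geq// addr0 subrr normr0 expr0.
  rewrite big_nat_cond big1 ?addr0 ?subrr ?normr0 ?mulr_ge0 ?exprn_ge0// => n /andP[/andP[n0 _] _].
  by rewrite expr0n eqn0Ngt n0 !mul0r.
rewrite normrM (ger0_norm q0).
have dcq : `|dF c| <= 2 * q ^+ N / (1 - q) ^+ 2.
  apply: le_trans dFb _; apply: ler_pM.
  - by rewrite mulr_ge0// exprn_ge0.
  - by rewrite invr_ge0 sqr_ge0.
  - by rewrite ler_pM2l// lerXn2r.
  - have q1' : 0 < 1 - q by rewrite subr_gt0.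
    have c1' : 0 < 1 - c by rewrite subr_gt0 (le_lt_trans cq).
    by rewrite lef_pV2 ?posrE ?exprn_gt0// (@lerXn2r _ 2) ?nnegrE ?(ltW q1') ?(ltW c1')// lerB.
apply: le_trans dcq; rewrite ler_piMr//; exact: ltW.
Qed.

Lemma geo_cvg0 (q A : R) : 0 <= q < 1 -> (fun N => A * q ^+ N) @ \oo --> (0 : R).
Proof.
move=> /andP[q0 q1]; rewrite -[X in _ --> X](mulr0 A).
by apply: cvgM; [exact: cvg_cst|apply: cvg_expr; rewrite ger0_norm].
Qed.

Lemma geo_small (q A e : R) : 0 <= q < 1 -> 0 <= A -> 0 < e ->
  exists N0, forall N, (N0 <= N)%N -> A * q ^+ N <= e.
Proof.
move=> q01 A0 e0; have /cvgrPdist_le /(_ _ e0) [N0 _ h] := @geo_cvg0 q A q01.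
exists N0 => N /h /=; rewrite sub0r normrN; apply: le_trans; exact: ler_norm.
Qed.

End TrigSums.

(** * Means over [0, pi] *)

Section ArcsineMean.
Variable R : realType.
Implicit Types (f g : R -> R) (M k : R).
Local Notation mu := (@lebesgue_measure R).

(** For f t = F (s cos t) this is the mean of F under the arcsine law on [-s, s]. *)
Definition Av f : R := pi^-1 * \int[mu]_(t in `[0, pi]) f t.

Lemma Av_integrable f : continuous f -> mu.-integrable `[0, pi] (EFin \o f).
Proof.
move=> cf; apply: continuous_compact_integrable; first exact: segment_compact.
exact: continuous_subspaceT.
Qed.

Lemma continuous_cst k : continuous (fun _ : R => k).
Proof. exact: cst_continuous. Qed.

Lemma AvD f g : continuous f -> continuous g ->
  Av (fun t => f t + g t) = Av f + Av g.
Proof. by move=> cf cg; rewrite /Av RintegralD ?mulrDr//; exact: Av_integrable. Qed.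

Lemma AvB f g : continuous f -> continuous g ->
  Av (fun t => f t - g t) = Av f - Av g.
Proof. by move=> cf cg; rewrite /Av RintegralB ?mulrBr//; exact: Av_integrable. Qed.

Lemma AvZ k f : continuous f -> Av (fun t => k * f t) = k * Av f.
Proof.
move=> cf; rewrite /Av RintegralZl; [|by []|exact: Av_integrable].
by rewrite mulrCA.
Qed.

Lemma Av_cst k : Av (fun=> k) = k.
Proof.
rewrite /Av Rintegral_cst//= lebesgue_measure_itv/= lte_fin pi_gt0/= oppr0 addr0.
by rewrite mulrCA mulVf ?mulr1// gt_eqF// pi_gt0.
Qed.

Lemma Av_le f g : continuous f -> continuous g ->
  (forall t, 0 <= t <= pi -> f t <= g t) -> Av f <= Av g.
Proof.
move=> cf cg fg; rewrite ler_wpM2l ?invr_ge0 ?pi_ge0//.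
apply: le_Rintegral; [by []|exact: Av_integrable|exact: Av_integrable|].
by move=> t; rewrite /= in_itv/= => /fg.
Qed.

Lemma Av_eq f g : (forall t, f t = g t) -> Av f = Av g.
Proof. by move=> /funext ->. Qed.

Lemma Av_norm f M : continuous f ->
  (forall t, 0 <= t <= pi -> `|f t| <= M) -> `|Av f| <= M.
Proof.
move=> cf fM; rewrite ler_norml; apply/andP; split.
  by rewrite -(Av_cst (- M)); apply: Av_le; [exact: continuous_cst|by []|move=> t /fM; rewrite ler_norml => /andP[]].
by rewrite -(Av_cst M); apply: Av_le; [by []|exact: continuous_cst|move=> t /fM; rewrite ler_norml => /andP[]].
Qed.

Lemma continuous_sum (I : Type) (r : seq I) (F : I -> R -> R) :
  (forall i, continuous (F i)) -> continuous (fun t => \sum_(i <- r) F i t).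
Proof.
move=> cF; elim: r => [|i r IH].
  have -> : (fun t => \sum_(i <- [::]) F i t) = fun=> 0.
    by apply/funext => t; rewrite big_nil.
  exact: cst_continuous.
have -> : (fun t => \sum_(j <- i :: r) F j t) = (fun t => F i t + \sum_(j <- r) F j t).
  by apply/funext => t; rewrite big_cons.
by move=> t; apply: cvgD; [exact: cF|exact: IH].
Qed.

Lemma Av_sum (I : Type) (r : seq I) (F : I -> R -> R) :
  (forall i, continuous (F i)) ->
  Av (fun t => \sum_(i <- r) F i t) = \sum_(i <- r) Av (F i).
Proof.
move=> cF; elim: r => [|i r IH].
  by rewrite big_nil -[RHS](Av_cst 0); apply: Av_eq => t; rewrite big_nil.
rewrite big_cons -IH -AvD//; last exact: continuous_sum.
by apply: Av_eq => t; rewrite big_cons.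
Qed.

Lemma is_derive_cont (F f : R -> R) : (forall t : R, is_derive t 1 F (f t)) -> continuous F.
Proof.
move=> dF t; apply: differentiable_continuous.
by rewrite -derivable1_diffP; exact: ex_derive.
Qed.

Lemma Av_FTC (F f : R -> R) : (forall t : R, is_derive t 1 F (f t)) -> continuous f ->
  Av f = pi^-1 * (F pi - F 0).
Proof.
move=> dF cf; rewrite /Av /Rintegral (@continuous_FTC2 _ _ F)//.
- exact: pi_gt0.
- exact: continuous_subspaceT.
- have cF := is_derive_cont dF; split.
  + by move=> x _; exact: ex_derive.
  + by apply: cvg_at_right_filter; exact: cF.
  + by apply: cvg_at_left_filter; exact: cF.
- by move=> x _; rewrite derive1E; exact: derive_val.
Qed.

(** The substitution t -> pi - t reverses the sign of cos t; the parity arguments for V and its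
    derivative rest on it. *)
Lemma Av_refl f : continuous f -> Av (fun t => f (pi - t)) = Av f.
Proof.
move=> cf; rewrite /Av; congr (_ * _); rewrite /Rintegral; congr fine.
have dF (x : R) : is_derive x 1 (fun t : R => pi - t) (-1).
  by apply: is_derive_eq; ring.
have F' : derive1 (fun t : R => pi - t) = fun=> -1.
  by apply/funext => x; rewrite derive1E; exact: derive_val.
have cF := is_derive_cont dF.
have := @integration_by_substitution_decreasing R (fun t => pi - t) f 0 pi (pi_ge0 R).
rewrite subrr subr0 => ->.
- by apply: eq_integral => t _ /=; rewrite F' fctE/= opprK mulr1.
- by move=> x y _ _ xy; rewrite ltrD2l ltrN2.
- by rewrite F' => x _; exact: cvg_cst.
- by rewrite F'; exact: is_cvg_cst.
- by rewrite F'; exact: is_cvg_cst.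
- split.
  + by move=> x _; exact: ex_derive.
  + by apply: cvg_at_right_filter; exact: cF.
  + by apply: cvg_at_left_filter; exact: cF.
- exact: continuous_subspaceT.
Qed.

Lemma is_derive_sinn k (t : R) : is_derive t 1 (fun t => sin (k * t)) (k * cos (k * t)).
Proof.
have h : is_derive t 1 (fun t => k * t) k.
  by apply: is_derive_eq; rewrite /GRing.scale/= mulr1.
have := @is_derive1_comp R (@sin R) (fun t => k * t) t _ _ (is_derive_sin _) h.
by rewrite mulrC.
Qed.

Lemma is_derive_cosn k (t : R) : is_derive t 1 (fun t => cos (k * t)) (- (k * sin (k * t))).
Proof.
have h : is_derive t 1 (fun t => k * t) k.
  by apply: is_derive_eq; rewrite /GRing.scale/= mulr1.
have := @is_derive1_comp R (@cos R) (fun t => k * t) t _ _ (is_derive_cos _) h.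
by rewrite mulrC mulrN.
Qed.

Lemma continuous_cosn k : continuous (fun t : R => cos (k * t)).
Proof. exact: is_derive_cont (is_derive_cosn k). Qed.

Lemma continuous_sinn k : continuous (fun t : R => sin (k * t)).
Proof. exact: is_derive_cont (is_derive_sinn k). Qed.

Lemma sin_npi n : sin (n%:R * pi) = 0 :> R.
Proof.
elim: n => [|n IH]; first by rewrite mul0r sin0.
by rewrite -natr1 mulrDl mul1r sinDpi IH oppr0.
Qed.

Lemma continuousM2 f g : continuous f -> continuous g -> continuous (fun t => f t * g t).
Proof. by move=> cf cg t; apply: cvgM; [exact: cf|exact: cg]. Qed.

Lemma continuousD2 f g : continuous f -> continuous g -> continuous (fun t => f t + g t).
Proof. by move=> cf cg t; apply: cvgD; [exact: cf|exact: cg]. Qed.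

Lemma continuousB2 f g : continuous f -> continuous g -> continuous (fun t => f t - g t).
Proof. by move=> cf cg t; apply: cvgB; [exact: cf|exact: cg]. Qed.

Lemma continuous_comp2 f g : continuous f -> continuous g -> continuous (fun t => f (g t)).
Proof. by move=> cf cg t; apply: (cvg_comp _ f); [exact: cg|exact: cf]. Qed.

Lemma continuousX2 f n : continuous f -> continuous (fun t => f t ^+ n).
Proof.
move=> cf; elim: n => [|n IH].
  rewrite (_ : (fun t => _) = fun=> 1); first exact: continuous_cst.
  by apply/funext => t; rewrite expr0.
rewrite (_ : (fun t => _) = fun t => f t * f t ^+ n); first exact: continuousM2.
by apply/funext => t; rewrite exprS.
Qed.

Lemma continuousN2 f : continuous f -> continuous (fun t => - f t).
Proof. by move=> cf t; apply: cvgN; exact: cf. Qed.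

Lemma continuous_id2 : continuous (fun t : R => t).
Proof. by move=> t; exact: cvg_id. Qed.

Lemma Av_cosn n : (0 < n)%N -> Av (fun t => cos (n%:R * t)) = 0.
Proof.
move=> n0; have nn : n%:R != 0 :> R by rewrite pnatr_eq0 -lt0n.
apply: (mulfI nn); rewrite mulr0 -AvZ; last exact: continuous_cosn.
rewrite (Av_FTC (is_derive_sinn n%:R)).
  by rewrite sin_npi mulr0 sin0 subrr mulr0.
exact: continuousM2 (@continuous_cst _) (@continuous_cosn _).
Qed.

Lemma Av_ibp (F f G g : R -> R) :
  (forall t : R, is_derive t 1 F (f t)) -> (forall t : R, is_derive t 1 G (g t)) ->
  continuous f -> continuous g -> F pi * G pi = F 0 * G 0 ->
  Av (fun t => F t * g t) = - Av (fun t => f t * G t).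
Proof.
move=> dF dG cf cg h; have cF := is_derive_cont dF; have cG := is_derive_cont dG.
apply/eqP; rewrite -subr_eq0 opprK -AvD; [|exact: continuousM2..].
have dFG (t : R) : is_derive t 1 (fun t => F t * G t) (F t * g t + f t * G t).
  have := @is_deriveM R R F G t 1 _ _ (dF t) (dG t).
  by rewrite /GRing.scale/= (mulrC (G t)).
rewrite (Av_FTC dFG); first by rewrite h subrr mulr0.
by apply: continuousD2; exact: continuousM2.
Qed.

End ArcsineMean.

Ltac cont := solve [repeat
  lazymatch goal with
  | |- continuous (fun t => @?f t * @?g t) => apply (@continuousM2 _ f g)
  | |- continuous (fun t => @?f t - @?g t) => apply (@continuousB2 _ f g)
  | |- continuous (fun t => - @?f t) => apply (@continuousN2 _ f)
  | |- continuous (fun t => @?f t + @?g t) => apply (@continuousD2 _ f g)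
  | |- continuous (fun t => @?f t ^+ ?n) => apply (@continuousX2 _ f n)
  | |- continuous (fun t => cos t) => exact (@continuous_cos _)
  | |- continuous (fun t => sin t) => exact (@continuous_sin _)
  | |- continuous (fun t => t) => exact (@continuous_id2 _)
  | |- _ => first [assumption|exact: continuous_cst|exact (@continuous_cos _)|exact (@continuous_sin _)|exact: continuous_cosn|exact: continuous_sinn]
  end].

(** * Cosine and sine coefficients *)

Section CosineSeries.
Variable R : realType.
Implicit Types (f g : R -> R) (q phi t M e : R) (n N K : nat).

(** The factors 1 and 2 are pi / h_n, so that f is the sum of [fcos f n] cos(n t). *)
Definition fcos f n : R := (if n == 0%N then 1 else 2) * Av (fun t => f t * cos (n%:R * t)).
Definition fsin g n : R := 2 * Av (fun t => g t * sin (n%:R * t)).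

(** On [0, pi] alone, extending f evenly (or g oddly) to the circle folds the convolution with the
    kernel into a combination of the angles phi and - phi. *)
Definition poisS q phi t : R := (pois q (t - phi) + pois q (t + phi)) / 2.
Definition cpoisS q phi t : R := cpois q (t + phi) + cpois q (t - phi).

Lemma continuous_shift k : continuous (fun t : R => t + k).
Proof. by move=> t; apply: cvgD; [exact: cvg_id|exact: cvg_cst]. Qed.

Lemma continuous_poisS q phi : 0 <= q < 1 -> continuous (poisS q phi).
Proof.
move=> q01 t; apply: cvgM; last exact: cvg_cst.
apply: cvgD.
  exact: (continuous_comp2 (continuous_pois q01) (@continuous_shift (- phi))).
exact: (continuous_comp2 (continuous_pois q01) (@continuous_shift phi)).
Qed.

Lemma continuous_cpoisS q phi : 0 <= q < 1 -> continuous (cpoisS q phi).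
Proof.
move=> q01 t; apply: cvgD.
  exact: (continuous_comp2 (continuous_cpois q01) (@continuous_shift phi)).
exact: (continuous_comp2 (continuous_cpois q01) (@continuous_shift (- phi))).
Qed.

Lemma poisS_ge0 q phi t : 0 <= q < 1 -> 0 <= poisS q phi t.
Proof. by move=> q01; rewrite divr_ge0// addr_ge0// pois_ge0. Qed.

(** The truncated Abel sum is exactly the mean of f against the truncated kernel [k], so no series
    is exchanged with an integral. The error is uniform in phi. *)
Lemma fcos_sum_pois f q phi M N : continuous f -> 0 <= q < 1 ->
  (forall t, 0 <= t <= pi -> `|f t| <= M) ->
  `|\sum_(0 <= n < N.+1) q ^+ n * fcos f n * cos (n%:R * phi)
     - Av (fun t => f t * poisS q phi t)| <= M * (4 * q ^+ N / (1 - q) ^+ 2).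
Proof.
move=> cf q01 fM.
pose k t := ((1 + 2 * (\sum_(1 <= n < N.+1) q ^+ n * cos (n%:R * (t - phi)))) +
             (1 + 2 * (\sum_(1 <= n < N.+1) q ^+ n * cos (n%:R * (t + phi))))) / 2.
have kE t : k t = 1 + \sum_(1 <= n < N.+1) (2 * q ^+ n * cos (n%:R * phi)) * cos (n%:R * t).
  rewrite /k; set A := \sum_(_ <= _ < _) _; set B := \sum_(_ <= _ < _) _.
  have -> : (1 + 2 * A + (1 + 2 * B)) / 2 = 1 + (A + B) by field.
  congr (_ + _); rewrite -big_split/=; apply: eq_bigr => n _.
  by rewrite mulrBr mulrDr cosB cosD; ring.
have ck : continuous (fun t => \sum_(1 <= n < N.+1) (2 * q ^+ n * cos (n%:R * phi)) * cos (n%:R * t)).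
  apply: continuous_sum => n; apply: continuousM2; first exact: continuous_cst.
  exact: continuous_cosn.
have kC : continuous k.
  rewrite (_ : k = fun t => 1 + \sum_(1 <= n < N.+1) (2 * q ^+ n * cos (n%:R * phi)) * cos (n%:R * t)).
    by apply: continuousD2 => //; exact: continuous_cst.
  by apply/funext => t; rewrite kE.
have -> : \sum_(0 <= n < N.+1) q ^+ n * fcos f n * cos (n%:R * phi) = Av (fun t => f t * k t).
  transitivity (Av (fun t => f t + \sum_(1 <= n < N.+1) (2 * q ^+ n * cos (n%:R * phi)) * (f t * cos (n%:R * t)))).
    rewrite AvD//; last first.
      apply: continuous_sum => n; apply: continuousM2; first exact: continuous_cst.
      by apply: continuousM2 => //; exact: continuous_cosn.
    rewrite Av_sum; last first.
      move=> n; apply: continuousM2; first exact: continuous_cst.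
      by apply: continuousM2 => //; exact: continuous_cosn.
    rewrite big_ltn//; congr (_ + _).
      rewrite expr0 mul1r mul0r cos0 mulr1 /fcos/= mul1r.
      by apply: Av_eq => t; rewrite mul0r cos0 mulr1.
    apply: eq_big_nat => n /andP[n0 _]; rewrite AvZ; last first.
      by apply: continuousM2 => //; exact: continuous_cosn.
    by rewrite /fcos eqn0Ngt n0/=; ring.
  apply: Av_eq => t; rewrite kE mulrDr mulr1 mulr_sumr; congr (_ + _).
  by apply: eq_bigr => n _; ring.
have cp := @continuous_poisS q phi q01.
rewrite -AvB; [|exact: continuousM2..].
apply: Av_norm; first by apply: continuousB2; exact: continuousM2.
move=> t /fM ftM; rewrite -mulrBr normrM; apply: ler_pM => //.
rewrite /k /poisS -mulrBl normrM [X in _ * X]ger0_norm// ler_pdivrMr//.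
set a := 1 + _; set b := 1 + _; set c := pois _ _; set d := pois _ _.
have -> : a + b - (c + d) = (a - c) + (b - d) by ring.
apply: le_trans (ler_normD _ _) _.
by rewrite mulr_natr mulr2n lerD//; exact: sum_cos_pois.
Qed.

Lemma fsin_sum_cpois g q phi M N : continuous g -> 0 <= q < 1 ->
  (forall t, 0 <= t <= pi -> `|g t| <= M) ->
  `|\sum_(1 <= n < N.+1) q ^+ n * fsin g n * cos (n%:R * phi)
     - Av (fun t => g t * cpoisS q phi t)| <= M * (4 * q ^+ N / (1 - q) ^+ 2).
Proof.
move=> cg q01 gM.
pose k t := (\sum_(1 <= n < N.+1) q ^+ n * sin (n%:R * (t + phi))) +
            (\sum_(1 <= n < N.+1) q ^+ n * sin (n%:R * (t - phi))).
have kE t : k t = \sum_(1 <= n < N.+1) (2 * q ^+ n * cos (n%:R * phi)) * sin (n%:R * t).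
  rewrite /k -big_split/=; apply: eq_bigr => n _.
  by rewrite mulrBr mulrDr sinB sinD; ring.
have kC : continuous k.
  rewrite (_ : k = fun t => \sum_(1 <= n < N.+1) (2 * q ^+ n * cos (n%:R * phi)) * sin (n%:R * t)).
    apply: continuous_sum => n; apply: continuousM2; first exact: continuous_cst.
    exact: continuous_sinn.
  by apply/funext => t; rewrite kE.
have -> : \sum_(1 <= n < N.+1) q ^+ n * fsin g n * cos (n%:R * phi) = Av (fun t => g t * k t).
  transitivity (Av (fun t => \sum_(1 <= n < N.+1) (2 * q ^+ n * cos (n%:R * phi)) * (g t * sin (n%:R * t)))).
    have cgs n : continuous (fun t => g t * sin (n%:R * t)).
      by apply: continuousM2 => //; exact: continuous_sinn.
    rewrite Av_sum; last first.
      by move=> n; apply: continuousM2; [exact: continuous_cst|].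
    by apply: eq_bigr => n _; rewrite AvZ// /fsin; ring.
  apply: Av_eq => t; rewrite kE mulr_sumr.
  by apply: eq_bigr => n _; ring.
have cp := @continuous_cpoisS q phi q01.
rewrite -AvB; [|exact: continuousM2..].
apply: Av_norm; first by apply: continuousB2; exact: continuousM2.
move=> t /gM gtM; rewrite -mulrBr normrM; apply: ler_pM => //.
rewrite /k /cpoisS.
set a := \sum_(_ <= _ < _) _; set b := \sum_(_ <= _ < _) _; set c := cpois _ _; set d := cpois _ _.
have -> : a + b - (c + d) = (a - c) + (b - d) by ring.
apply: le_trans (ler_normD _ _) _.
have -> : 4 * q ^+ N / (1 - q) ^+ 2 = (2 * q ^+ N / (1 - q) ^+ 2) + (2 * q ^+ N / (1 - q) ^+ 2).
  by ring.
by apply: lerD; exact: sum_sin_cpois.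
Qed.

Lemma bounded_cont f : continuous f -> exists2 M, 0 <= M & forall t, 0 <= t <= pi -> `|f t| <= M.
Proof.
move=> cf.
have [c _ hc] := @EVT_max R (fun t => `|f t|) 0 pi (pi_ge0 R) (continuous_subspaceT (fun t => @continuous_comp _ _ _ f (@Num.norm R R) t (cf t) (@norm_continuous _ _ _))).
by exists `|f c| => // t h; apply: hc; rewrite in_itv.
Qed.

Lemma eq_small (x y A q : R) N0 : 0 <= q < 1 -> 0 <= A ->
  (forall N, (N0 <= N)%N -> `|x - y| <= A * q ^+ N) -> x = y.
Proof.
move=> q01 A0 h; apply/eqP; rewrite -subr_eq0 -normr_le0; apply/ler_addgt0Pr => e e0.
have [N1 hN] := geo_small q01 A0 e0.
rewrite add0r; apply: le_trans (h (maxn N0 N1) (leq_maxl _ _)) _.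
by apply: hN; exact: leq_maxr.
Qed.

Lemma Av_cosB (n m : nat) : Av (fun t : R => cos ((n%:R - m%:R) * t)) = (n == m)%:R.
Proof.
have [->|] := eqVneq n m.
  by rewrite -[RHS](Av_cst 1); apply: Av_eq => t; rewrite subrr mul0r cos0.
rewrite neq_ltn => /orP[nm|mn].
  rewrite /= mulr0n -(@Av_cosn R (m - n)) ?subn_gt0//; apply: Av_eq => t.
  by rewrite natrB ?(ltnW nm)// -cosN -mulNr opprB.
rewrite /= mulr0n -(@Av_cosn R (n - m)) ?subn_gt0//; apply: Av_eq => t.
by rewrite natrB ?(ltnW mn).
Qed.

Lemma Av_cosD (n m : nat) : Av (fun t : R => cos ((n%:R + m%:R) * t)) = (n + m == 0)%N%:R.
Proof.
have [nm|] := eqVneq (n + m)%N 0%N.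
  by rewrite -[RHS](Av_cst 1); apply: Av_eq => t; rewrite -natrD nm mul0r cos0.
rewrite -lt0n => nm; rewrite /= mulr0n -(@Av_cosn R (n + m))//; apply: Av_eq => t.
by rewrite natrD.
Qed.

Lemma fcos_cosn k n : fcos (fun t => cos (k%:R * t)) n = (n == k)%:R.
Proof.
rewrite /fcos.
have -> : (fun t : R => cos (k%:R * t) * cos (n%:R * t)) =
  fun t => 2^-1 * cos ((k%:R + n%:R) * t) + 2^-1 * cos ((k%:R - n%:R) * t).
  by apply/funext => t; rewrite mulrDl mulrBl cosD cosB; field.
have cc (x : R) : continuous (fun t : R => cos (x * t)) by exact: continuous_cosn.
have cz (x : R) : continuous (fun t : R => 2^-1 * cos (x * t)).
  by apply: continuousM2 => //; exact: continuous_cst.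
rewrite AvD// !AvZ// Av_cosD Av_cosB (eq_sym k) addn_eq0.
by case: n => [|n]; case: k => [|k] /=; rewrite ?(mulr1n, mulr0n); try field.
Qed.

Lemma fsin_sin n : (0 < n)%N -> fsin sin n = (n == 1)%N%:R.
Proof.
move=> n0; rewrite /fsin.
have -> : (fun t : R => sin t * sin (n%:R * t)) =
  fun t => 2^-1 * cos ((n%:R - 1%:R) * t) - 2^-1 * cos ((n%:R + 1%:R) * t).
  by apply/funext => t; rewrite mulrBl mulrDl !mul1r cosB cosD; field.
have cc (x : R) : continuous (fun t : R => cos (x * t)) by exact: continuous_cosn.
have cz (x : R) : continuous (fun t : R => 2^-1 * cos (x * t)).
  by apply: continuousM2 => //; exact: continuous_cst.
rewrite AvB// !AvZ// Av_cosD Av_cosB addn_eq0 andbF/=; by field.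
Qed.

Lemma sum_delta (u : nat -> R) a k N : (a <= k <= N)%N ->
  \sum_(a <= n < N.+1) (n == k)%:R * u n = u k.
Proof.
move=> /andP[ak kN]; rewrite (big_cat_nat (n := k))//=; last by rewrite (leq_trans kN).
rewrite big_nat big1 ?add0r; last by move=> n /andP[_ /ltn_eqF ->]; rewrite mul0r.
rewrite big_ltn ?ltnS// eqxx mul1r big_nat big1 ?addr0// => n /andP[/gtn_eqF -> _].
by rewrite mul0r.
Qed.

(** The Poisson mean damps the k-th harmonic by q^k: in [fcos_sum_pois] only the term n = k survives
    once N >= k. *)
Lemma Av_cosn_poisS k q phi : 0 <= q < 1 ->
  Av (fun t => cos (k%:R * t) * poisS q phi t) = q ^+ k * cos (k%:R * phi).
Proof.
move=> q01; symmetry.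
have q1 : 0 < 1 - q by rewrite subr_gt0; case/andP: q01.
apply: (@eq_small _ _ (4 / (1 - q) ^+ 2) q k) => //.
  by rewrite divr_ge0// sqr_ge0.
move=> N kN.
have := @fcos_sum_pois (fun t => cos (k%:R * t)) q phi 1 N (@continuous_cosn _ _) q01.
have -> : \sum_(0 <= n < N.+1) q ^+ n * fcos (fun t => cos (k%:R * t)) n * cos (n%:R * phi) =
  q ^+ k * cos (k%:R * phi).
  rewrite -(@sum_delta (fun n => q ^+ n * cos (n%:R * phi)) 0 k N)//.
  by apply: eq_bigr => n _; rewrite fcos_cosn; ring.
move=> h; apply: le_trans (h _) _; first by move=> t _; exact: cos_max.
by rewrite mul1r mulrAC.
Qed.

Lemma Av_sin_cpoisS q phi : 0 <= q < 1 ->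
  Av (fun t => sin t * cpoisS q phi t) = q * cos phi.
Proof.
move=> q01; symmetry.
apply: (@eq_small _ _ (4 / (1 - q) ^+ 2) q 1) => //.
  by rewrite divr_ge0// sqr_ge0.
move=> N kN.
have := @fsin_sum_cpois sin q phi 1 N (@continuous_sin _) q01.
have -> : \sum_(1 <= n < N.+1) q ^+ n * fsin sin n * cos (n%:R * phi) =
  q * cos phi.
  rewrite -[RHS](_ : q ^+ 1 * cos (1%:R * phi) = _); last by rewrite expr1 mul1r.
  rewrite -(@sum_delta (fun n => q ^+ n * cos (n%:R * phi)) 1 1 N)//.
  by apply: eq_big_nat => n /andP[n0 _]; rewrite fsin_sin//; ring.
move=> h; apply: le_trans (h _) _; first by move=> t _; exact: sin_max.
by rewrite mul1r mulrAC.
Qed.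

(* Korovkin's argument: only the first three cosine moments of the kernel are used. *)
Lemma poisS_lipschitz f (L q phi d : R) : continuous f -> 0 <= q < 1 -> 0 < d -> 0 <= L ->
  (forall t s : R, `|f t - f s| <= L * `|cos t - cos s|) ->
  `|Av (fun t => f t * poisS q phi t) - f phi| <= L * (d + 2 * (1 - q) / d) / 2.
Proof.
move=> cf q01 d0 L0 fL; have cp := @continuous_poisS q phi q01.
have A0 : Av (poisS q phi) = 1.
  rewrite -[RHS](_ : q ^+ 0 * cos (0%:R * phi) = _); last by rewrite mul0r cos0 mul1r.
  by rewrite -Av_cosn_poisS//; apply: Av_eq => t; rewrite mul0r cos0 mul1r.
have A1 : Av (fun t => cos t * poisS q phi t) = q * cos phi.
  rewrite -[RHS](_ : q ^+ 1 * cos (1%:R * phi) = _); last by rewrite mul1r expr1.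
  by rewrite -Av_cosn_poisS//; apply: Av_eq => t; rewrite mul1r.
have A2 : Av (fun t => cos (2%:R * t) * poisS q phi t) = q ^+ 2 * cos (2%:R * phi).
  by rewrite -Av_cosn_poisS.
have c2 (t : R) : cos (2%:R * t) = 2 * cos t ^+ 2 - 1.
  by rewrite mulr_natl cos_mulr2n -mulr_natl.
have cc := @continuous_cos R.
have cc2 := @continuous_cosn R 2%:R.
have cC := @continuous_cst R.
(* The second moment of cos t - cos phi under the kernel is (1 - q^2) / 2 + (1 - q)^2 cos(phi)^2,
   hence of order 1 - q. *)
have Asq : Av (fun t => (cos t - cos phi) ^+ 2 * poisS q phi t) <= 2 * (1 - q).
  have -> : Av (fun t => (cos t - cos phi) ^+ 2 * poisS q phi t) =
     (2^-1 + cos phi ^+ 2) * Av (poisS q phi)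
     - 2 * cos phi * Av (fun t => cos t * poisS q phi t)
     + 2^-1 * Av (fun t => cos (2%:R * t) * poisS q phi t).
    rewrite -!AvZ; [|cont..].
    rewrite -AvB; [|cont..]; rewrite -AvD; [|cont..].
    by apply: Av_eq => t; rewrite c2; field.
  rewrite A0 A1 A2 c2; move: q01 => /andP[q0 q1].
  have := cos_le1 phi; have := cos_geN1 phi; set c := cos phi; move=> h1 h2.
  have c21 : c ^+ 2 <= 1 by nra.
  have : (1 - q) ^+ 2 * c ^+ 2 <= (1 - q) ^+ 2 by rewrite ler_piMr// sqr_ge0.
  nra.
have -> : Av (fun t => f t * poisS q phi t) - f phi = Av (fun t => (f t - f phi) * poisS q phi t).
  rewrite [X in _ - X = _](_ : f phi = f phi * Av (poisS q phi)); last by rewrite A0 mulr1.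
  rewrite -AvZ// -AvB; [|exact: continuousM2|exact: continuousM2].
  by apply: Av_eq => t; ring.
have cfp : continuous (fun t => (f t - f phi) * poisS q phi t).
  by apply: continuousM2 => //; apply: continuousB2.
(* By |x| <= (d + x^2 / d) / 2 the first absolute moment is controlled by the second; d is then
   chosen so that 1 - q is at most d^2 / 2. *)
pose G t := L / 2 * d * poisS q phi t + L / 2 / d * ((cos t - cos phi) ^+ 2 * poisS q phi t).
have cs : continuous (fun t => (cos t - cos phi) ^+ 2 * poisS q phi t).
  apply: continuousM2 => //; apply: (@continuousM2 R (fun t => cos t - cos phi) (fun t => cos t - cos phi));
    by apply: continuousB2.
have cG : continuous G.
  by apply: continuousD2; apply: continuousM2.
have AG : Av G <= L * (d + 2 * (1 - q) / d) / 2.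
  rewrite /G AvD; [|by apply: continuousM2..].
  rewrite !AvZ// A0.
  have h : L / 2 / d * Av (fun t => (cos t - cos phi) ^+ 2 * poisS q phi t) <= L / 2 / d * (2 * (1 - q)).
    by rewrite ler_wpM2l// divr_ge0// ?divr_ge0// ltW.
  apply: le_trans (lerD (lexx _) h) _.
  rewrite le_eqVlt; apply/orP; left; apply/eqP; field.
  by rewrite gt_eqF.
have key t : `|(f t - f phi) * poisS q phi t| <= G t.
  rewrite normrM (ger0_norm (poisS_ge0 _ _ q01)) /G mulrA -mulrDl.
  rewrite ler_wpM2r ?poisS_ge0//; apply: le_trans (fL _ _) _.
  have -> : L / 2 * d + L / 2 / d * (cos t - cos phi) ^+ 2 = L * ((d + (cos t - cos phi) ^+ 2 / d) / 2).
    by field; rewrite gt_eqF.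
  rewrite ler_wpM2l// ler_pdivlMr//.
  rewrite -(ler_pM2r d0) mulrDl divfK ?gt_eqF//.
  rewrite -(real_normK (num_real (cos t - cos phi))); set x := `|_|.
  have := sqr_ge0 (d - x); nra.
apply: le_trans _ AG; rewrite ler_norml; apply/andP; split.
  rewrite -mulN1r -AvZ//; apply: Av_le => //; first by apply: continuousM2.
  by move=> t _; have := key t; rewrite ler_norml mulN1r => /andP[].
by apply: Av_le => // t _; have := key t; rewrite ler_norml => /andP[].
Qed.

End CosineSeries.

(** * Series with quadratically decaying coefficients *)

Section QuadraticDecay.
Variable R : realType.
Implicit Types (h u : nat -> R) (M q e : R) (n N K : nat).

Definition quad_decay h M := forall n, (0 < n)%N -> `|h n| <= M / n%:R ^+ 2.

Lemma cvg_dist_le (v : nat -> R) (l a b : R) N0 : v @ \oo --> l ->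
  (forall N, (N0 <= N)%N -> `|v N - a| <= b) -> `|l - a| <= b.
Proof.
move=> /cvgrPdist_le vl h; apply/ler_addgt0Pr => e e0.
have [N1 _ hN] := vl _ e0; set N := maxn N0 N1.
have -> : l - a = (v N - a) + (l - v N) by ring.
apply: le_trans (ler_normD _ _) _; apply: lerD; first exact/h/leq_maxl.
by apply: hN => /=; exact: leq_maxr.
Qed.

(** Comparison with a telescoping sum, from 1 / (n + 1)^2 <= 1 / n - 1 / (n + 1). *)
Lemma quad_decay_norm h M K N : quad_decay h M -> 0 <= M -> (0 < K)%N ->
  \sum_(K.+1 <= n < N) `|h n| <= M / K%:R.
Proof.
move=> hM M0 K0; have K0' : 0 < K%:R :> R by rewrite ltr0n.
have [NK|KN] := leqP N K.+1; first by rewrite big_geq// divr_ge0// ltW.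
have [j ->] : exists j, N = (K.+1 + j)%N by exists (N - K.+1)%N; rewrite subnKC// ltnW.
have : \sum_(K.+1 <= n < K.+1 + j) `|h n| <= M * (K%:R^-1 - (K + j)%:R^-1).
  elim: j => [|j IH]; first by rewrite addn0 big_geq// addn0 subrr mulr0.
  rewrite addnS big_nat_recr/= ?leq_addr//.
  apply: le_trans (lerD IH (hM _ (ltn0Sn _))) _.
  rewrite -mulrDr ler_wpM2l// ?addnS ?addSn.
  have Kj : 0 < (K + j)%:R :> R by rewrite ltr0n addn_gt0 K0.
  have -> : (K + j).+1%:R = (K + j)%:R + 1 :> R by rewrite natr1.
  move: Kj; move: (K + j)%:R => x x0; rewrite -addrA lerD2l lerNr opprD opprK.
  have x1 : 0 < x + 1 by rewrite addr_gt0.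
  rewrite -subr_ge0.
  have -> : x^-1 - ((x + 1) ^- 2) - (x + 1)^-1 = ((x + 1) ^+ 2 * x)^-1.
    by field; rewrite !gt_eqF.
  by rewrite invr_ge0 mulr_ge0 ?sqr_ge0// ltW.
by move=> h0; apply: le_trans h0 _; rewrite ler_wpM2l// gerBl invr_ge0 ler0n.
Qed.

Lemma quad_decay_tail h M u K N : quad_decay h M -> 0 <= M -> (0 < K)%N ->
  (forall n, `|u n| <= 1) -> `|\sum_(K.+1 <= n < N) h n * u n| <= M / K%:R.
Proof.
move=> hM M0 K0 u1; apply: le_trans (quad_decay_norm N hM M0 K0).
apply: le_trans (ler_norm_sum _ _ _) _; apply: ler_sum => n _.
by rewrite normrM ler_piMr.
Qed.

Lemma quad_decay_diff h M u K N : quad_decay h M -> 0 <= M -> (0 < K)%N ->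
  (forall n, `|u n| <= 1) -> (K < N)%N ->
  `|\sum_(1 <= n < N) h n * u n - \sum_(1 <= n < K.+1) h n * u n| <= M / K%:R.
Proof.
move=> hM M0 K0 u1 KN; rewrite (big_cat_nat (n := K.+1))//= addrAC subrr add0r.
exact: quad_decay_tail.
Qed.

Lemma exists_inv_le M e : 0 <= M -> 0 < e -> exists2 K, (0 < K)%N & M / K%:R <= e.
Proof.
move=> M0 e0; exists (Num.truncn (M / e)).+1 => //.
rewrite ler_pdivrMr ?ltr0n// mulrC -ler_pdivrMr//; apply: ltW.
exact: truncnS_gt.
Qed.

Lemma quad_decay_cvg h M u : quad_decay h M -> 0 <= M -> (forall n, `|u n| <= 1) ->
  cvgn (fun N => \sum_(1 <= n < N) h n * u n).
Proof.
move=> hM M0 u1; apply: cauchy_cvg; apply: cauchy_exP => e e0.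
have [K K0 hK] := exists_inv_le M0 (divr_gt0 e0 (@ltr0n R 2)).
exists (\sum_(1 <= n < K.+1) h n * u n); exists K.+1 => // N /= KN.
rewrite /ball/= distrC; apply: le_lt_trans (quad_decay_diff hM M0 K0 u1 KN) _.
by apply: le_lt_trans hK _; rewrite ltr_pdivrMr// ltr_pMr// ltr1n.
Qed.

Lemma quad_decay_lim h M u l K : quad_decay h M -> 0 <= M -> (forall n, `|u n| <= 1) ->
  (fun N => \sum_(1 <= n < N) h n * u n) @ \oo --> l -> (0 < K)%N ->
  `|l - \sum_(1 <= n < K.+1) h n * u n| <= M / K%:R.
Proof.
move=> hM M0 u1 hl K0; apply: (cvg_dist_le hl (N0 := K.+1)) => N KN.
exact: quad_decay_diff.
Qed.

Lemma one_sub_exp q n : 0 <= q <= 1 -> 0 <= 1 - q ^+ n <= n%:R * (1 - q).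
Proof.
move=> /andP[q0 q1]; elim: n => [|n /andP[IH1 IH2]].
  by rewrite expr0 subrr mul0r lexx.
rewrite exprS -natr1; apply/andP; split; first by nra.
have : q * q ^+ n >= q ^+ n - (1 - q).
  have : q ^+ n <= 1 by lra.
  nra.
lra.
Qed.

(** The threshold d depends on M and e only. On the first K terms 1 - q^n <= n (1 - q) is small;
    beyond them the quadratic decay suffices whatever q is. *)
Lemma abel_uniform M e : 0 <= M -> 0 < e -> exists2 d, 0 < d &
  forall h u q N, quad_decay h M -> (forall n, `|u n| <= 1) -> 0 <= q <= 1 -> 1 - q <= d ->
  `|\sum_(1 <= n < N) h n * u n - \sum_(1 <= n < N) q ^+ n * h n * u n| <= e.
Proof.
move=> M0 e0; have e2 : 0 < e / 2 by rewrite divr_gt0.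
have [K K0 hK] := exists_inv_le M0 e2.
(* The head contributes at most K * (K (1 - q)) * M; the added 1 keeps the denominator positive when
   M = 0. *)
have KM : 0 < K%:R * M * K%:R + 1 by rewrite ltr_wpDl// mulr_ge0// mulr_ge0.
exists (e / 2 / (K%:R * M * K%:R + 1)); first by rewrite divr_gt0.
move=> h u q N hM u1 q01 qd; have [q0 q1] := andP q01.
have q1' : 0 <= 1 - q by rewrite subr_ge0.
rewrite -sumrB; apply: le_trans (ler_norm_sum _ _ _) _.
have step : \sum_(1 <= n < N) `|h n * u n - q ^+ n * h n * u n| <=
            \sum_(1 <= n < N) (1 - q ^+ n) * `|h n|.
  apply: ler_sum => n _; have /andP[a b] := one_sub_exp n q01.
  have -> : h n * u n - q ^+ n * h n * u n = (1 - q ^+ n) * (h n * u n) by ring.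
  rewrite normrM (ger0_norm a) ler_wpM2l// normrM ler_piMr//.
apply: le_trans step _.
have F0 n : 0 <= (1 - q ^+ n) * `|h n|.
  by rewrite mulr_ge0//; have /andP[] := one_sub_exp n q01.
have head : \sum_(1 <= n < K.+1) (1 - q ^+ n) * `|h n| <= e / 2.
  apply: (@le_trans _ _ (\sum_(1 <= n < K.+1) (K%:R * (1 - q) * M))).
    rewrite big_nat [leRHS]big_nat; apply: ler_sum => n /andP[n0 nK].
    have /andP[a b] := one_sub_exp n q01.
    have n1 : 1 <= n%:R :> R by rewrite ler1n.
    apply: ler_pM => //.
      by apply: le_trans b _; rewrite ler_wpM2r// ler_nat.
    apply: le_trans (hM _ n0) _; rewrite ler_pdivrMr ?exprn_gt0 ?ltr0n//.
    by rewrite ler_peMr// expr_ge1// ler0n.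
  rewrite sumr_const_nat subSS subn0 -mulr_natr.
  have : (K%:R * M * K%:R + 1) * (1 - q) <= e / 2.
    by rewrite mulrC -ler_pdivlMr.
  have : 0 <= K%:R :> R by []. nra.
have tail : \sum_(K.+1 <= n < N) (1 - q ^+ n) * `|h n| <= e / 2.
  apply: le_trans hK; apply: le_trans (quad_decay_norm N hM M0 K0).
  apply: ler_sum => n _; rewrite ler_piMl//.
  by rewrite gerBl exprn_ge0.
(* A sum that stops before the split at K is dominated by the head alone. *)
have [NK|KN] := leqP N K.+1.
  apply: (@le_trans _ _ (e / 2)); last by rewrite ler_pdivrMr// ler_pMr// ler1n.
  apply: le_trans head.
  have [N0|N0] := leqP N 1; first by rewrite big_geq// sumr_ge0.
  by rewrite [leRHS](big_cat_nat (n := N))//= ?(ltnW N0)// lerDl sumr_ge0.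
rewrite (big_cat_nat (n := K.+1))//=; last exact: ltnW.
have -> : e = e / 2 + e / 2 by field.
exact: lerD.
Qed.

(** Three errors add up: plain sum against Abel sum, Abel sum against Poisson mean, Poisson mean
    against the value of f. The Lipschitz condition is taken in cos t because Korovkin's test
    functions are powers of cos t. *)
Lemma fcos_inversion (f : R -> R) M L e : continuous f -> 0 <= M -> 0 <= L -> 0 < e ->
  (forall t s : R, `|f t - f s| <= L * `|cos t - cos s|) ->
  quad_decay (fcos f) M ->
  exists N0, forall N phi, (N0 <= N)%N ->
    `|\sum_(0 <= n < N) fcos f n * cos (n%:R * phi) - f phi| <= e.
Proof.
move=> cf M0 L0 e0 fL fM.
have e6 : 0 < e / 6 by rewrite divr_gt0.
have [d d0 hd] := abel_uniform M0 e6.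
pose dd := e / 6 / (L + 1).
have L1 : 0 < L + 1 by rewrite ltr_wpDl.
have dd0 : 0 < dd by rewrite divr_gt0.
(* The entry dd^2 / 2 makes 2 (1 - q) / dd at most dd, and L * dd is at most e / 6 by the choice of
   dd. *)
pose q := 1 - Num.min (1 / 2) (Num.min d (dd * dd / 2)).
have q1 : 1 - q <= d by rewrite /q opprB addrC subrK ge_min ge_min lexx orbT.
have q2 : 1 - q <= dd * dd / 2 by rewrite /q opprB addrC subrK !ge_min lexx !orbT.
have q3 : 0 < 1 - q.
  by rewrite /q opprB addrC subrK !lt_min d0 !divr_gt0// mulr_gt0.
have q4 : 1 - q <= 1 / 2 by rewrite /q opprB addrC subrK ge_min lexx.
have q01 : 0 <= q < 1 by apply/andP; split; lra.
have [B B0 fB] := bounded_cont cf.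
have A0 : 0 <= B * (4 / (1 - q) ^+ 2) by rewrite mulr_ge0// divr_ge0// sqr_ge0.
have [N1 hN1] := geo_small q01 A0 e6.
have [K K0 hK] := exists_inv_le M0 e6.
exists (maxn N1 K).+2 => N phi; case: N => [//|N]; rewrite ltnS => NN.
have NN1 : (N1 <= N)%N by rewrite (leq_trans _ (ltnW NN))// leq_maxl.
have step1 : `|\sum_(0 <= n < N.+1) fcos f n * cos (n%:R * phi) -
               \sum_(0 <= n < N.+1) q ^+ n * fcos f n * cos (n%:R * phi)| <= e / 6.
  rewrite big_ltn// [X in _ - X]big_ltn// expr0 mul1r.
  rewrite opprD addrACA subrr add0r; apply: (hd) => //.
    by move=> n; exact: cos_max.
  by apply/andP; split; lra.
have step2 := fcos_sum_pois phi N cf q01 fB.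
have step2' : B * (4 * q ^+ N / (1 - q) ^+ 2) <= e / 6.
  by apply: le_trans (hN1 _ NN1); rewrite -!mulrA [q ^+ N * _]mulrC lexx.
have step3 := poisS_lipschitz phi cf q01 dd0 L0 fL.
have step3' : L * (dd + 2 * (1 - q) / dd) / 2 <= e / 6.
  have h1 : 2 * (1 - q) / dd <= dd by rewrite ler_pdivrMr//; lra.
  have h2 : dd * (L + 1) = e / 6 by rewrite /dd divfK// gt_eqF.
  have h3 : L * (dd + 2 * (1 - q) / dd) <= L * (dd + dd) by rewrite ler_wpM2l// lerD2l.
  lra.
have := step1; have := le_trans step2 step2'; have := le_trans step3 step3'.
set x := \sum_(_ <= _ < _) _; set y := \sum_(_ <= _ < _) _; set z := Av _.
rewrite !ler_norml => /andP[a1 a2] /andP[b1 b2] /andP[c1 c2].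
by apply/andP; split; lra.
Qed.

End QuadraticDecay.

Lemma cvg_sum_cpois (R : realType) (g : R -> R) (q phi : R) : continuous g -> 0 <= q < 1 ->
  (fun N => \sum_(1 <= n < N) q ^+ n * fsin g n * cos (n%:R * phi)) @ \oo -->
  Av (fun t => g t * cpoisS q phi t).
Proof.
move=> cg q01; have [B B0 gB] := bounded_cont cg.
have A0 : 0 <= B * (4 / (1 - q) ^+ 2) by rewrite mulr_ge0// divr_ge0// sqr_ge0.
apply/cvgrPdist_le => e e0; have [N1 hN1] := geo_small q01 A0 e0.
exists N1.+1 => // -[//|N] /= NN1; rewrite distrC.
apply: le_trans (fsin_sum_cpois phi N cg q01 gB) _.
by apply: le_trans (hN1 _ NN1); rewrite -!mulrA [q ^+ N * _]mulrC lexx.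
Qed.

(** Abel's theorem with a rate that ignores g and phi beyond the decay constant, so that a single q
    can be used to compare the series at two angles. *)
Lemma abel_cpois (R : realType) (M e : R) : 0 <= M -> 0 < e -> exists2 d, 0 < d &
  forall (g : R -> R) (q phi l : R), continuous g -> quad_decay (fsin g) M ->
  (fun N => \sum_(1 <= n < N) fsin g n * cos (n%:R * phi)) @ \oo --> l ->
  0 <= q < 1 -> 1 - q <= d -> `|l - Av (fun t => g t * cpoisS q phi t)| <= e.
Proof.
move=> M0 e0; have [d d0 hd] := abel_uniform M0 e0.
exists d => // g q phi l cg gM hl q01 qd.
have h : (fun N => \sum_(1 <= n < N) fsin g n * cos (n%:R * phi) -
   \sum_(1 <= n < N) q ^+ n * fsin g n * cos (n%:R * phi)) @ \oo -->
   l - Av (fun t => g t * cpoisS q phi t).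
  by apply: cvgB => //; exact: cvg_sum_cpois.
have -> : forall x y : R, `|x - y| = `|(x - y) - 0| by move=> x y; rewrite subr0.
apply: (cvg_dist_le (N0 := 0) h) => N _.
rewrite subr0; apply: (hd) => //; first by move=> n; exact: cos_max.
by have /andP[-> /ltW ->] := q01.
Qed.

Lemma bounded_ball (R : realType) (F : R -> R) B : continuous F ->
  exists2 m, 0 <= m & forall x, `|x| <= B -> `|F x| <= m.
Proof.
move=> cF; have [B0|B0] := leP 0 B; last first.
  by exists 0 => // x h; have := le_lt_trans h B0; rewrite normr_lt0.
have BB : - B <= B by lra.
have [c _ hc] := @EVT_max R (fun t => `|F t|) (- B) B BB (continuous_subspaceT
   (fun t => @continuous_comp _ _ _ F (@Num.norm R R) t (cF t) (@norm_continuous _ _ _))).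
by exists `|F c| => // x h; apply: hc; rewrite in_itv/= -ler_norml.
Qed.

Lemma derive_lipschitz (R : realType) (V W : R -> R) B :
  (forall x : R, is_derive x 1 V (W x)) -> continuous W -> exists2 L, 0 <= L &
  forall x y, `|x| <= B -> `|y| <= B -> `|V x - V y| <= L * `|x - y|.
Proof.
move=> dV cW; have cV := is_derive_cont dV.
have [L L0 hL] := bounded_ball B cW; exists L => // x y.
wlog xy : x y / x <= y => [hw xB yB|].
  have [xy|/ltW yx] := leP x y; first exact: hw.
  by rewrite distrC [X in _ * X]distrC; apply: hw.
move=> xB yB.
have [c] := @MVT_segment R V W x y xy (fun z _ => dV z) (continuous_subspaceT cV).
rewrite in_itv/= => /andP[xc cy] E.
rewrite distrC E [X in _ <= _ * X]distrC normrM ler_wpM2r// hL//.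
by move: xB yB; rewrite !ler_norml => /andP[? ?] /andP[? ?]; apply/andP; split; lra.
Qed.

(** The derivatives of V are carried as named functions; convexity is recorded as monotonicity of W
    and symmetry as its oddness, the forms in which the coefficient estimates use them. *)
Record potential (R : realType) (V W W2 W3 : R -> R) : Prop := Potential {
  pot_V : forall x : R, is_derive x 1 V (W x);
  pot_W : forall x : R, is_derive x 1 W (W2 x);
  pot_W2 : forall x : R, is_derive x 1 W2 (W3 x);
  pot_W3 : continuous W3;
  pot_odd : forall x, W (- x) = - W x;
  pot_mono : forall x y, x <= y -> W x <= W y }.

Definition Vcos (R : realType) (V : R -> R) r t := V (r * cos t).
Definition Gsin (R : realType) (W : R -> R) r t := r * sin t * W (r * cos t).
Definition Smean (R : realType) (W : R -> R) r : R := Av (fun t => r * cos t * W (r * cos t)).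

(** * Chebyshev coefficients of a convex potential *)

Section Potential.
Variables (R : realType) (V W W2 W3 : R -> R).
Hypothesis pot : potential V W W2 W3.

Let dV := pot_V pot.
Let dW := pot_W pot.
Let dW2 := pot_W2 pot.
Let cW3 := pot_W3 pot.
Let Wodd := pot_odd pot.
Let Wmono := pot_mono pot.
Let cV : continuous V := is_derive_cont dV.
Let cW : continuous W := is_derive_cont dW.
Let cW2 : continuous W2 := is_derive_cont dW2.
Local Notation Vcos := (Vcos V).
Local Notation Gsin := (Gsin W).
Local Notation Smean := (Smean W).

Lemma continuous_rcos r : continuous (fun t : R => r * cos t).
Proof. cont. Qed.

Lemma continuous_Vcos r : continuous (Vcos r).
Proof. exact: (continuous_comp2 cV (@continuous_rcos r)). Qed.

Lemma continuous_Gsin r : continuous (Gsin r).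
Proof.
have h : continuous (fun t => W (r * cos t)).
  exact: (continuous_comp2 cW (@continuous_rcos r)).
rewrite /Gsin; cont.
Qed.

Lemma is_derive_rcos r (t : R) : is_derive t 1 (fun t => r * cos t) (- (r * sin t)).
Proof. by apply: is_derive_eq; rewrite /GRing.scale/=; ring. Qed.

Lemma is_derive_comp_rcos (F dF : R -> R) r (t : R) : (forall x : R, is_derive x 1 F (dF x)) ->
  is_derive t 1 (fun t => F (r * cos t)) (- (r * sin t) * dF (r * cos t)).
Proof.
move=> hF; have := @is_derive1_comp R F (fun t => r * cos t) t _ _ (hF _) (is_derive_rcos r t).
by rewrite mulrC.
Qed.

Lemma fcos_fsin r n : (0 < n)%N -> n%:R * fcos (Vcos r) n = fsin (Gsin r) n.
Proof.
move=> n0; rewrite /fcos eqn0Ngt n0/= /fsin mulrCA; congr (_ * _).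
have cf := continuous_Vcos (r := r).
rewrite -AvZ; last cont.
have cG := continuous_Gsin (r := r).
transitivity (Av (fun t => Vcos r t * (n%:R * cos (n%:R * t)))).
  by apply: Av_eq => t; ring.
have h := continuous_comp2 cW (@continuous_rcos r).
have cdV : continuous (fun t => - (r * sin t) * W (r * cos t)) by cont.
rewrite (Av_ibp (fun t => is_derive_comp_rcos r t dV) (is_derive_sinn n%:R) cdV).
- rewrite -[LHS]mulN1r -AvZ; last cont.
  by apply: Av_eq => t; rewrite /Gsin; ring.
- cont.
- by rewrite sin_npi mulr0 mulr0 sin0 mulr0.
Qed.

(** Two integrations by parts. The boundary terms vanish first because [Gsin] is zero at 0 and pi,
    then because sin(n t) is; the bounded expression is the second derivative of [Gsin]. *)
Lemma Gsin_decay_aux r n B : continuous (Gsin r) -> (0 < n)%N ->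
  (forall t, `|- (r * sin t) * W (r * cos t) - 3 * (r ^+ 2 * sin t * cos t) * W2 (r * cos t) +
    r ^+ 3 * sin t ^+ 3 * W3 (r * cos t)| <= B) ->
  `|fsin (Gsin r) n| <= 2 * B / n%:R ^+ 2.
Proof.
move=> cG n0 hB.
pose g1 t := r * cos t * W (r * cos t) - r ^+ 2 * sin t ^+ 2 * W2 (r * cos t).
pose g2 t := - (r * sin t) * W (r * cos t) - 3 * (r ^+ 2 * sin t * cos t) * W2 (r * cos t) +
    r ^+ 3 * sin t ^+ 3 * W3 (r * cos t).
have c1 := continuous_comp2 cW (@continuous_rcos r).
have c2 := continuous_comp2 cW2 (@continuous_rcos r).
have c3 := continuous_comp2 cW3 (@continuous_rcos r).
have cg1 : continuous g1 by rewrite /g1; cont.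
have cg2 : continuous g2 by rewrite /g2; cont.
have dG (t : R) : is_derive t 1 (Gsin r) (g1 t).
  have h := is_derive_comp_rcos r t dW.
  have h' : is_derive t 1 (fun t => r * sin t) (r * cos t).
    by apply: is_derive_eq; rewrite /GRing.scale/=; ring.
  have := @is_deriveM R R _ _ t 1 _ _ h' h.
  rewrite (_ : _ + _ = g1 t)// /g1 /GRing.scale/=; ring.
have dg1 (t : R) : is_derive t 1 g1 (g2 t).
  have h := is_derive_comp_rcos r t dW.
  have hh := is_derive_comp_rcos r t dW2.
  have h' := is_derive_rcos r t.
  have h2 : is_derive t 1 (fun t => r ^+ 2 * sin t ^+ 2) (2 * r ^+ 2 * sin t * cos t).
    by apply: is_derive_eq; rewrite /GRing.scale/=; ring.
  have := @is_deriveB _ _ _ _ _ t 1 _ _ (@is_deriveM R R _ _ t 1 _ _ h' h) (@is_deriveM R R _ _ t 1 _ _ h2 hh).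
  rewrite (_ : _ - _ = g2 t)// /g2 /GRing.scale/=; ring.
have n1 : n%:R != 0 :> R by rewrite pnatr_eq0 -lt0n.
have dcn (t : R) : is_derive t 1 (fun t => - cos (n%:R * t)) (n%:R * sin (n%:R * t)).
  have := @is_deriveN _ _ _ _ t 1 _ (is_derive_cosn n%:R t).
  by rewrite opprK.
have E1 : n%:R * Av (fun t => Gsin r t * sin (n%:R * t)) = Av (fun t => g1 t * cos (n%:R * t)).
  rewrite -AvZ; last cont.
  transitivity (Av (fun t => Gsin r t * (n%:R * sin (n%:R * t)))).
    by apply: Av_eq => t; ring.
  rewrite (Av_ibp dG dcn cg1); last 2 first.
  - cont.
  - by rewrite /Gsin sin0 sinpi !(mulr0, mul0r).
  by rewrite -mulN1r -AvZ; [apply: Av_eq => t; ring|cont].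
have E2 : n%:R * Av (fun t => g1 t * cos (n%:R * t)) = - Av (fun t => g2 t * sin (n%:R * t)).
  rewrite -AvZ; last cont.
  transitivity (Av (fun t => g1 t * (n%:R * cos (n%:R * t)))).
    by apply: Av_eq => t; ring.
  rewrite (Av_ibp dg1 (is_derive_sinn n%:R) cg2)//; first cont.
  by rewrite sin_npi !mulr0 sin0 mulr0.
rewrite ler_pdivlMr ?exprn_gt0 ?ltr0n//.
rewrite -[X in _ * X](ger0_norm (exprn_ge0 2 (ler0n R n))) -normrM /fsin.
have -> : 2 * Av (fun t => Gsin r t * sin (n%:R * t)) * n%:R ^+ 2 = - (2 * Av (fun t => g2 t * sin (n%:R * t))).
  by rewrite -mulrN -E2 -E1; ring.
rewrite normrN normrM ger0_norm// ler_pM2l//; apply: Av_norm; first cont.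
move=> t _; rewrite normrM; apply: le_trans (hB t).
by rewrite ler_piMr// sin_max.
Qed.

(** A single constant for all radii up to B makes the tails uniform in r, as continuity in the
    radius requires. *)
Lemma Gsin_decay B : exists2 M, 0 <= M &
  forall r, 0 < r -> r <= B -> quad_decay (fsin (Gsin r)) M.
Proof.
have [m1 m10 h1] := bounded_ball B cW.
have [m2 m20 h2] := bounded_ball B cW2.
have [m3 m30 h3] := bounded_ball B cW3.
have [B0|B0] := ltP 0 B; last first.
  by exists 0 => // r r0 rB; have := lt_le_trans r0 (le_trans rB B0); rewrite ltxx.
exists (2 * (B * m1 + 3 * B ^+ 2 * m2 + B ^+ 3 * m3)).
  by rewrite !(mulr_ge0, addr_ge0)// ?exprn_ge0// ltW.
move=> r r0 rB n n0; apply: Gsin_decay_aux => //; first exact: continuous_Gsin.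
move=> t.
have rc : `|r * cos t| <= B.
  rewrite normrM (gtr0_norm r0); apply: le_trans rB.
  by rewrite ler_piMr ?cos_max// ltW.
have rr n' : r ^+ n' <= B ^+ n' by rewrite lerXn2r// nnegrE ltW.
apply: le_trans (ler_normD _ _) _; apply: lerD; last first.
  rewrite normrM; apply: ler_pM => //; last exact: h3.
  rewrite normrM ![`|_ ^+ _|]normrX (gtr0_norm r0).
  by rewrite -[leRHS]mulr1; apply: ler_pM => //; rewrite ?exprn_ge0 ?exprn_ile1 ?sin_max// ltW.
apply: le_trans (ler_normB _ _) _; apply: lerD.
  rewrite normrM; apply: ler_pM => //; last exact: h1.
  rewrite normrN normrM (gtr0_norm r0).
  by apply: le_trans rB; rewrite ler_piMr ?sin_max// ltW.
rewrite normrM; apply: ler_pM => //; last exact: h2.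
rewrite normrM ger0_norm// ler_pM2l// -mulrA normrM normrX (gtr0_norm r0).
rewrite -[leRHS]mulr1; apply: ler_pM => //.
- by rewrite exprn_ge0// ltW.
- by rewrite normrM mulr_ile1// ?sin_max ?cos_max.
Qed.

Lemma Vcos_decay r M : quad_decay (fsin (Gsin r)) M -> quad_decay (fcos (Vcos r)) M.
Proof.
move=> h n n0; apply: le_trans (h _ n0).
by rewrite -(fcos_fsin r n0) [leRHS]normrM (ger0_norm (ler0n _ _)) ler_peMl// ler1n.
Qed.

Lemma Vcos_lipschitz r : 0 < r -> exists2 L, 0 <= L &
  forall t s, `|Vcos r t - Vcos r s| <= L * `|cos t - cos s|.
Proof.
move=> r0; have [L L0 hL] := derive_lipschitz r dV cW; exists (L * r); first by rewrite mulr_ge0// ltW.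
have rc (t : R) : `|r * cos t| <= r.
  by rewrite normrM (gtr0_norm r0) ler_piMr ?cos_max// ltW.
move=> t s; apply: le_trans (hL _ _ (rc t) (rc s)) _.
by rewrite -mulrBr normrM (gtr0_norm r0) mulrA.
Qed.

Lemma poisS_0 (q t : R) : poisS q 0 t = pois q t.
Proof. by rewrite /poisS subr0 addr0; field. Qed.

Lemma cpoisS_0 (q t : R) : cpoisS q 0 t = 2 * cpois q t.
Proof. by rewrite /cpoisS subr0 addr0 mulr_natl. Qed.

Lemma Av_pois (q : R) : 0 <= q < 1 -> Av (pois q) = 1.
Proof.
move=> q01; have := Av_cosn_poisS 0 0 q01; rewrite expr0 mulr0 cos0 mulr1 => <-.
by apply: Av_eq => t; rewrite mul0r cos0 mul1r poisS_0.
Qed.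

Lemma Av_odd r : Av (fun t => W (r * cos t)) = 0.
Proof.
have c1 := continuous_comp2 cW (@continuous_rcos r).
have := Av_refl c1.
have -> : (fun t : R => W (r * cos (pi - t))) = fun t => -1 * W (r * cos t).
  by apply/funext => t; rewrite cosB cospi sinpi mul0r addr0 !mulN1r mulrN Wodd.
by rewrite AvZ// => h; lra.
Qed.

(** Used twice: as q tends to 1 the right-hand side vanishes, which identifies the sum of the
    series; at fixed q the positivity of [pois] allows W to be replaced by one of its upper
    bounds. *)
Lemma Smean_cpois r q : 0 < q < 1 -> Smean r - Av (fun t => Gsin r t * cpoisS q 0 t) =
  r * (1 - q ^+ 2) / (2 * q) * Av (fun t => W (r * cos t) * pois q t).
Proof.
move=> /andP[q0 q1]; have q01 : 0 <= q < 1 by rewrite ltW.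
have c1 := continuous_comp2 cW (@continuous_rcos r).
have c2 := continuous_Gsin (r := r).
have c3 := continuous_cpoisS (phi := 0) q01.
have c4 := continuous_pois q01.
rewrite /Smean -AvB; [|cont..].
(* By oddness W(r cos t) has mean zero; subtracting a suitable multiple of it turns the claim into a
   pointwise identity. *)
transitivity (r * (1 - q ^+ 2) / (2 * q) * Av (fun t => W (r * cos t) * pois q t) -
  r * (1 + q ^+ 2) / (2 * q) * Av (fun t => W (r * cos t))); last first.
  by rewrite Av_odd mulr0 subr0.
rewrite -!AvZ; [|cont..]; rewrite -AvB; [|cont..].
apply: Av_eq => t; rewrite cpoisS_0 /cpois /pois /Gsin.
have D0 := poisD_gt0 t q01.
transitivity (r * W (r * cos t) * (cos t - 2 * q * (sin t ^+ 2) / poisD q t)).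
  by field; rewrite gt_eqF.
rewrite sin2cos2; move: (lt0r_neq0 D0); rewrite /poisD => D1.
by field; rewrite D1 gt_eqF.
Qed.

Lemma Smean_lim r (l : R) : 0 < r ->
  (fun N => \sum_(1 <= n < N) fsin (Gsin r) n * cos (n%:R * 0)) @ \oo --> l ->
  l = Smean r.
Proof.
move=> r0 hl; have [M M0 hM] := Gsin_decay r; have {hM} hM := hM _ r0 (lexx r).
have [m m0 hm] := bounded_ball r cW.
apply/eqP; rewrite -subr_eq0 -normr_le0; apply/ler_addgt0Pr => e e0; rewrite add0r.
have e2 : 0 < e / 2 by rewrite divr_gt0.
have [d d0 hd] := abel_cpois M0 e2.
have rm : 0 < 2 * r * m + 1 by rewrite ltr_wpDl// !mulr_ge0// ltW.
(* Here x is 1 - q. As q >= 1/2, the factor (1 - q^2) / (2 q) is at most 2 x, and the last entry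
   makes 2 r x m at most e / 2. *)
pose x := Num.min (1 / 2) (Num.min d (e / 2 / (2 * r * m + 1))).
have x1 : x <= d by rewrite /x !ge_min lexx orbT.
have x2 : x <= e / 2 / (2 * r * m + 1) by rewrite /x !ge_min lexx !orbT.
have x3 : 0 < x by rewrite /x !lt_min d0 !divr_gt0.
have x4 : x <= 1 / 2 by rewrite /x ge_min lexx.
pose q := 1 - x.
have q01 : 0 < q < 1 by apply/andP; split; rewrite /q; lra.
have q01' : 0 <= q < 1 by move/andP: q01 => [/ltW -> ->].
have qd : 1 - q <= d by rewrite /q opprB addrC subrK.
have h1 := hd _ _ _ _ (continuous_Gsin (r := r)) hM hl q01' qd.
have h2 := Smean_cpois r q01.
have c1 := continuous_comp2 cW (@continuous_rcos r).
have c4 := continuous_pois q01'.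
have h3 : `|Av (fun t => W (r * cos t) * pois q t)| <= m.
  have rc (t : R) : `|W (r * cos t)| <= m.
    by apply: hm; rewrite normrM (gtr0_norm r0) ler_piMr ?cos_max// ltW.
  have -> : m = Av (fun t => m * pois q t) by rewrite AvZ// Av_pois// mulr1.
  rewrite ler_norml; apply/andP; split.
    rewrite -mulN1r -AvZ; [apply: Av_le; [cont|cont|]|cont].
    move=> t _; rewrite mulrA ler_wpM2r ?pois_ge0// mulN1r.
    by have := rc t; rewrite ler_norml => /andP[].
  apply: Av_le; [cont|cont|] => t _; rewrite ler_wpM2r ?pois_ge0//.
  by have := rc t; rewrite ler_norml => /andP[].
have h4 : `|Smean r - Av (fun t => Gsin r t * cpoisS q 0 t)| <= 2 * r * x * m.
  rewrite h2 normrM ler_pM//.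
  have [q0 q1] := andP q01.
  have q11 : 0 <= 1 - q ^+ 2 by nra.
  rewrite ger0_norm; last by rewrite divr_ge0// ?mulr_ge0// ltW.
  rewrite ler_pdivrMr ?mulr_gt0//.
  have -> : r * (1 - q ^+ 2) = r * x * (1 + q) by rewrite /q; ring.
  have -> : 2 * r * x * (2 * q) = r * x * (4 * q) by ring.
  by rewrite ler_wpM2l ?mulr_ge0 ?(ltW r0) ?(ltW x3)//; rewrite /q; lra.
have h5 : 2 * r * x * m <= e / 2.
  have : x * (2 * r * m + 1) <= e / 2 by rewrite -ler_pdivlMr.
  by have := mulr_ge0 (ltW r0) m0; nra.
move: h1 (le_trans h4 h5); rewrite !ler_norml => /andP[a1 a2] /andP[b1 b2].
by apply/andP; split; lra.
Qed.

(* The Abel means of the two series differ by the mean of [Gsin r t * k t] with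
   k = cpoisS q 0 - cpoisS q phi, and k changes sign only where cos t = cs. As W is
   nondecreasing, W (r * cos t) may be replaced by the constant W (r * cs) from below;
   the resulting mean is q (1 - cos phi) up to that constant, and cs > - 2 (1 - q). *)
Lemma Smean_decrease r (l0 l phi : R) : 0 < r -> 0 <= cos phi ->
  (fun N => \sum_(1 <= n < N) fsin (Gsin r) n * cos (n%:R * 0)) @ \oo --> l0 ->
  (fun N => \sum_(1 <= n < N) fsin (Gsin r) n * cos (n%:R * phi)) @ \oo --> l ->
  l <= l0.
Proof.
move=> r0 p0 hl0 hl; have [M M0 hM] := Gsin_decay r; have {hM} hM := hM _ r0 (lexx r).
apply/ler_addgt0Pr => e e0.
have e3 : 0 < e / 3 by rewrite divr_gt0.
have [d d0 hd] := abel_cpois M0 e3.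
have W0 : W 0 = 0 by have := Wodd 0; rewrite oppr0 => ?; lra.
(* Since W vanishes at 0, continuity keeps W(r * cs) above a small negative number even when cs is
   slightly negative. *)
have /cvgrPdist_le /(_ _ (divr_gt0 e3 r0)) [d1 /= d10 hd1] : W x @[x --> 0] --> W 0 by exact: cW.
pose x := Num.min (1 / 2) (Num.min d (d1 / (2 * r + 1) / 2)).
have r21 : 0 < 2 * r + 1 by lra.
have x1 : x <= d by rewrite /x !ge_min lexx orbT.
have x2 : x <= d1 / (2 * r + 1) / 2 by rewrite /x !ge_min lexx !orbT.
have x3 : 0 < x by rewrite /x !lt_min d0 !divr_gt0.
have x4 : x <= 1 / 2 by rewrite /x ge_min lexx.
pose q := 1 - x.
have [q0 q1] : 0 < q /\ q < 1 by split; rewrite /q; lra.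
have q01 : 0 <= q < 1 by rewrite ltW.
have qd : 1 - q <= d by rewrite /q opprB addrC subrK.
have cG := continuous_Gsin (r := r).
have h1 := hd _ _ _ _ cG hM hl0 q01 qd.
have h2 := hd _ _ _ _ cG hM hl q01 qd.
pose a := 1 + q ^+ 2.
have a0 : 0 < a by rewrite ltr_wpDr// sqr_ge0.
pose p := cos phi.
(* The value of cos t at which the kernel difference changes sign; [E] below exhibits the factor cos
   t - cs. *)
pose cs := (4 * q ^+ 2 * (1 + p) - a ^+ 2) / (2 * a * q).
have csE : 2 * a * q * cs = 4 * q ^+ 2 * (1 + p) - a ^+ 2.
  by rewrite mulrC divfK// !mulf_neq0// gt_eqF.
have key t : r * sin t * W (r * cs) * (cpoisS q 0 t - cpoisS q phi t) <=
             Gsin r t * cpoisS q 0 t - Gsin r t * cpoisS q phi t.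
  rewrite -mulrBr -subr_ge0 -mulrBl /Gsin.
  have D0 := poisD_gt0 t q01.
  have D1 := poisD_gt0 (t + phi) q01.
  have D2 := poisD_gt0 (t - phi) q01.
  have E : cpoisS q 0 t - cpoisS q phi t =
     2 * q * sin t * (1 - p) * (2 * a * q * (cos t - cs)) / (poisD q t * (poisD q (t + phi) * poisD q (t - phi))).
    have hDD : poisD q (t + phi) * poisD q (t - phi) =
      (a - 2 * q * cos t * p) ^+ 2 - 4 * q ^+ 2 * (1 - cos t ^+ 2) * (1 - p ^+ 2).
      by rewrite /poisD (cosB t phi) (cosD t phi) -!sin2cos2 /a /p; ring.
    have hN : sin (t + phi) * poisD q (t - phi) + sin (t - phi) * poisD q (t + phi) =
       2 * sin t * (p * (a - 2 * q * cos t * p) - 2 * q * cos t * (1 - p ^+ 2)).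
      by rewrite /poisD (sinD t phi) (sinB t phi) (cosB t phi) (cosD t phi) -!sin2cos2 /a /p; ring.
    have -> : cpoisS q 0 t - cpoisS q phi t = q * (2 * sin t * (poisD q (t + phi) * poisD q (t - phi))
       - poisD q t * (sin (t + phi) * poisD q (t - phi) + sin (t - phi) * poisD q (t + phi)))
         / (poisD q t * (poisD q (t + phi) * poisD q (t - phi))).
      rewrite cpoisS_0 /cpoisS /cpois; move: D0 D1 D2.
      move: (poisD q t) (poisD q (t + phi)) (poisD q (t - phi)) => x0 y0 z0 ? ? ?.
      by field; rewrite !gt_eqF.
    rewrite hDD hN; congr (_ / _).
    have -> : 2 * a * q * (cos t - cs) = 2 * a * q * cos t - (4 * q ^+ 2 * (1 + p) - a ^+ 2).
      by rewrite mulrBr csE.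
    by rewrite /poisD /a; ring.
  rewrite E.
  have -> : (r * sin t * W (r * cos t) - r * sin t * W (r * cs)) *
     (2 * q * sin t * (1 - p) * (2 * a * q * (cos t - cs)) / (poisD q t * (poisD q (t + phi) * poisD q (t - phi)))) =
     4 * q ^+ 2 * a * r * (1 - p) * sin t ^+ 2 * ((W (r * cos t) - W (r * cs)) * (cos t - cs)) /
       (poisD q t * (poisD q (t + phi) * poisD q (t - phi))).
    by ring.
  apply: divr_ge0; last by rewrite !mulr_ge0// ltW.
  have p1 : 0 <= 1 - p by rewrite subr_ge0 cos_le1.
  apply: mulr_ge0.
    apply: mulr_ge0; last exact: sqr_ge0.
    by rewrite !mulr_ge0 ?(ltW q0) ?(ltW a0) ?(ltW r0).
  have [cc|/ltW cc] := leP (cos t) cs.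
    by rewrite mulr_le0// subr_le0// Wmono// ler_pM2l.
  by rewrite mulr_ge0// subr_ge0// Wmono// ler_pM2l.
have c0 := continuous_cpoisS (phi := 0) q01.
have cp := continuous_cpoisS (phi := phi) q01.
have L1 : Av (fun t => r * sin t * W (r * cs) * (cpoisS q 0 t - cpoisS q phi t)) = r * W (r * cs) * (q - q * p).
  have -> : q - q * p = q * cos 0 - q * p by rewrite cos0 mulr1.
  rewrite /p -!Av_sin_cpoisS// -AvB; [|cont..]; rewrite -AvZ; last cont.
  by apply: Av_eq => t; ring.
have L2 : r * W (r * cs) * (q - q * p) <= Av (fun t => Gsin r t * cpoisS q 0 t) - Av (fun t => Gsin r t * cpoisS q phi t).
  rewrite -L1 -AvB; [|cont..]; apply: Av_le; [cont|cont|] => t _; exact: key.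
have L3 : - (e / 3) <= r * W (r * cs) * (q - q * p).
  have p1 : p <= 1 by exact: cos_le1.
  (* With x = 1 - q the numerator of cs equals 4 q^2 p - x^2 (2 - x)^2. The hypothesis cos phi >= 0
     makes its first term nonnegative. *)
  have csb : - (2 * x) <= cs.
    rewrite ler_pdivlMr ?mulr_gt0//.
    have q2p : 0 <= 4 * q ^+ 2 * p by apply: mulr_ge0 => //; apply: mulr_ge0 => //; exact: sqr_ge0.
    have e1 : 4 * q ^+ 2 * (1 + p) - a ^+ 2 = 4 * q ^+ 2 * p - x ^+ 2 * (2 - x) ^+ 2.
      by rewrite /a /q; ring.
    have e2 : (2 - x) ^+ 2 <= 4 by nra.
    have e3' : x ^+ 2 * (2 - x) ^+ 2 <= x ^+ 2 * 4 by rewrite ler_wpM2l ?sqr_ge0.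
    have e4 : 1 / 2 <= a * q.
      have : 1 <= a by rewrite /a lerDl sqr_ge0.
      have : 1 / 2 <= q by rewrite /q; lra.
      nra.
    have e5 := ler_wpM2l (ltW x3) e4.
    rewrite e1; nra.
  have Wb : - (e / 3 / r) <= W (r * cs).
    apply: le_trans (Wmono (_ : - (2 * r * x) <= r * cs)); last first.
      by rewrite -[in leRHS](mulrC) -mulNr; have := ler_wpM2l (ltW r0) csb; lra.
    have := hd1 (- (2 * r * x)); rewrite /= /ball/= sub0r opprK W0 sub0r normrN => h.
    have : `|W (- (2 * r * x))| <= e / 3 / r.
      apply: h; rewrite ger0_norm ?mulr_ge0// ?(ltW r0)// ?(ltW x3)//.
      have : x * 2 * (2 * r + 1) <= d1 by rewrite -ler_pdivlMr// -ler_pdivlMr.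
      nra.
    by rewrite ler_norml => /andP[].
  have rW : - (e / 3) <= r * W (r * cs).
    by have := ler_wpM2l (ltW r0) Wb; rewrite mulrN mulrCA mulfV ?gt_eqF// mulr1.
  have qp : 0 <= q - q * p <= 1 by apply/andP; split; have : 0 <= p by []; nra.
  move: qp => /andP[? ?]; nra.
move: h1 h2; rewrite !ler_norml => /andP[a1 a2] /andP[b1 b2]; lra.
Qed.

End Potential.

(** * Dependence on the radius and the critical equation *)

Lemma Av_rcos_lipschitz (R : realType) (F dF k : R -> R) B :
  (forall x : R, is_derive x 1 F (dF x)) -> continuous dF -> continuous k ->
  (forall t, `|k t| <= 1) -> exists2 L, 0 <= L & forall r s, `|r| <= B -> `|s| <= B ->
  `|Av (fun t => F (r * cos t) * k t) - Av (fun t => F (s * cos t) * k t)| <= L * `|r - s|.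
Proof.
move=> hF cdF ck k1; have cF := is_derive_cont hF.
have [L L0 hL] := derive_lipschitz B hF cdF; exists L => // r s rB sB.
have c1 := continuous_comp2 cF (@continuous_rcos R r).
have c2 := continuous_comp2 cF (@continuous_rcos R s).
rewrite -AvB; [|cont..]; apply: Av_norm; first cont.
have h u (t : R) : `|u| <= B -> `|u * cos t| <= B.
  by move=> uB; apply: le_trans uB; rewrite normrM ler_piMr ?cos_max.
move=> t _; rewrite -mulrBl normrM; apply: le_trans (_ : L * `|r * cos t - s * cos t| * 1 <= _).
  by apply: ler_pM => //; apply: hL; exact: h.
by rewrite mulr1 ler_wpM2l// -mulrBl normrM ler_piMr ?cos_max.
Qed.

Section Critical.
Variables (R : realType) (V W W2 W3 : R -> R).
Hypothesis pot : potential V W W2 W3.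

Let dV := pot_V pot.
Let dW := pot_W pot.
Let dW2 := pot_W2 pot.
Let Wodd := pot_odd pot.
Let Wmono := pot_mono pot.
Let cV : continuous V := is_derive_cont dV.
Let cW : continuous W := is_derive_cont dW.
Let cW2 : continuous W2 := is_derive_cont dW2.
Local Notation Vcos := (Vcos V).
Local Notation Gsin := (Gsin W).
Local Notation Smean := (Smean W).

(** In [Smean_cpois], s (q + 1/q) / 2 lies to the right of every s cos t, so W there bounds W(s cos
    t), and the Poisson kernel has mean one. *)
Lemma Smean_outside s q : 0 < s -> 0 < q < 1 ->
  Smean s - Av (fun t => Gsin s t * cpoisS q 0 t) <=
  s * (1 - q ^+ 2) / (2 * q) * W (s * (q + q^-1) / 2).
Proof.
move=> s0 q01; rewrite (Smean_cpois pot)//.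
have [q0 q1] := andP q01.
have q01' : 0 <= q < 1 by rewrite ltW.
have c1 := continuous_comp2 cW (@continuous_rcos R s).
have c4 := continuous_pois q01'.
rewrite ler_wpM2l//.
  by rewrite divr_ge0// ?mulr_ge0// ?(ltW s0) ?(ltW q0)// subr_ge0 expr_le1// ltW.
set x := W _; have -> : x = Av (fun t => x * pois q t) by rewrite AvZ// Av_pois// mulr1.
rewrite {}/x.
apply: Av_le; [cont|cont|] => t _; rewrite ler_wpM2r ?pois_ge0// Wmono//.
rewrite -mulrA ler_pM2l//; apply: le_trans (cos_le1 t) _.
rewrite -subr_ge0 (_ : _ - _ = (q - 1) ^+ 2 / (2 * q)); last by field; rewrite gt_eqF.
by rewrite divr_ge0 ?sqr_ge0// mulr_ge0// ltW.
Qed.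

(* At x = s (q + 1/q) / 2 the left-hand side is the logarithmic potential of the
   equilibrium measure up to constants. The difference of the two sides vanishes at q = 1
   and is monotone in q by [Smean_outside] when Smean s = 1. *)
Lemma outside_sum s q e : 0 < s -> Smean s = 1 -> 0 < q <= 1 -> 0 < e ->
  exists N0, forall N, (N0 <= N)%N ->
  \sum_(0 <= n < N) q ^+ n * fcos (Vcos s) n <= V (s * (q + q^-1) / 2) + ln q + e.
Proof.
move=> s0 S1 /andP[q0 q1] e0.
have [M M0 hM] := Gsin_decay pot s; have {hM} hM := hM _ s0 (lexx s).
have [L L0 hL] := Vcos_lipschitz pot s0.
have e2 : 0 < e / 2 by rewrite divr_gt0.
have [N1 hN1] := fcos_inversion (continuous_Vcos pot (r := s)) M0 L0 e2 hL (Vcos_decay pot hM).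
(* The factor q pays for the later division by c, which is at least q. *)
have [K K0 hK] := exists_inv_le M0 (mulr_gt0 e2 q0).
exists (maxn N1 K).+2 => -[//|N]; rewrite ltnS => NN.
have NN1 : (N1 <= N.+1)%N by rewrite (leq_trans _ (leqnSn N))// (leq_trans _ (ltnW NN))// leq_maxl.
have NK : (K <= N)%N by rewrite (leq_trans _ (ltnW NN))// leq_maxr.
have N0 : (0 < N)%N by exact: leq_trans NK.
have sumE x : \sum_(0 <= n < N.+1) x ^+ n * fcos (Vcos s) n =
  fcos (Vcos s) 0 + \sum_(1 <= n < N.+1) x ^+ n / n%:R * fsin (Gsin s) n.
  rewrite big_ltn// expr0 mul1r; congr (_ + _).
  apply: eq_big_nat => n /andP[n0 _]; rewrite -(fcos_fsin pot)//.
  by rewrite mulrA divfK// pnatr_eq0 -lt0n.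
pose x (y : R) := s * (y + y^-1) / 2.
pose w (y : R) := V (x y) + ln y - (fcos (Vcos s) 0 + \sum_(1 <= n < N.+1) y ^+ n / n%:R * fsin (Gsin s) n).
pose dw (y : R) := W (x y) * (s * (1 - y ^- 2) / 2) + y^-1 - \sum_(1 <= n < N.+1) y ^+ n.-1 * fsin (Gsin s) n.
(* At y = 1 the point [x y] is s and the logarithm vanishes, so cosine inversion at angle 0
   applies. *)
have w1 : - (e / 2) <= w 1.
  rewrite /w ln1 addr0 -sumE.
  have := hN1 N.+1 0 NN1; rewrite /(Vcos s) cos0 mulr1.
  have -> : x 1 = s by rewrite /x invr1; field.
  under eq_bigr do rewrite mulr0 cos0 mulr1.
  under [X in _ -> _ <= _ - X]eq_bigr do rewrite expr1n mul1r.
  by rewrite ler_norml => /andP[h1 h2]; lra.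
rewrite sumE; suff : - e <= w q by rewrite /w; lra.
have [->|qn1] := eqVneq q 1; first by lra.
have q1' : q < 1 by rewrite lt_neqAle qn1.
have dwE (y : R) : 0 < y -> is_derive y 1 w (dw y).
  move=> y0; have yn : y != 0 by rewrite gt_eqF.
  have dx : is_derive y 1 x (s * (1 - y ^- 2) / 2).
    have h : is_derive y 1 (fun y : R => y^-1) (- y ^- 2).
      by have := @is_deriveV R id y 1 1 yn (is_derive_id _ _); rewrite /GRing.scale/= mulr1.
    by rewrite /x; apply: is_derive_eq; rewrite /GRing.scale/=; field.
  have h1 := @is_derive1_comp R V x y _ _ (dV _) dx.
  have h2 := is_derive1_ln y0.
  have h3 := @is_derive_sumq R (fsin (Gsin s)) y N.
  have h4 := @is_deriveD _ _ _ _ _ _ _ _ _ (is_derive_cst (fcos (Vcos s) 0) y 1) h3.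
  rewrite add0r in h4.
  exact: (@is_deriveB _ _ _ _ _ _ _ _ _ (@is_deriveD _ _ _ _ _ _ _ _ _ h1 h2) h4).
have cw : {within `[q, 1], continuous w}.
  apply: derivable_within_continuous => y; rewrite in_itv/= => /andP[qy _].
  by apply: ex_derive; apply: dwE; exact: lt_le_trans qy.
have dwI (y : R) : y \in `]q, 1[ -> is_derive y 1 w (dw y).
  by rewrite in_itv/= => /andP[qy _]; apply: dwE; exact: lt_trans qy.
have [c] := MVT q1' dwI cw.
rewrite in_itv/= => /andP[qc c1] E.
have c0 : 0 < c by exact: lt_trans qc.
have c01 : 0 <= c < 1 by rewrite ltW.
(* The critical equation enters here: as Smean s = 1, [Smean_outside] makes c * dw c nonpositive for
   the full series, and truncating the series costs M / N. *)
have dwc : c * dw c <= M / N%:R.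
  have h1 := Smean_outside s0 (_ : 0 < c < 1).
  have {h1} h1 := h1 (introT andP (conj c0 c1)).
  rewrite S1 in h1.
  have h2 : `|Av (fun t => Gsin s t * cpoisS c 0 t) - \sum_(1 <= n < N.+1) fsin (Gsin s) n * c ^+ n| <= M / N%:R.
    apply: (quad_decay_lim hM M0 _ _ N0).
      by move=> n; rewrite normrX ger0_norm ?(ltW c0)// exprn_ile1// ltW.
    have := @cvg_sum_cpois R (Gsin s) c 0 (continuous_Gsin pot (r := s)) c01.
    rewrite (_ : (fun N => _) = (fun N : nat => \sum_(1 <= n < N) fsin (Gsin s) n * c ^+ n))//.
    by apply/funext => m; apply: eq_bigr => n _; rewrite mulr0 cos0 mulr1 mulrC.
  have -> : c * dw c = 1 - s * (1 - c ^+ 2) / (2 * c) * W (x c) - \sum_(1 <= n < N.+1) fsin (Gsin s) n * c ^+ n.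
    rewrite /dw mulrBr; congr (_ - _).
      by field; rewrite gt_eqF.
    rewrite mulr_sumr; apply: eq_big_nat => -[//|n] _.
    by rewrite mulrA -exprS mulrC.
  move: h2; rewrite ler_norml => /andP[_ h2].
  move: h1; rewrite -/(x c); lra.
have dwc' : dw c <= e / 2.
  have h : M / N%:R <= e / 2 * q.
    apply: le_trans hK; rewrite ler_wpM2l// lef_pV2 ?posrE ?ltr0n// ler_nat//.
  have h' : c * dw c <= c * (e / 2).
    apply: le_trans dwc (le_trans h _); rewrite mulrC ler_wpM2r// ltW//.
  by rewrite -(ler_pM2l c0).
have : dw c * (1 - q) <= e / 2.
  have [d0|d0] := leP 0 (dw c); last by have : 0 < 1 - q; [lra|nra].
  by apply: le_trans dwc'; rewrite ler_piMr//; lra.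
by rewrite -E; lra.
Qed.

Lemma fcos_Vcos_cvg r0 n : fcos (Vcos r) n @[r --> r0] --> fcos (Vcos r0) n.
Proof.
have [L L0 hL] := Av_rcos_lipschitz (`|r0| + 1) dV cW (@continuous_cosn R n%:R) (fun t => cos_max _).
rewrite /fcos; apply: cvgM; first exact: cvg_cst.
apply/cvgrPdist_le => e e0; have L1 : 0 < L + 1 by rewrite ltr_wpDl.
exists (Num.min 1 (e / (L + 1))); first by rewrite /= lt_min ltr01 divr_gt0.
move=> r /=; rewrite lt_min => /andP[r1 r2].
apply: le_trans (hL _ _ _ _) _; first by rewrite lerDl.
  have -> : r = r0 - (r0 - r) by ring.
  by apply: le_trans (ler_normB _ _) _; rewrite lerD2l ltW.
have h : `|r0 - r| * (L + 1) <= e by rewrite -ler_pdivlMr// ltW.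
by have := normr_ge0 (r0 - r); nra.
Qed.

(** The tails are small uniformly for r <= B and the finite head is continuous in r. The predicate
    [D] confines r to radii where the factors [u n r] stay bounded by 1. *)
Lemma series_continuous (D : R -> Prop) B (u : nat -> R -> R) (l : R -> R) r0 e :
  (forall r, D r -> 0 < r <= B) -> D r0 -> (forall r n, D r -> `|u n r| <= 1) ->
  (forall n, u n r @[r --> r0] --> u n r0) ->
  (forall r, D r -> (fun N => \sum_(1 <= n < N) fsin (Gsin r) n * u n r) @ \oo --> l r) ->
  0 < e ->
  exists2 d, 0 < d & forall r, D r -> `|r0 - r| < d -> `|l r0 - l r| <= e.
Proof.
move=> DB D0 u1 cu hl e0.
have [M M0 hM] := Gsin_decay pot B.
have e3 : 0 < e / 3 by rewrite divr_gt0.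
have [K K0 hK] := exists_inv_le M0 e3.
pose F r := \sum_(1 <= n < K.+1) (n%:R * fcos (Vcos r) n) * u n r.
have FE r : F r = \sum_(1 <= n < K.+1) fsin (Gsin r) n * u n r.
  by apply: eq_big_nat => n /andP[n0 _]; rewrite (fcos_fsin pot).
have cF : F r @[r --> r0] --> F r0.
  rewrite /F; elim: K.+1 => [|k IH].
    under eq_fun do rewrite big_geq//.
    by rewrite big_geq//; exact: cvg_cst.
  case: k IH => [|k] IH.
    under eq_fun do rewrite big_geq//.
    by rewrite big_geq//; exact: cvg_cst.
  under eq_fun do rewrite big_nat_recr//=.
  rewrite big_nat_recr//=; apply: cvgD => //; apply: cvgM => //.
  by apply: cvgM; [exact: cvg_cst|exact: fcos_Vcos_cvg].
have /cvgrPdist_le /(_ _ e3) [d /= d0 hd] := cF.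
exists d => // r Dr rd; have := hd r rd; rewrite /= => hF.
have near0 r' : D r' -> `|l r' - F r'| <= e / 3.
  move=> Dr'; have /andP[r0' rB'] := DB _ Dr'; rewrite FE; apply: le_trans hK.
  by apply: (quad_decay_lim (hM _ r0' rB') M0 _ (hl _ Dr') K0) => n; exact: u1.
have := near0 _ D0; have := near0 _ Dr; move: hF.
rewrite !ler_norml => /andP[? ?] /andP[? ?] /andP[? ?].
by apply/andP; split; lra.
Qed.

Lemma Smean_lipschitz B : exists2 L, 0 <= L & forall r s, `|r| <= B -> `|s| <= B ->
  `|Smean r - Smean s| <= L * `|r - s|.
Proof.
have h1 (x : R) : is_derive x 1 (fun x => x * W x) (x * W2 x + W x).
  have := @is_deriveM R R id W x 1 _ _ (is_derive_id _ _) (dW x).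
  by rewrite /GRing.scale/= mulr1.
have c1 : continuous (fun x : R => x * W2 x + W x) by cont.
have one t : `|(fun _ : R => 1 : R) t| <= 1 by rewrite normr1.
have [L L0 hL] := Av_rcos_lipschitz B h1 c1 (@continuous_cst R 1) one.
exists L => // r s rB sB; have := hL r s rB sB.
have E u : Av (fun t => u * cos t * W (u * cos t) * 1) = Smean u.
  by apply: Av_eq => t; rewrite mulr1.
by rewrite !E.
Qed.

Lemma Smean_large : 0 < W 1 -> exists2 r, 0 < r & 1 <= Smean r.
Proof.
move=> W1; set d := W 1 in W1.
(* This r solves d (r / 2 - 1) = 1, the mean of the lower bound d (r cos(t)^2 - 1) for the
   integrand. *)
exists (2 * (d^-1 + 1)); first by rewrite mulr_gt0// addr_gt0// invr_gt0.
set r := 2 * _.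
have r0 : 0 <= r by rewrite mulr_ge0// addr_ge0// invr_ge0 ltW.
(* Monotonicity gives u W(u) >= d |u| for |u| >= 1. For smaller u the right-hand side is at most 0,
   and u W(u) is nonnegative. *)
have key u : d * (`|u| - 1) <= u * W u.
  wlog u0 : u / 0 <= u => [hw|].
    have [|/ltW u0] := leP 0 u; first exact: hw.
    by have := hw (- u); rewrite normrN oppr_ge0 u0 Wodd mulrNN => ->.
  rewrite ger0_norm//; have [u1|u1] := leP 1 u.
    have : d <= W u by exact: Wmono.
    nra.
  have : 0 <= W u by have := Wmono u0; have := Wodd 0; rewrite oppr0; lra.
  by move=> h; have := mulr_ge0 u0 h; nra.
have c1 := continuous_comp2 cW (@continuous_rcos R r).
have cc2 : continuous (fun t : R => cos (2%:R * t)) by exact: continuous_cosn.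
have E : Av (fun t => d * r / 2 * cos (2%:R * t) + (d * r / 2 - d)) = 1.
  rewrite AvD; [|cont..]; rewrite AvZ// Av_cosn// Av_cst mulr0 add0r /r.
  by field; rewrite gt_eqF.
rewrite -E; apply: Av_le; [cont|cont|] => t _.
apply: le_trans (key _); rewrite normrM (ger0_norm r0).
have -> : cos (2%:R * t) = 2 * cos t ^+ 2 - 1 by rewrite mulr_natl cos_mulr2n -mulr_natl.
rewrite -(real_normK (num_real (cos t))).
have := cos_max t; have := normr_ge0 (cos t); set c := `|_| => c0 cl1.
have : c ^+ 2 <= c by rewrite expr2 ler_piMr.
have : 0 <= d * r by rewrite mulr_ge0// ltW.
nra.
Qed.

(** The infimum of the radii with Smean >= 1 yields minimality at once. The Lipschitz bound then
    gives Smean >= 1 from nearby points of the set and Smean <= 1 from points just below. *)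
Lemma critical_radius : 0 < W 1 ->
  exists Rs, [/\ 0 < Rs, Smean Rs = 1 & forall r, 0 <= r < Rs -> Smean r < 1].
Proof.
move=> W1; have [b b0 hb] := Smean_large W1.
pose A := [set r : R | 0 <= r /\ 1 <= Smean r].
have A0 : A !=set0 by exists b; split => //; exact: ltW.
have Alb : lbound A 0 by move=> r [].
have hA : has_inf A by split => //; exists 0.
pose Rs := inf A; exists Rs.
have Rs0 : 0 <= Rs by exact: lb_le_inf.
have below r : 0 <= r < Rs -> Smean r < 1.
  move=> /andP[r0 rRs]; rewrite ltNge; apply/negP => h.
  have : Rs <= r by apply: ge_inf; [exists 0|split].
  by rewrite leNgt rRs.
have [L L0 hL] := Smean_lipschitz (Rs + 1).
have L1 : 0 < L + 1 by rewrite ltr_wpDl.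
have RsB : `|Rs| <= Rs + 1 by rewrite ger0_norm// lerDl.
have ge1 : 1 <= Smean Rs.
  apply/ler_addgt0Pr => e e0.
  pose d := Num.min 1 (e / (L + 1)).
  have d0 : 0 < d by rewrite lt_min ltr01 divr_gt0.
  have [r [r0 r1] rd] := inf_adherent d0 hA.
  have Rr : Rs <= r by apply: ge_inf; [exists 0|split].
  have d1 : d <= 1 by rewrite ge_min lexx.
  have rB : `|r| <= Rs + 1 by rewrite ger0_norm//; move: rd; rewrite -/Rs; lra.
  have := hL _ _ rB RsB; rewrite [X in _ <= _ * X]ger0_norm ?subr_ge0//.
  have h : (r - Rs) * (L + 1) <= e.
    rewrite -ler_pdivlMr//; apply: (@le_trans _ _ d); first by move: rd; rewrite -/Rs; lra.
    by rewrite ge_min lexx orbT.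
  rewrite ler_norml => /andP[_ h2]; nra.
have Rs1 : 0 < Rs.
  rewrite lt_neqAle Rs0 andbT; apply/eqP => R0; move: ge1; rewrite -R0.
  rewrite /(Smean _) (_ : (fun t => _) = fun=> 0) ?Av_cst ?ler10//.
  by apply/funext => t; rewrite !mul0r.
split => //; apply/eqP; rewrite eq_le ge1 andbT; apply/ler_addgt0Pr => e e0.
pose d := Num.min Rs (e / (L + 1)).
have d0 : 0 < d by rewrite lt_min Rs1 divr_gt0.
have dR : d <= Rs by rewrite ge_min lexx.
have dB : `|Rs - d| <= Rs + 1 by rewrite ger0_norm ?subr_ge0//; lra.
have := hL _ _ RsB dB; rewrite (_ : Rs - (Rs - d) = d); last by ring.
rewrite (gtr0_norm d0) ler_norml => /andP[_ h].
have : Smean (Rs - d) < 1 by apply: below; apply/andP; split; lra.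
have : d * (L + 1) <= e by rewrite -ler_pdivlMr// ge_min lexx orbT.
nra.
Qed.

End Critical.

(** * The derivative of an even strictly convex function *)

Lemma potential_of_C3 (R : realType) (V : R -> R) : C3 V -> (forall x, V (- x) = V x) ->
  strictly_convex V ->
  potential V (derive1 V) (derive1n 2 V) (derive1n 3 V) /\ 0 < derive1 V 1.
Proof.
move=> [d1 [d2 [d3 c3]]] Vev Vcv; set W := derive1 V.
have dV (x : R) : is_derive x 1 V (W x) by rewrite /W derive1E; apply: derivableP.
have dW (x : R) : is_derive x 1 W (derive1n 2 V x).
  by have /derivableP := d2 x; rewrite -derive1E.
have dW2 (x : R) : is_derive x 1 (derive1n 2 V) (derive1n 3 V x).
  by have /derivableP := d3 x; rewrite -derive1E.
have cV := is_derive_cont dV; have cW := is_derive_cont dW.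
have Wodd x : W (- x) = - W x.
  have hN : is_derive x 1 (fun y : R => - y) (-1) by apply: is_derive_eq.
  have := @is_derive1_comp R V (fun y => - y) x _ _ (dV _) hN.
  have -> : V \o (fun y => - y) = V by apply/funext => y /=.
  move=> h; have := @derive_val _ _ _ _ _ _ _ h; have := @derive_val _ _ _ _ _ _ _ (dV x).
  by move=> -> ->; ring.
(* The tangent at x lies below the chord. Otherwise W would exceed the slope of the chord near x by
   continuity, and the mean value theorem on a short interval from x would contradict convexity. *)
have slope x y : x < y -> W x * (y - x) <= V y - V x.
  move=> xy; have yx : 0 < y - x by rewrite subr_gt0.
  rewrite leNgt; apply/negP => h.
  pose e := W x - (V y - V x) / (y - x).
  have e0 : 0 < e by rewrite subr_gt0 ltr_pdivrMr.
  have /cvgrPdist_lt /(_ _ e0) [d /= d0 hd] : W z @[z --> x] --> W x by exact: cW.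
  pose k := Num.min (1 / 2) (d / (y - x) / 2).
  have k0 : 0 < k by rewrite lt_min !divr_gt0.
  have k1 : k <= 1 / 2 by rewrite ge_min lexx.
  have k2 : k * (y - x) <= d / 2.
    by rewrite -ler_pdivlMr// mulrAC ge_min lexx orbT.
  have xk : x < x + k * (y - x) by rewrite ltrDl mulr_gt0.
  have [c] := @MVT R V W _ _ xk (fun z _ => dV z) (continuous_subspaceT cV).
  rewrite in_itv/= => /andP[xc ck] E.
  have hc : V (x + k * (y - x)) < k * V y + (1 - k) * V x.
    have -> : x + k * (y - x) = k * y + (1 - k) * x by ring.
    by apply: Vcv; [rewrite gt_eqF|apply/andP; split; lra].
  have := hd c; rewrite /ball/= => hdc.
  have : `|W x - W c| < e.
    apply: hdc; rewrite distrC gtr0_norm ?subr_gt0//; lra.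
  rewrite ltr_norml => /andP[_]; rewrite /e => hW.
  have hWc : (V y - V x) / (y - x) < W c by lra.
  rewrite ltr_pdivrMr// in hWc.
  have : k * (V y - V x) < k * (W c * (y - x)) by rewrite ltr_pM2l.
  move: E; rewrite (_ : x + k * (y - x) - x = k * (y - x)); last by ring.
  lra.
have Wmono x y : x <= y -> W x <= W y.
  rewrite le_eqVlt => /predU1P[->//|xy].
  have h1 := slope _ _ xy.
  (* Evenness turns the tangent inequality on [-y, -x] into the one at y; together the two give
     monotonicity. *)
  have h2 := slope (- y) (- x); rewrite ltrN2 !Vev Wodd in h2.
  have {h2} h2 := h2 xy.
  have yx : 0 < y - x by rewrite subr_gt0.
  by rewrite -(ler_pM2r yx); lra.
split; first by split.
(* The tangent at -1, read at 0, gives V 1 - V 0 <= W 1, and strict convexity at the midpoint of -1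
   and 1 gives V 0 < V 1. *)
have h := slope (-1) 0; rewrite Wodd Vev in h.
have h01 : V (1 / 2 * 1 + (1 - 1 / 2) * -1) < 1 / 2 * V 1 + (1 - 1 / 2) * V (- 1).
  by apply: Vcv; [rewrite gt_eqF// lt_neqAle; lra|lra].
rewrite Vev in h01.
have V0 : V 0 < V 1.
  by move: h01; rewrite (_ : 1 / 2 * 1 + (1 - 1 / 2) * -1 = 0); [lra|field].
have := h (_ : -1 < 0); rewrite ltrN10 => /(_ isT); lra.
Qed.

(** * The substitution x = s cos t *)

Section Substitution.
Variable R : realType.
Implicit Types (F : R -> R) (s : R).
Local Notation mu := (@lebesgue_measure R).

Lemma cos_lt_itv s (x : R) : 0 < s -> `|x| < s -> exists2 t, 0 < t < pi & x = s * cos t.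
Proof.
move=> s0 xs; have xs1 : -1 < x / s < 1.
  by rewrite ltr_pdivlMr// mulN1r ltr_pdivrMr// mul1r -ltr_norml.
have xs2 : -1 <= x / s <= 1 by case/andP: xs1 => /ltW -> /ltW ->.
exists (acos (x / s)).
  case/andP: xs1 => h1 h2; case/andP: xs2 => h3 h4.
  by rewrite acos_gt0 ?h3//= acos_ltpi// h1.
by rewrite acosK ?in_itv//= mulrC divfK// gt_eqF.
Qed.

Lemma rcos_lt s (t : R) : 0 < s -> 0 < t < pi -> `|s * cos t| < s.
Proof.
move=> s0 t0; rewrite normrM (gtr0_norm s0) gtr_pMr// -ltr_sqr ?nnegrE// expr1n.
rewrite real_normK ?num_real// cos2sin2 gtrBl exprn_gt0// sin_gt0_pi//.
Qed.

Lemma sqrt_rcos s (t : R) : 0 < s -> 0 < t < pi ->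
  Num.sqrt (s ^+ 2 - (s * cos t) ^+ 2) = s * sin t.
Proof.
move=> s0 t0; have -> : s ^+ 2 - (s * cos t) ^+ 2 = (s * sin t) ^+ 2.
  by rewrite !exprMn cos2sin2; ring.
by rewrite sqrtr_sqr ger0_norm// mulr_ge0 ?(ltW s0)// ltW// sin_gt0_pi.
Qed.

Lemma sqrt_weight_gt0 s (x : R) : 0 < s -> `|x| < s -> 0 < Num.sqrt (s ^+ 2 - x ^+ 2).
Proof.
move=> s0 xs; rewrite sqrtr_gt0 subr_gt0 -(real_normK (num_real x)).
by rewrite ltr_pXn2r// nnegrE// ltW.
Qed.

Lemma weight_continuous_at F s (x : R) : 0 < s -> `|x| < s -> continuous F ->
  {for x, continuous (fun x => F x / Num.sqrt (s ^+ 2 - x ^+ 2))}.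
Proof.
move=> s0 xs cF; apply: cvgM; first exact: cF.
apply: cvgV; first by rewrite gt_eqF// sqrt_weight_gt0.
have h : continuous (fun x : R => s ^+ 2 - x ^+ 2) by cont.
exact: (continuous_comp2 (@sqrt_continuous R) h).
Qed.

(** The weight is singular at both ends, so the change of variables is first made on a compact
    interval inside. *)
Lemma integral_weight_cc F s (a : R) : continuous F -> 0 < s -> 0 < a < pi / 2 ->
  (\int[mu]_(x in `[(s * cos (pi - a))%R, (s * cos a)%R]) (F x / Num.sqrt (s ^+ 2 - x ^+ 2))%:E =
   \int[mu]_(t in `[a, (pi - a)%R]) (F (s * cos t))%:E)%E.
Proof.
move=> cF s0 /andP[a0 a1].
have dc (t : R) : is_derive t 1 (fun t => s * cos t) (- (s * sin t)).
  exact: is_derive_rcos.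
have dcE : derive1 (fun t : R => s * cos t) = fun t => - (s * sin t).
  by apply/funext => t; rewrite derive1E; exact: derive_val.
have cC := is_derive_cont dc.
have cS : continuous (fun t : R => - (s * sin t)) by cont.
have aa : a <= pi - a by lra.
have in0pi (t : R) : a <= t <= pi - a -> 0 < t < pi.
  by move=> /andP[h1 h2]; apply/andP; split; lra.
have ccI (t : R) : a <= t <= pi - a -> t \in `[0, pi].
  by move=> /in0pi /andP[/ltW h1 /ltW h2]; rewrite in_itv/= h1.
rewrite (@integration_by_substitution_decreasing R (fun t => s * cos t) (fun x => F x / Num.sqrt (s ^+ 2 - x ^+ 2)) a (pi - a) aa).
- apply: eq_integral => t; rewrite inE/= in_itv/= => /in0pi t0.
  rewrite fctE/= dcE opprK sqrt_rcos// divfK// mulf_neq0// gt_eqF//.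
  exact: sin_gt0_pi.
- move=> x y; rewrite !in_itv/= => /ccI hx /ccI hy xy; by rewrite ltr_pM2l// ltr_cos.
- by rewrite dcE => x _; exact: cS.
- by rewrite dcE; apply/cvg_ex; exists (- (s * sin a)); apply: cvg_at_right_filter; exact: cS.
- by rewrite dcE; apply/cvg_ex; exists (- (s * sin (pi - a))); apply: cvg_at_left_filter; exact: cS.
- split.
  + by move=> x _; exact: ex_derive.
  + by apply: cvg_at_right_filter; exact: cC.
  + by apply: cvg_at_left_filter; exact: cC.
- apply: continuous_in_subspaceT => x; rewrite inE/= in_itv/= => /andP[h1 h2].
  apply: weight_continuous_at => //.
  have ca : `|s * cos a| < s by apply: rcos_lt => //; apply/andP; split; lra.
  have ca' : `|s * cos (pi - a)| < s by apply: rcos_lt => //; apply/andP; split; lra.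
  move: ca ca'; rewrite !ltr_norml => /andP[? ?] /andP[? ?].
  by apply/andP; split; lra.
Qed.

(** Exhaustion by compact intervals: nonnegativity makes both sides monotone limits, before
    integrability of the singular weight is known. *)
Lemma ge0_integral_weight F s : continuous F -> (forall x, 0 <= F x) -> 0 < s ->
  (\int[mu]_(x in `](- s)%R, s[) (F x / Num.sqrt (s ^+ 2 - x ^+ 2))%:E =
   \int[mu]_(t in `]0%R, pi[) (F (s * cos t))%:E)%E.
Proof.
move=> cF F0 s0.
(* Dividing by n + 2 keeps a n strictly below pi / 2 already for n = 0. *)
pose a n : R := pi / 2 / n.+2%:R.
have pi2 : 0 < pi / 2 :> R by rewrite divr_gt0// pi_gt0.
have a0 n : 0 < a n < pi / 2.
  by rewrite divr_gt0//= ltr_pdivrMr// ltr_pMr// ltr1n.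
have aS n m : (n <= m)%N -> a m <= a n.
  by move=> nm; rewrite ler_wpM2l ?(ltW pi2)// lef_pV2 ?posrE// ler_nat.
have acv (e : R) : 0 < e -> exists n, a n < e.
  move=> e0; exists (Num.truncn (pi / 2 / e)).
  rewrite /a ltr_pdivrMr// [ltRHS]mulrC -ltr_pdivrMr//; apply: lt_trans (truncnS_gt _) _.
  by rewrite ltr_nat.
have apiB n : s * cos (pi - a n) = - (s * cos (a n)).
  by rewrite cosB cospi sinpi mul0r addr0; ring.
have inI n (t : R) : a n <= t <= pi - a n -> 0 < t < pi.
  by have /andP[h1 h2] := a0 n; move=> /andP[h3 h4]; apply/andP; split; lra.
have a0pi n : 0 < a n < pi by have /andP[h1 h2] := a0 n; apply/andP; split; lra.
pose A n := `[a n, (pi - a n)]%classic.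
pose B n := `[(s * cos (pi - a n)), (s * cos (a n))]%classic.
have UA : \bigcup_n A n = `]0, pi[%classic.
  apply/seteqP; split => t /=.
    by move=> [n _]; rewrite /A/= !in_itv/=; exact: inI.
  rewrite in_itv/= => /andP[t0 tpi].
  have m0 : 0 < Num.min t (pi - t) by rewrite lt_min t0 subr_gt0.
  have [n hn] := acv _ m0; exists n => //.
  by move: hn; rewrite /A/= in_itv/= lt_min => /andP[? ?]; apply/andP; split; lra.
have UB : \bigcup_n B n = `](- s), s[%classic.
  apply/seteqP; split => x /=.
    move=> [n _]; rewrite /B/= !in_itv/= apiB => /andP[h1 h2].
    by have := rcos_lt s0 (a0pi n); rewrite ltr_norml => /andP[? ?]; apply/andP; split; lra.
  rewrite in_itv/= -ltr_norml => xs; have [t t0 ->] := cos_lt_itv s0 xs.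
  have : (\bigcup_n A n) t by rewrite UA/= in_itv.
  move=> [n _]; rewrite /A/= in_itv/= => /andP[h1 h2]; exists n => //.
  have /andP[t1 t2] := t0; have /andP[b1 b2] := a0pi n; have /andP[_ b3] := a0 n.
  rewrite /B/= in_itv/= !ler_pM2l//; apply/andP; split.
    rewrite leNgt ltr_cos ?in_itv/= -?leNgt//; apply/andP; split; lra.
  rewrite leNgt ltr_cos ?in_itv/= -?leNgt//; apply/andP; split; lra.
have ndA : nondecreasing_seq A.
  move=> n m nm; apply/subsetPset => t; rewrite /A/= !in_itv/= => /andP[h1 h2].
  by have h3 := aS _ _ nm; apply/andP; split; lra.
have ndB : nondecreasing_seq B.
  move=> n m nm; apply/subsetPset => t; rewrite /B/= !in_itv/= !apiB => /andP[h1 h2].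
  have h3 : s * cos (a n) <= s * cos (a m).
    have aI k : a k \in `[0, pi].
      by have /andP[h4 h5] := a0pi k; rewrite in_itv/= (ltW h4) (ltW h5).
    by rewrite ler_pM2l// leNgt ltr_cos// -leNgt aS.
  by apply/andP; split; lra.
have cFc : continuous (fun t => F (s * cos t)).
  by apply: (continuous_comp2 cF); exact: continuous_rcos.
have hA : (\int[mu]_(t in A n) (F (s * cos t))%:E @[n --> \oo] --> \int[mu]_(t in \bigcup_n A n) (F (s * cos t))%:E)%E.
  apply: ge0_nondecreasing_set_cvg_integral => //.
  - by move=> n; exact: measurable_itv.
  - by move=> n; apply/measurable_EFinP; apply: measurable_funTS; exact: continuous_measurable_fun.
  - by move=> n t _; rewrite lee_fin.
have hB : (\int[mu]_(x in B n) (F x / Num.sqrt (s ^+ 2 - x ^+ 2))%:E @[n --> \oo] -->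
    \int[mu]_(x in \bigcup_n B n) (F x / Num.sqrt (s ^+ 2 - x ^+ 2))%:E)%E.
  apply: ge0_nondecreasing_set_cvg_integral => //.
  - by move=> n; exact: measurable_itv.
  - move=> n; apply/measurable_EFinP.
    apply: subspace_continuous_measurable_fun; first exact: measurable_itv.
    apply: continuous_in_subspaceT => x; rewrite inE /B/= in_itv/= apiB => /andP[h1 h2].
    apply: weight_continuous_at => //.
    by have := rcos_lt s0 (a0pi n); rewrite !ltr_norml => /andP[? ?]; apply/andP; split; lra.
  - by move=> n x _; rewrite lee_fin divr_ge0.
rewrite -UA -UB; move/cvg_lim : hB => <-//; move/cvg_lim : hA => <-//.
congr (limn _); apply/funext => n; exact: integral_weight_cc.
Qed.

Lemma integral_0pi (F : R -> R) : continuous F ->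
  (\int[mu]_(t in `]0%R, pi[) (F t)%:E = (pi * Av F)%:E)%E.
Proof.
move=> cF; rewrite /Av mulrA mulfV ?gt_eqF ?pi_gt0// mul1r /Rintegral fineK; last first.
  by apply: integrable_fin_num => //; exact: Av_integrable.
rewrite integral_itv_bndo_bndc ?integral_itv_obnd_cbnd//.
  by apply/measurable_EFinP; apply: measurable_funTS; exact: continuous_measurable_fun.
by apply/measurable_EFinP; apply: measurable_funTS; exact: continuous_measurable_fun.
Qed.

Lemma measurable_weight F s : continuous F -> 0 < s ->
  measurable_fun `](- s), s[ (fun x => F x / Num.sqrt (s ^+ 2 - x ^+ 2)).
Proof.
move=> cF s0; apply: subspace_continuous_measurable_fun => //.
apply: continuous_in_subspaceT => x; rewrite inE/= in_itv/= -ltr_norml => xs.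
exact: weight_continuous_at.
Qed.

Lemma integrable_weight F s : continuous F -> 0 < s ->
  mu.-integrable `](- s), s[ (EFin \o (fun x => F x / Num.sqrt (s ^+ 2 - x ^+ 2))).
Proof.
move=> cF s0; apply/integrableP; split.
  by apply/measurable_EFinP; exact: measurable_weight.
have cF' : continuous (fun x => `|F x|).
  by apply: (continuous_comp2 (f := @Num.norm R R)) => //; exact: norm_continuous.
rewrite (_ : (fun x => _) = fun x => (`|F x| / Num.sqrt (s ^+ 2 - x ^+ 2))%:E); last first.
  by apply/funext => x /=; rewrite normrM normfV (ger0_norm (sqrtr_ge0 _)).
rewrite ge0_integral_weight// integral_0pi ?ltry//.
exact: (continuous_comp2 cF' (@continuous_rcos _ _)).
Qed.

Lemma integral_weight F s : continuous F -> 0 < s ->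
  (\int[mu]_(x in `](- s)%R, s[) (F x / Num.sqrt (s ^+ 2 - x ^+ 2))%:E =
  (pi * Av (fun t => F (s * cos t)))%:E)%E.
Proof.
move=> cF s0.
have cN : continuous (fun x => `|F x|).
  by apply: (continuous_comp2 (f := @Num.norm R R)) => //; exact: norm_continuous.
(* Positive and negative parts written with the absolute value, so that both stay continuous. *)
pose Fp x := (`|F x| + F x) / 2; pose Fm x := (`|F x| - F x) / 2.
have cFp : continuous Fp by rewrite /Fp; cont.
have cFm : continuous Fm by rewrite /Fm; cont.
have FE x : F x = Fp x - Fm x by rewrite /Fp /Fm; field.
have Fp0 x : 0 <= Fp x by rewrite divr_ge0// -lerBlDr sub0r -normrN ler_norm.
have Fm0 x : 0 <= Fm x by rewrite divr_ge0// subr_ge0 ler_norm.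
transitivity (\int[mu]_(x in `](- s)%R, s[) ((Fp x / Num.sqrt (s ^+ 2 - x ^+ 2))%:E - (Fm x / Num.sqrt (s ^+ 2 - x ^+ 2))%:E))%E.
  by apply: eq_integral => x _; rewrite -EFinB -mulrBl -FE.
rewrite integralB_EFin//; [|exact: integrable_weight..].
rewrite !ge0_integral_weight//.
have c1 := continuous_comp2 cFp (@continuous_rcos R s).
have c2 := continuous_comp2 cFm (@continuous_rcos R s).
rewrite !integral_0pi// -EFinB -mulrBr -AvB//; congr (_ * _)%:E.
by apply: Av_eq => t; rewrite -FE.
Qed.

Lemma cheb_coefE (V : R -> R) r n : continuous V ->
  cheb_coef V r n = fcos (fun t => V (r * cos t)) n.
Proof.
move=> cV; rewrite /cheb_coef /fcos.
have cF : continuous (fun x => V (r * x) * chebT n x).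
  apply: continuousM2; last exact: continuous_chebT.
  have h : continuous (fun x : R => r * x).
    by apply: continuousM2; [exact: continuous_cst|exact: continuous_id2].
  exact: (continuous_comp2 cV h).
have h := integral_weight cF (@ltr01 R).
have -> : \int[mu]_(x in `]-1, 1[) (V (r * x) * chebT n x / Num.sqrt (1 - x ^+ 2)) =
   pi * Av (fun t => V (r * cos t) * cos (n%:R * t)).
  rewrite /Rintegral; move: h; rewrite !expr1n => ->/=; congr (_ * _).
  by apply: Av_eq => t; rewrite !mul1r chebT_cos.
rewrite /cheb_h mulrA; congr (_ * _).
case: ifP => _; first by rewrite mulVf// gt_eqF// pi_gt0.
by have := pi_gt0 R; move: (pi : R) => p p0; field; rewrite gt_eqF.
Qed.

End Substitution.

Record pdensity (R : realType) := PDensity {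
  pd :> R -> R;
  pd_ge0 : forall x, 0 <= pd x;
  pd_meas : measurable_fun setT pd;
  pd_int : (\int[lebesgue_measure]_x (pd x)%:E = 1)%E }.

Definition dens_prob (R : realType) (D : pdensity R) : set (measurableTypeR R) -> \bar R :=
  fun A => (\int[lebesgue_measure]_(x in A) (D x)%:E)%E.

(** * Probability measures with a density *)

Section DensityProbability.
Variables (R : realType) (D : pdensity R).
Local Notation leb := (@lebesgue_measure R).

Let dens0 : dens_prob D set0 = 0%E.
Proof. by rewrite /dens_prob integral_set0. Qed.

Let dens_ge0 A : (0 <= dens_prob D A)%E.
Proof. by rewrite /dens_prob integral_ge0//= => x _; rewrite lee_fin pd_ge0. Qed.

Lemma integrable_pd : leb.-integrable setT (EFin \o D).
Proof.
apply/integrableP; split; first by apply/measurable_EFinP; exact: pd_meas.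
rewrite (_ : (fun x => _) = fun x => (D x)%:E) ?pd_int ?ltry//.
by apply/funext => x /=; rewrite ger0_norm// pd_ge0.
Qed.

Let dens_sigma_additive : semi_sigma_additive (dens_prob D).
Proof.
move=> /= A mA tA mUA.
rewrite /dens_prob/= integral_bigcup//=; last first.
  by apply: (integrableS _ _ (subsetT _)) => //; exact: integrable_pd.
apply: is_cvg_ereal_nneg_natsum_cond => n _ _.
by apply: integral_ge0 => /= x ?; rewrite lee_fin pd_ge0.
Qed.

HB.instance Definition _ := isMeasure.Build _ _ _
  (dens_prob D) dens0 dens_ge0 dens_sigma_additive.

Let dens_setT : dens_prob D [set: _] = 1%E.
Proof. by rewrite /dens_prob pd_int. Qed.

HB.instance Definition _ :=
  @Measure_isProbability.Build _ _ R (dens_prob D) dens_setT.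

Lemma dens_prob_dominates : dens_prob D `<< leb.
Proof.
apply/null_content_dominatesP=> A mA muA0; rewrite /dens_prob.
apply: null_set_integral => //=; apply: measurable_funTS => /=.
by apply/measurable_EFinP; exact: pd_meas.
Qed.

(** The density agrees almost everywhere with the Radon-Nikodym derivative, having the same
    integrals over measurable sets; the change of variables for that derivative then applies. *)
Lemma integral_dens_prob (f : measurableTypeR R -> \bar R) E : measurable E ->
  (dens_prob D).-integrable E f ->
  (\int[dens_prob D]_(x in E) f x = \int[leb]_(x in E) (f x * (D x)%:E))%E.
Proof.
move=> mE fi; rewrite -(@Radon_Nikodym_change_of_variables _ _ R (dens_prob D) leb dens_prob_dominates f E mE fi).
have mD : measurable_fun setT (EFin \o D) by apply/measurable_EFinP; exact: pd_meas.
have mf := measurable_int _ fi.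
apply: ae_eq_integral => //.
- apply: emeasurable_funM => //; apply: measurable_funTS.
  apply: (measurable_int leb); apply: Radon_Nikodym_integrable; exact: dens_prob_dominates.
- by apply: emeasurable_funM => //; apply: measurable_funTS.
- apply: ae_eqe_mul2l.
  apply: (ae_eq_subset (@subsetT _ E)).
  apply: integral_ae_eq => //.
  + apply: Radon_Nikodym_integrable; exact: dens_prob_dominates.
  + by move=> A _ mA; rewrite -Radon_Nikodym_integral//; exact: dens_prob_dominates.
Qed.

(* [probability R R] and [lebesgue_measure] live on different (convertible) measurable
   structures on [R]; the push-forward along the identity changes one into the other. *)
Let idTR : measurableTypeR R -> R := idfun.

#[local] HB.instance Definition _ :=
  @isMeasurableFun.Build _ _ _ _ idTR (@measurable_id _ _ setT).

Definition densP : probability R R := distribution (dens_prob D) idTR.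

Lemma densPE A : densP A = dens_prob D A.
Proof. by []. Qed.

Lemma integral_densP (F : R -> R) (s : R) : continuous F ->
  (\int[densP]_(x in `[(- s)%R, s]) (F x)%:E = \int[leb]_(x in `[(- s)%R, s]) (F x * D x)%:E)%E.
Proof.
move=> cF; have mF := continuous_measurable_fun cF.
have Fi : (dens_prob D).-integrable `[(- s), s] (EFin \o F).
  apply: measurable_bounded_integrable => //.
  - by apply: le_lt_trans (probability_le1 (dens_prob D) _) _; rewrite ?ltry.
  - exact: measurable_funTS.
  - have [m m0 hm] := bounded_ball s cF.
    exists m; split; first exact: num_real.
    by move=> M mM x /=; rewrite in_itv/= -ler_norml => /hm xm; exact: le_trans (ltW mM).
have mEF : measurable_fun setT (EFin \o F) by exact/measurable_EFinP.
rewrite [LHS](@integral_pushforward _ _ (measurableTypeR R) R R idTR (@measurable_id _ _ setT) (dens_prob D) `[(- s), s]%classic (EFin \o F) mEF Fi)//.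
by rewrite [LHS](@integral_dens_prob (EFin \o F) `[(- s), s]%classic).
Qed.

End DensityProbability.

(** * Chebyshev moments determine a measure *)

Section BoundedIntegrals.
Variable R : realType.
Implicit Types (mu nu : probability R R) (F G : R -> R) (r : R).

Lemma prob_integrable mu F r : continuous F -> mu.-integrable `[(- r), r] (EFin \o F).
Proof.
move=> cF; apply: measurable_bounded_integrable => //.
- by rewrite (le_lt_trans (probability_le1 mu _)) ?ltry.
- by apply: measurable_funTS; exact: continuous_measurable_fun.
- have [m m0 hm] := bounded_ball r cF.
  exists m; split; first exact: num_real.
  by move=> M mM x /=; rewrite in_itv/= -ler_norml => /hm xm; exact: le_trans (ltW mM).
Qed.

(** Restricting to [-r, r] makes every continuous function integrable; nothing is lost for measures
    supported there. *)
Definition Ex mu r F : R := \int[mu]_(x in `[(- r), r]) F x.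

Lemma supported_itv mu r : supported_in r mu -> mu `[(- r), r]%classic = 1%E.
Proof.
move=> h; rewrite -[X in mu X]setCK probability_setC; last exact: measurableC.
by rewrite h sube0.
Qed.

Lemma ExD mu r F G : continuous F -> continuous G ->
  Ex mu r (fun x => F x + G x) = Ex mu r F + Ex mu r G.
Proof. by move=> cF cG; rewrite /Ex RintegralD//; exact: prob_integrable. Qed.

Lemma ExZ mu r k F : continuous F -> Ex mu r (fun x => k * F x) = k * Ex mu r F.
Proof. by move=> cF; rewrite /Ex RintegralZl//; exact: prob_integrable. Qed.

Lemma ExB mu r F G : continuous F -> continuous G ->
  Ex mu r (fun x => F x - G x) = Ex mu r F - Ex mu r G.
Proof. by move=> cF cG; rewrite /Ex RintegralB//; exact: prob_integrable. Qed.

Lemma Ex_cst mu r k : supported_in r mu -> Ex mu r (fun=> k) = k.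
Proof. by move=> h; rewrite /Ex Rintegral_cst//= supported_itv//= mulr1. Qed.

Lemma Ex_le mu r F G : continuous F -> continuous G ->
  (forall x, `|x| <= r -> F x <= G x) -> Ex mu r F <= Ex mu r G.
Proof.
move=> cF cG h; apply: le_Rintegral; [by []|exact: prob_integrable|exact: prob_integrable|].
by move=> x; rewrite /= in_itv/= -ler_norml; exact: h.
Qed.

Lemma Ex_eq mu r F G : (forall x, `|x| <= r -> F x = G x) -> Ex mu r F = Ex mu r G.
Proof.
move=> h; apply: eq_Rintegral => x; rewrite inE/= in_itv/= -ler_norml; exact: h.
Qed.

Lemma Ex_sum mu r (I : Type) (s : seq I) (F : I -> R -> R) : (forall i, continuous (F i)) ->
  Ex mu r (fun x => \sum_(i <- s) F i x) = \sum_(i <- s) Ex mu r (F i).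
Proof.
move=> cF; elim: s => [|i s IH].
  rewrite big_nil (@Ex_eq _ _ _ (fun x => 0 * 0)); last by move=> x _; rewrite big_nil mul0r.
  by rewrite (@ExZ _ _ _ (fun=> 0)) ?mul0r//; exact: continuous_cst.
rewrite big_cons -IH -ExD//; last exact: continuous_sum.
by apply: Ex_eq => x _; rewrite big_cons.
Qed.

Lemma Ex_dist mu r F G e : supported_in r mu -> continuous F -> continuous G ->
  (forall x, `|x| <= r -> `|F x - G x| <= e) -> `|Ex mu r F - Ex mu r G| <= e.
Proof.
move=> mr cF cG h; rewrite ler_distl; apply/andP; split.
  rewrite -[e](Ex_cst e mr) -ExB//; last exact: continuous_cst.
  apply: Ex_le => //; first by apply: continuousB2 => //; exact: continuous_cst.
  by move=> x /h; rewrite ler_distl => /andP[].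
rewrite -[e](Ex_cst e mr) -ExD//; last exact: continuous_cst.
apply: Ex_le => //; first by apply: continuousD2 => //; exact: continuous_cst.
by move=> x /h; rewrite ler_distl => /andP[].
Qed.

Lemma continuous_chebTr n r : continuous (fun x : R => chebT n (x / r)).
Proof.
apply: (continuous_comp2 (@continuous_chebT R n)).
by apply: continuousM2; [exact: continuous_id2|exact: continuous_cst].
Qed.

Lemma cos_le_itv r (x : R) : 0 < r -> `|x| <= r -> x = r * cos (acos (x / r)).
Proof.
move=> r0 xr; rewrite acosK; last first.
  by rewrite in_itv/= -ler_norml normrM normfV (gtr0_norm r0) ler_pdivrMr// mul1r.
by rewrite mulrC divfK// gt_eqF.
Qed.

Lemma chebT_acos r n (x : R) : 0 < r -> `|x| <= r -> chebT n (x / r) = cos (n%:R * acos (x / r)).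
Proof.
move=> r0 xr; rewrite chebTE// normrM normfV (gtr0_norm r0).
by rewrite ler_pdivrMr// mul1r.
Qed.

(** The Abel sums of h(r cos t) are finite combinations of the Chebyshev polynomials and approximate
    h uniformly on [-r, r], so equal moments force equal integrals. *)
Lemma moments_lipschitz mu nu r h L : 0 < r -> supported_in r mu -> supported_in r nu ->
  (forall n, Ex mu r (fun x => chebT n (x / r)) = Ex nu r (fun x => chebT n (x / r))) ->
  continuous h -> 0 <= L -> (forall x y, `|h x - h y| <= L * `|x - y|) ->
  Ex mu r h = Ex nu r h.
Proof.
move=> r0 mr nr mn ch L0 hL; apply/eqP; rewrite -subr_eq0 -normr_le0.
apply/ler_addgt0Pr => e e0; rewrite add0r.
pose f t := h (r * cos t).
have cf : continuous f by apply: (continuous_comp2 ch); exact: continuous_rcos.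
have fL t s : `|f t - f s| <= L * r * `|cos t - cos s|.
  by apply: le_trans (hL _ _) _; rewrite -mulrBr normrM (gtr0_norm r0) mulrA.
have Lr : 0 <= L * r by rewrite mulr_ge0// ltW.
have e4 : 0 < e / 4 by rewrite divr_gt0.
have Lr1 : 0 < L * r + 1 by rewrite ltr_wpDl.
pose d := e / 4 / (L * r + 1).
have d0 : 0 < d by rewrite divr_gt0.
pose q := 1 - Num.min (1 / 2) (d * d / 2).
have q3 : 0 < 1 - q by rewrite /q opprB addrC subrK lt_min !divr_gt0// mulr_gt0.
have q4 : 1 - q <= 1 / 2 by rewrite /q opprB addrC subrK ge_min lexx.
have q2 : 1 - q <= d * d / 2 by rewrite /q opprB addrC subrK ge_min lexx orbT.
have q01 : 0 <= q < 1 by apply/andP; split; lra.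
have [B B0 fB] := bounded_cont cf.
have A0 : 0 <= B * (4 / (1 - q) ^+ 2) by rewrite mulr_ge0// divr_ge0// sqr_ge0.
have [N hN] := geo_small q01 A0 e4; have {hN} hN := hN N (leqnn N).
pose p x := \sum_(0 <= n < N.+1) q ^+ n * fcos f n * chebT n (x / r).
have cp : continuous p.
  apply: continuous_sum => n; apply: continuousM2; first exact: continuous_cst.
  exact: continuous_chebTr.
have hp x : `|x| <= r -> `|h x - p x| <= e / 2.
  move=> xr; rewrite distrC.
  have step2 := fcos_sum_pois (acos (x / r)) N cf q01 fB.
  have step3 := poisS_lipschitz (acos (x / r)) cf q01 d0 Lr fL.
  have step3' : L * r * (d + 2 * (1 - q) / d) / 2 <= e / 4.
    have h1 : 2 * (1 - q) / d <= d by rewrite ler_pdivrMr//; lra.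
    have h2 : d * (L * r + 1) = e / 4 by rewrite /d divfK// gt_eqF.
    have h3 : L * r * (d + 2 * (1 - q) / d) <= L * r * (d + d) by rewrite ler_wpM2l// lerD2l.
    lra.
  have step2' : B * (4 * q ^+ N / (1 - q) ^+ 2) <= e / 4.
    by apply: le_trans hN; rewrite -!mulrA [q ^+ N * _]mulrC lexx.
  have pE : p x = \sum_(0 <= n < N.+1) q ^+ n * fcos f n * cos (n%:R * acos (x / r)).
    by apply: eq_bigr => n _; rewrite chebT_acos.
  have hE : h x = f (acos (x / r)) by rewrite /f -cos_le_itv.
  rewrite pE hE.
  have := le_trans step2 step2'; have := le_trans step3 step3'.
  set y := \sum_(_ <= _ < _) _; set z := Av _.
  rewrite !ler_norml => /andP[? ?] /andP[? ?].
  by apply/andP; split; lra.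
have Ep : Ex mu r p = Ex nu r p.
  have cn n : continuous (fun x : R => q ^+ n * fcos f n * chebT n (x / r)).
    apply: continuousM2; first exact: continuous_cst.
    exact: continuous_chebTr.
  rewrite /p !Ex_sum//; apply: eq_bigr => n _.
  by rewrite !ExZ ?mn//; exact: continuous_chebTr.
have := Ex_dist mr ch cp hp; have := Ex_dist nr ch cp hp; rewrite Ep.
rewrite !ler_norml => /andP[? ?] /andP[? ?]; apply/andP; split; lra.
Qed.

(** For k > 0, the piecewise linear function equal to 1 up to a and to 0 from a + 1/k on. Absolute
    values make its continuity and its Lipschitz constant k immediate. *)
Definition ramp (a k x : R) : R :=
  (`|1 - k * (x - a)| - `|k * (x - a)| + 1) / 2.

Lemma continuous_ramp a k : continuous (ramp a k).
Proof.
have cN (F : R -> R) : continuous F -> continuous (fun x => `|F x|).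
  by move=> cF; apply: (continuous_comp2 (f := @Num.norm R R)) => //; exact: norm_continuous.
have c1 : continuous (fun x : R => k * (x - a)) by cont.
have c2 := cN _ c1.
have c3 : continuous (fun x : R => 1 - k * (x - a)) by cont.
have c4 := cN _ c3.
rewrite /ramp; cont.
Qed.

Lemma ramp_lipschitz a k : 0 <= k -> forall x y, `|ramp a k x - ramp a k y| <= k * `|x - y|.
Proof.
move=> k0 x y; rewrite /ramp.
set u := 1 - k * (x - a); set v := 1 - k * (y - a).
set u' := k * (x - a); set v' := k * (y - a).
have h1 : `| `|u| - `|v| | <= k * `|x - y|.
  apply: le_trans (ler_dist_dist _ _) _.
  rewrite (_ : u - v = - (k * (x - y))); last by rewrite /u /v; ring.
  by rewrite normrN normrM (ger0_norm k0).
have h2 : `| `|u'| - `|v'| | <= k * `|x - y|.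
  apply: le_trans (ler_dist_dist _ _) _.
  rewrite (_ : u' - v' = k * (x - y)); last by rewrite /u' /v'; ring.
  by rewrite normrM (ger0_norm k0).
move: h1 h2; rewrite !ler_norml => /andP[? ?] /andP[? ?].
by apply/andP; split; lra.
Qed.

Lemma ramp_le a k x : x <= a -> 0 <= k -> ramp a k x = 1.
Proof.
move=> xa k0; have h : k * (x - a) <= 0 by rewrite mulr_ge0_le0// subr_le0.
by rewrite /ramp ger0_norm ?subr_ge0 ?(le_trans h)// ler0_norm//; field.
Qed.

Lemma ramp_ge a k x : 1 <= k * (x - a) -> ramp a k x = 0.
Proof.
by move=> h; rewrite /ramp ler0_norm ?subr_le0// ger0_norm ?(le_trans _ h)//; field.
Qed.

Lemma ramp_01 a k x : 0 <= ramp a k x <= 1.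
Proof.
rewrite /ramp; set u := k * (x - a).
have h1 : `|u| <= `|1 - u| + 1.
  by rewrite -[X in `|X| <= _](subrK 1) -(normrN (1 - u)) opprB -[X in _ <= _ + X]normr1 ler_normD.
have h2 : `|1 - u| <= 1 + `|u| by rewrite -[X in _ <= X + _]normr1 ler_normB.
by apply/andP; split; lra.
Qed.

Lemma prob_half_line mu r a : supported_in r mu ->
  (\int[mu]_(x in `[(- r)%R, r]) (\1_(`]-oo, a]) x)%:E = mu `]-oo, a]%classic)%E.
Proof.
move=> mr; rewrite integral_indic//.
apply/eqP; rewrite eq_le; apply/andP; split.
  by apply: le_measure => //; rewrite ?inE//; exact: measurableI.
pose A := `]-oo, a]%classic : set R; pose I := `[(- r), r]%classic : set R.
have mA : measurable A by exact: measurable_itv.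
have mI : measurable I by exact: measurable_itv.
have AE : A = (A `&` I) `|` (A `&` ~` I) by rewrite -setIUr setUv setIT.
have AI0 : mu (A `&` ~` I) = 0%E.
  apply: (@subset_measure0 _ _ _ mu (A `&` ~` I) (~` I)) => //.
  - by apply: measurableI => //; exact: measurableC.
  - exact: measurableC.
rewrite -/A -/I [X in (mu X <= _)%E]AE.
have h : (mu ((A `&` I) `|` (A `&` ~` I)) <= mu (A `&` I) + mu (A `&` ~` I))%E.
  apply: measureU2; first exact: measurableI.
  by apply: measurableI => //; exact: measurableC.
by apply: le_trans h _; rewrite AI0 adde0.
Qed.

(** The [ramp] lies between the indicators of the two half-lines, and it has the same integral under
    mu and nu. *)
Lemma half_line_le mu nu r (a k : R) : 0 < r -> supported_in r mu -> supported_in r nu ->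
  (forall n, Ex mu r (fun x => chebT n (x / r)) = Ex nu r (fun x => chebT n (x / r))) ->
  0 < k -> (mu `]-oo, a]%classic <= nu `]-oo, (a + k^-1)%R]%classic)%E.
Proof.
move=> r0 mr nr mn k0; have k0' := ltW k0.
have mI b : measurable_fun `[(- r), r]%classic (fun x : R => (\1_(`]-oo, b]) x : R)%:E).
  by apply/measurable_EFinP; exact: measurable_indic.
have mR : measurable_fun `[(- r), r]%classic (fun x : R => (ramp a k x)%:E).
  by apply/measurable_EFinP; apply: measurable_funTS; apply: continuous_measurable_fun; exact: continuous_ramp.
have ExE (m : probability R R) : (\int[m]_(x in `[(- r)%R, r]) (ramp a k x)%:E = (Ex m r (ramp a k))%:E)%E.
  by rewrite /Ex /Rintegral fineK//; apply: integrable_fin_num => //; apply: prob_integrable; exact: continuous_ramp.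
rewrite -(prob_half_line a mr) -(prob_half_line _ nr).
apply: (@le_trans _ _ (\int[mu]_(x in `[(- r)%R, r]) (ramp a k x)%:E)%E).
  apply: ge0_le_integral => //.
        move=> x _; rewrite lee_fin indicE mem_setE in_itv/=; have [xa|_] := leP x a; first by rewrite ramp_le.
    by have /andP[] := ramp_01 a k x.
rewrite ExE (moments_lipschitz r0 mr nr mn (@continuous_ramp a k) k0' (@ramp_lipschitz a k k0')) -ExE.
apply: ge0_le_integral => //.
  by move=> x _; rewrite lee_fin; have /andP[] := ramp_01 a k x.
move=> x _; rewrite lee_fin indicE mem_setE in_itv/=; have [_|xa] := leP x (a + k^-1); first by have /andP[] := ramp_01 a k x.
rewrite ramp_ge//.
have h : k^-1 <= x - a by rewrite lerBrDl ltW.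
by have := ler_wpM2l k0' h; rewrite mulfV// gt_eqF.
Qed.

Lemma half_line_le0 mu nu r a : 0 < r -> supported_in r mu -> supported_in r nu ->
  (forall n, Ex mu r (fun x => chebT n (x / r)) = Ex nu r (fun x => chebT n (x / r))) ->
  (mu `]-oo, a]%classic <= nu `]-oo, a]%classic)%E.
Proof.
move=> r0 mr nr mn.
pose F n := `]-oo, (a + n.+1%:R^-1)]%classic : set R.
have hF : nu (F n) @[n --> \oo] --> nu (\bigcap_n F n).
  apply: nonincreasing_cvg_mu => //.
  - by apply: le_lt_trans (probability_le1 nu _) _; rewrite ?ltry//; exact: measurable_itv.
  - by move=> n; exact: measurable_itv.
  - by apply: bigcap_measurable => // n _; exact: measurable_itv.
  - move=> n m nm; apply/subsetPset; apply: subset_itvl.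
    by rewrite bnd_simp lerD2l lef_pV2 ?posrE// ler_nat.
have AE : `]-oo, a]%classic = \bigcap_n F n by rewrite (itvNycEbigcap false).
rewrite [X in (_ <= nu X)%E]AE; have /cvg_lim <- := hF => //.
apply: lime_ge; first by apply/cvg_ex; exists (nu (\bigcap_n F n)).
by apply: nearW => n; exact: (half_line_le _ r0 mr nr mn).
Qed.

Lemma moments_unique mu nu r : 0 < r -> supported_in r mu -> supported_in r nu ->
  (forall n, Ex mu r (fun x => chebT n (x / r)) = Ex nu r (fun x => chebT n (x / r))) ->
  forall A, measurable A -> mu A = nu A.
Proof.
move=> r0 mr nr mn.
have E a : mu `]-oo, a]%classic = nu `]-oo, a]%classic.
  apply/eqP; rewrite eq_le; apply/andP; split; first exact: (half_line_le0 _ r0 mr nr mn).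
  by apply: (half_line_le0 _ r0 nr mr) => n; rewrite mn.
have E' a : mu `]a, +oo[%classic = nu `]a, +oo[%classic.
  by rewrite -setCitvl !probability_setC// E.
pose g n := `](- n%:R), +oo[%classic : set R.
have gG n : RGenOInfty.G (g n) by exists (- n%:R).
have GI : setI_closed (@RGenOInfty.G R).
  move=> _ _ [x ->] [y ->]; exists (Num.max x y).
  by apply/seteqP; split => z /=; rewrite !in_itv/= !andbT gt_max => /andP.
have gU : \bigcup_k g k = setT.
  apply/seteqP; split => // x _; exists (Num.truncn `|x|).+1 => //=.
  rewrite /g/= in_itv/= andbT ltrNl; apply: le_lt_trans (truncnS_gt _).
  by rewrite -normrN ler_norm.
move=> A mA.
apply: (@measure_unique _ R R (@RGenOInfty.G R) g (RGenOInfty.measurableE R) GI gG gU mu nu) => //.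
- by move=> _ [x ->]; exact: E'.
- move=> k; apply: le_lt_trans (probability_le1 mu _) _; rewrite ?ltry//; exact: measurable_itv.
Qed.

End BoundedIntegrals.

(** * The logarithmic kernel *)

Section LogKernel.
Variable R : realType.
Implicit Types (s q d x y : R).

(** A continuous regularisation of the logarithmic kernel, below [logK] and increasing as d
    decreases. *)
Definition Lker d x y : R := - 2^-1 * ln ((x - y) ^+ 2 + d ^+ 2).

(* A partial sum of the expansion of - ln |x - y| in Chebyshev polynomials, with Abel weights. *)
Definition kN s q N x y : R := ln (2 / s) +
  \sum_(1 <= n < N.+2) 2 * q ^+ n / n%:R * chebT n (x / s) * chebT n (y / s).

Lemma Lker_arg_gt0 d x y : 0 < d -> 0 < (x - y) ^+ 2 + d ^+ 2.
Proof. by move=> d0; rewrite ltr_wpDl ?sqr_ge0// exprn_gt0. Qed.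

Lemma continuous_Lker d x : 0 < d -> continuous (Lker d x).
Proof.
move=> d0 y; apply: cvgM; first exact: cvg_cst.
have h : continuous (fun y : R => (x - y) ^+ 2 + d ^+ 2) by cont.
apply: (cvg_comp _ (@ln R) (h y)).
by apply: continuous_ln; exact: Lker_arg_gt0.
Qed.

Lemma Lker_mono d1 d2 x y : 0 < d1 -> d1 <= d2 -> Lker d2 x y <= Lker d1 x y.
Proof.
move=> d0 d12; rewrite /Lker !mulNr lerN2 ler_pM2l// ler_ln ?posrE ?Lker_arg_gt0//.
  by rewrite lerD2l lerXn2r// nnegrE ltW// (lt_le_trans d0).
exact: lt_le_trans d12.
Qed.

Lemma Lker_logK d x y : 0 < d -> ((Lker d x y)%:E <= logK x y)%E.
Proof.
move=> d0; rewrite /logK; case: eqVneq => [_|xy]; first exact: leey.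
rewrite lee_fin /Lker.
have xy0 : 0 < `|x - y| by rewrite normr_gt0 subr_eq0.
have -> : - ln `|x - y| = - 2^-1 * ln (`|x - y| ^+ 2).
  by rewrite lnXn// mulr2n; field.
rewrite !mulNr lerN2 ler_pM2l// ler_ln ?posrE ?exprn_gt0 ?Lker_arg_gt0//.
by rewrite real_normK ?num_real// lerDl sqr_ge0.
Qed.

(** With x = s cos f and y = s cos t, the polynomial A is poisD q (f + t) * poisD q (f - t). At q =
    1 it becomes 4 (x - y)^2 / s^2, which is why ln(2/s) - ln(A)/2 approximates - ln |x - y|. *)
Lemma sum_lnpoisD s q N x y : 0 < s -> 0 < q < 1 -> `|x| <= s -> `|y| <= s ->
  let A := (1 - q ^+ 2) ^+ 2 + 4 * q ^+ 2 * ((x / s) ^+ 2 + (y / s) ^+ 2)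
           - 4 * q * (1 + q ^+ 2) * (x / s) * (y / s) in
  0 < A /\ `|ln (2 / s) - 2^-1 * ln A - kN s q N x y| <= 4 * q ^+ N / (1 - q) ^+ 2.
Proof.
move=> s0 /andP[q0 q1] xs ys A.
have q01 : 0 <= q < 1 by rewrite ltW.
pose f := acos (x / s); pose t := acos (y / s).
have xs1 : `|x / s| <= 1 by rewrite normrM normfV (gtr0_norm s0) ler_pdivrMr// mul1r.
have ys1 : `|y / s| <= 1 by rewrite normrM normfV (gtr0_norm s0) ler_pdivrMr// mul1r.
have cf : cos f = x / s by rewrite acosK// in_itv/= -ler_norml.
have ct : cos t = y / s by rewrite acosK// in_itv/= -ler_norml.
have AE : A = poisD q (f + t) * poisD q (f - t).
  have -> : A = (1 + q ^+ 2 - 2 * q * cos f * cos t) ^+ 2 - 4 * q ^+ 2 * (1 - cos f ^+ 2) * (1 - cos t ^+ 2).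
    by rewrite /A cf ct; ring.
  by rewrite /poisD (cosD f t) (cosB f t) -!sin2cos2; ring.
have D1 := poisD_gt0 (f + t) q01; have D2 := poisD_gt0 (f - t) q01.
have A0 : 0 < A by rewrite AE mulr_gt0.
split => //; rewrite AE [ln (poisD _ _ * _)]lnM ?posrE//.
have h1 := lnpoisD_sum (f + t) N q01; have h2 := lnpoisD_sum (f - t) N q01.
have E : ln (2 / s) - 2^-1 * (ln (poisD q (f + t)) + ln (poisD q (f - t))) - kN s q N x y =
  (- 2^-1 * ln (poisD q (f + t)) - \sum_(1 <= n < N.+2) q ^+ n / n%:R * cos (n%:R * (f + t))) +
  (- 2^-1 * ln (poisD q (f - t)) - \sum_(1 <= n < N.+2) q ^+ n / n%:R * cos (n%:R * (f - t))).
  have -> : kN s q N x y = ln (2 / s) + (\sum_(1 <= n < N.+2) q ^+ n / n%:R * cos (n%:R * (f + t)) +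
     \sum_(1 <= n < N.+2) q ^+ n / n%:R * cos (n%:R * (f - t))).
    rewrite /kN -big_split/=; congr (_ + _); apply: eq_bigr => n _.
    by rewrite mulrDr mulrBr cosD cosB !chebTE// -/f -/t; ring.
  by ring.
rewrite E; apply: le_trans (ler_normD _ _) _.
have -> : 4 * q ^+ N / (1 - q) ^+ 2 = 2 * q ^+ N / (1 - q) ^+ 2 + 2 * q ^+ N / (1 - q) ^+ 2.
  by ring.
exact: lerD.
Qed.

Lemma kN_le_Lker s q N x y : 0 < s -> 0 < q < 1 -> `|x| <= s -> `|y| <= s ->
  kN s q N x y + ln q - 4 * q ^+ N / (1 - q) ^+ 2 <= Lker (s * (1 - q) ^+ 2 / 2) x y.
Proof.
move=> s0 q01 xs ys; have /= [] := sum_lnpoisD N s0 q01 xs ys.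
set A := _ - _ => A0; rewrite ler_norml => /andP[h1 h2].
have [q0 q1] := andP q01.
have d0 : 0 < s * (1 - q) ^+ 2 / 2 by rewrite divr_gt0// mulr_gt0// exprn_gt0// subr_gt0.
suff : ln (2 / s) - 2^-1 * ln A + ln q <= Lker (s * (1 - q) ^+ 2 / 2) x y by lra.
have B0 := Lker_arg_gt0 x y d0; rewrite /Lker; set B := _ + _ in B0 *.
(* The difference has the factor (1 - q)^2. In the cofactor, u v <= 1 leaves at least (1 - q)^2,
   which absorbs the contribution of d; this fixes the scale s (1 - q)^2 / 2. *)
have AB : 4 * q ^+ 2 * B <= s ^+ 2 * A.
  have xs1 : `|x / s| <= 1 by rewrite normrM normfV (gtr0_norm s0) ler_pdivrMr// mul1r.
  have ys1 : `|y / s| <= 1 by rewrite normrM normfV (gtr0_norm s0) ler_pdivrMr// mul1r.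
  have xE : x = s * (x / s) by field; rewrite gt_eqF.
  have yE : y = s * (y / s) by field; rewrite gt_eqF.
  rewrite /A /B; rewrite [in leLHS]xE [in leLHS]yE; move: xs1 ys1.
  move: (x / s) (y / s) => u v u1 v1.
  have uv : u * v <= 1.
    by apply: le_trans (ler_norm _) _; rewrite normrM mulr_ile1.
  rewrite -subr_ge0.
  rewrite (_ : _ - _ = s ^+ 2 * (1 - q) ^+ 2 * ((1 + q) ^+ 2 - 4 * q * (u * v) - q ^+ 2 * (1 - q) ^+ 2)); last by field.
  apply: mulr_ge0; first by rewrite mulr_ge0// sqr_ge0.
  have : q * (u * v) <= q by rewrite -[leRHS]mulr1 ler_wpM2l// ltW.
  have : q ^+ 2 * (1 - q) ^+ 2 <= (1 - q) ^+ 2.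
    by rewrite ler_piMl ?sqr_ge0// expr_le1// ltW.
  lra.
have l1 : ln (4 * q ^+ 2 * B) <= ln (s ^+ 2 * A).
  by rewrite ler_ln// posrE ?mulr_gt0// exprn_gt0.
rewrite lnM ?posrE ?mulr_gt0 ?exprn_gt0// lnM ?posrE ?exprn_gt0// lnM ?posrE ?exprn_gt0// in l1.
rewrite !lnXn// in l1.
have l4 : ln 4 = 2 * ln 2 :> R.
  by rewrite (_ : 4 = 2 ^+ 2) ?lnXn// ?mulr2n; ring.
rewrite lnM ?posrE ?invr_gt0// lnV ?posrE//.
rewrite l4 !mulr2n in l1; lra.
Qed.

(** The reverse comparison needs the coarser scale 2 s (1 - q): now d^2 must absorb the excess of
    s^2 A, for which only u v >= -1 is available. *)
Lemma Lker_le_kN s q N x y : 0 < s -> 0 < q < 1 -> `|x| <= s -> `|y| <= s ->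
  Lker (2 * s * (1 - q)) x y <= kN s q N x y + 4 * q ^+ N / (1 - q) ^+ 2.
Proof.
move=> s0 q01 xs ys; have /= [] := sum_lnpoisD N s0 q01 xs ys.
set A := _ - _ => A0; rewrite ler_norml => /andP[h1 h2].
have [q0 q1] := andP q01.
have d0 : 0 < 2 * s * (1 - q) by rewrite !mulr_gt0// subr_gt0.
suff : Lker (2 * s * (1 - q)) x y <= ln (2 / s) - 2^-1 * ln A by lra.
have B0 := Lker_arg_gt0 x y d0; rewrite /Lker; set B := _ + _ in B0 *.
have AB : s ^+ 2 * A <= 4 * B.
  have xs1 : `|x / s| <= 1 by rewrite normrM normfV (gtr0_norm s0) ler_pdivrMr// mul1r.
  have ys1 : `|y / s| <= 1 by rewrite normrM normfV (gtr0_norm s0) ler_pdivrMr// mul1r.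
  have xE : x = s * (x / s) by field; rewrite gt_eqF.
  have yE : y = s * (y / s) by field; rewrite gt_eqF.
  rewrite /A /B; rewrite [in leRHS]xE [in leRHS]yE; move: xs1 ys1.
  move: (x / s) (y / s) => u v u1 v1.
  have uv : - 1 <= u * v.
    have : `|u * v| <= 1 by rewrite normrM mulr_ile1.
    by rewrite ler_norml => /andP[].
  rewrite -subr_ge0.
  rewrite (_ : _ - _ = s ^+ 2 * (4 * (1 - q ^+ 2) * (u - v) ^+ 2 + (1 - q) ^+ 2 * (16 - (1 + q) ^+ 2 + 4 * q * (u * v)))); last by field.
  apply: mulr_ge0; first exact: sqr_ge0.
  have q21 : 0 <= 1 - q ^+ 2 by rewrite subr_ge0 expr_le1// ltW.
  apply: addr_ge0; first by apply: mulr_ge0; [rewrite mulr_ge0|exact: sqr_ge0].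
  apply: mulr_ge0; first exact: sqr_ge0.
  have : - q <= q * (u * v) by rewrite -[leLHS]mulr1 mulNr -mulrN ler_wpM2l// ltW.
  nra.
have l1 : ln (s ^+ 2 * A) <= ln (4 * B).
  by rewrite ler_ln// posrE mulr_gt0// exprn_gt0.
rewrite lnM ?posrE ?exprn_gt0// lnM ?posrE// in l1.
rewrite !lnXn// in l1.
have l4 : ln 4 = 2 * ln 2 :> R.
  by rewrite (_ : 4 = 2 ^+ 2) ?lnXn// ?mulr2n; ring.
rewrite lnM ?posrE ?invr_gt0// lnV ?posrE//.
rewrite l4 !mulr2n in l1; lra.
Qed.

(** p is the root of p + 1/p = 2 x / s in (0, 1), which is s / (x + sqrt(x^2 - s^2)). *)
Lemma joukowski s x : 0 < s -> s < x -> exists2 p, 0 < p < 1 & x = s * (p + p^-1) / 2.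
Proof.
move=> s0 sx; pose w := Num.sqrt (x ^+ 2 - s ^+ 2).
have xs : 0 < x ^+ 2 - s ^+ 2 by rewrite subr_gt0 ltr_pXn2r ?nnegrE// ltW// (lt_trans s0).
have w0 : 0 < w by rewrite sqrtr_gt0.
have wE : w ^+ 2 = x ^+ 2 - s ^+ 2 by rewrite sqr_sqrtr// ltW.
have x0 : 0 < x by exact: lt_trans sx.
have xw : 0 < x + w by rewrite addr_gt0.
exists (s / (x + w)).
  by rewrite divr_gt0//= ltr_pdivrMr// mul1r; lra.
have sE0 : (x - w) * (x + w) = x ^+ 2 - w ^+ 2 by ring.
have sE : s ^+ 2 = (x - w) * (x + w) by rewrite sE0 wE; ring.
rewrite invf_div; apply: (mulIf (_ : 2 * (x + w) != 0)); first by rewrite gt_eqF// mulr_gt0.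
transitivity (s ^+ 2 + (x + w) ^+ 2).
  by rewrite sE; ring.
by field; rewrite !gt_eqF.
Qed.

End LogKernel.

(** * The logarithmic potential of the equilibrium measure *)

Lemma chebT_opp (R : realType) n (x : R) : chebT n (- x) = (-1) ^+ n * chebT n x.
Proof.
suff : (chebT2 n (- x)).1 = (-1) ^+ n * (chebT2 n x).1 /\
       (chebT2 n (- x)).2 = (-1) ^+ n.+1 * (chebT2 n x).2 by case.
elim: n => [|n [IH1 IH2]] /=; first by rewrite expr0 expr1 mul1r mulN1r.
by split=> //; rewrite IH1 IH2 !exprS; ring.
Qed.

Section EquilibriumPotential.
Variables (R : realType) (V W W2 W3 : R -> R).
Hypothesis pot : potential V W W2 W3.
Hypothesis Veven : forall x, V (- x) = V x.
Variables (s : R) (rho : probability R R).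
Hypothesis s0 : 0 < s.
Hypothesis rhos : supported_in s rho.
Hypothesis rho_moments : forall n, (0 < n)%N ->
  Ex rho s (fun x => chebT n (x / s)) = - fsin (Gsin W s) n / 2.

Let dV := pot_V pot.
Let cV : continuous V := is_derive_cont dV.
Let cW : continuous W := is_derive_cont (pot_W pot).
Local Notation c := (fcos (Vcos V s)).

Definition Ceq : R := ln (2 / s) + c 0.

Lemma continuous_kN q N x : continuous (kN s q N x).
Proof.
apply: continuousD2; first exact: continuous_cst.
apply: continuous_sum => n; apply: continuousM2; first exact: continuous_cst.
exact: continuous_chebTr.
Qed.

(** The weight 2/n of the kernel meets the moment - n c_n / 2, so that the potential of rho has the
    Chebyshev coefficients of - V. *)
Lemma moments_fcos n k : (0 < n)%N ->
  2 * k / n%:R * Ex rho s (fun x => chebT n (x / s)) = - (k * c n).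
Proof.
move=> n0; rewrite rho_moments// -(fcos_fsin pot)//.
by field; rewrite pnatr_eq0 -lt0n.
Qed.

Lemma Ex_kN q N x : Ex rho s (kN s q N x) =
  ln (2 / s) - \sum_(1 <= n < N.+2) q ^+ n * c n * chebT n (x / s).
Proof.
have cn n : continuous (fun y : R => 2 * q ^+ n / n%:R * chebT n (x / s) * chebT n (y / s)).
  by apply: continuousM2; [exact: continuous_cst|exact: continuous_chebTr].
rewrite /kN ExD; [|exact: continuous_cst|exact: continuous_sum].
rewrite Ex_cst// Ex_sum//; congr (_ + _); rewrite -sumrN.
apply: eq_big_nat => n /andP[n0 _]; rewrite ExZ; last exact: continuous_chebTr.
have := moments_fcos (q ^+ n) n0; set m := Ex _ _ _ => h.
have -> : 2 * q ^+ n / n%:R * chebT n (x / s) * m = 2 * q ^+ n / n%:R * m * chebT n (x / s) by ring.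
by rewrite h mulNr.
Qed.

(** Integrating [kN] leaves minus the Abel sum of the cosine series of V without its constant term;
    [Ceq] restores that term. The estimate is uniform on [-s, s]. *)
Lemma Ex_kN_approx e : 0 < e -> exists2 d, 0 < d & forall q, 0 < q < 1 -> 1 - q <= d ->
  exists N0, forall N x, (N0 <= N)%N -> `|x| <= s ->
  `|Ex rho s (kN s q N x) - (Ceq - V x)| <= e.
Proof.
move=> e0; have e2 : 0 < e / 2 by rewrite divr_gt0.
have [M M0 hM] := Gsin_decay pot s; have {hM} hM := Vcos_decay pot (hM _ s0 (lexx s)).
have [L L0 hL] := Vcos_lipschitz pot s0.
have [N0 hN0] := fcos_inversion (continuous_Vcos pot (r := s)) M0 L0 e2 hL hM.
have [d d0 hd] := abel_uniform M0 e2.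
exists d => // q q01 qd; exists N0 => N x NN xs; rewrite Ex_kN.
have [q0 q1] := andP q01.
have h1 := hN0 N.+2 (acos (x / s)) (leq_trans NN (leq_trans (leqnSn _) (leqnSn _))).
have h2 := hd _ (fun n => cos (n%:R * acos (x / s))) q N.+2 hM (fun n => cos_max _).
have {h2} h2 := h2 (introT andP (conj (ltW q0) (ltW q1))) qd.
move: h1; rewrite big_ltn// mul0r cos0 mulr1.
have -> : Vcos V s (acos (x / s)) = V x by rewrite /Vcos -cos_le_itv.
have -> : \sum_(1 <= n < N.+2) q ^+ n * c n * chebT n (x / s) =
          \sum_(1 <= n < N.+2) q ^+ n * c n * cos (n%:R * acos (x / s)).
  by apply: eq_bigr => n _; rewrite chebT_acos.
move: h2; rewrite /Ceq; set X := \sum_(_ <= _ < _) _; set Y := \sum_(_ <= _ < _) _.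
rewrite !ler_norml => /andP[? ?] /andP[? ?].
by apply/andP; split; lra.
Qed.

(** Every scale d is coarser than 2 s (1 - q) once q is close to 1, so [Lker d] lies below [kN] up
    to a small error. *)
Lemma Ex_Lker_le d x : 0 < d -> `|x| <= s -> Ex rho s (Lker d x) <= Ceq - V x.
Proof.
move=> d0 xs; apply/ler_addgt0Pr => e e0.
have e2 : 0 < e / 2 by rewrite divr_gt0.
have [d1 d10 h1] := Ex_kN_approx e2.
pose q := 1 - Num.min (1 / 2) (Num.min d1 (d / (2 * s))).
have s2 : 0 < 2 * s by rewrite mulr_gt0.
have q3 : 0 < 1 - q by rewrite /q opprB addrC subrK !lt_min d10 !divr_gt0.
have q4 : 1 - q <= 1 / 2 by rewrite /q opprB addrC subrK ge_min lexx.
have q1 : 1 - q <= d1 by rewrite /q opprB addrC subrK !ge_min lexx orbT.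
have q2 : 1 - q <= d / (2 * s) by rewrite /q opprB addrC subrK !ge_min lexx !orbT.
have q01 : 0 < q < 1 by apply/andP; split; lra.
have [N0 hN0] := h1 q q01 q1.
have q01' : 0 <= q < 1 by have /andP[/ltW -> ->] := q01.
have A0 : 0 <= 4 / (1 - q) ^+ 2 by rewrite divr_ge0// sqr_ge0.
have [N1 hN1] := geo_small q01' A0 e2.
pose N := maxn N0 N1.
have hN := hN0 N x (leq_maxl _ _) xs.
have hN' := hN1 N (leq_maxr _ _).
have key : Ex rho s (Lker d x) <= Ex rho s (fun y => kN s q N x y + e / 2).
  apply: Ex_le; [exact: continuous_Lker| |].
    by apply: continuousD2; [exact: continuous_kN|exact: continuous_cst].
  move=> y ys; apply: (@le_trans _ _ (Lker (2 * s * (1 - q)) x y)).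
    apply: Lker_mono; first by rewrite mulr_gt0.
    by rewrite mulrC -ler_pdivlMr.
  apply: le_trans (Lker_le_kN N s0 q01 xs ys) _; rewrite lerD2l.
  by move: hN'; rewrite mulrAC.
move: key; rewrite ExD; [|exact: continuous_kN|exact: continuous_cst]; rewrite Ex_cst//.
by move: hN; rewrite ler_norml => /andP[_]; lra.
Qed.

Lemma Ex_Lker_ge_in e : 0 < e -> exists2 d, 0 < d &
  forall x, `|x| <= s -> Ceq - V x - e <= Ex rho s (Lker d x).
Proof.
move=> e0; have e3 : 0 < e / 3 by rewrite divr_gt0.
have [d1 d10 h1] := Ex_kN_approx e3.
have /cvgrPdist_le /(_ _ e3) [d2 /= d20 h2] : ln x @[x --> (1 : R)] --> ln (1 : R).
  exact: continuous_ln.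
pose q := 1 - Num.min (1 / 2) (Num.min d1 (d2 / 2)).
have q3 : 0 < 1 - q by rewrite /q opprB addrC subrK !lt_min d10 !divr_gt0.
have q4 : 1 - q <= 1 / 2 by rewrite /q opprB addrC subrK ge_min lexx.
have q1 : 1 - q <= d1 by rewrite /q opprB addrC subrK !ge_min lexx orbT.
have q2 : 1 - q <= d2 / 2 by rewrite /q opprB addrC subrK !ge_min lexx !orbT.
have q01 : 0 < q < 1 by apply/andP; split; lra.
have [N0 hN0] := h1 q q01 q1.
have q01' : 0 <= q < 1 by have /andP[/ltW -> ->] := q01.
have A0 : 0 <= 4 / (1 - q) ^+ 2 by rewrite divr_ge0// sqr_ge0.
have [N1 hN1] := geo_small q01' A0 e3.
pose N := maxn N0 N1.
have hN' := hN1 N (leq_maxr _ _).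
have lnq : - (e / 3) <= ln q.
  have : `|ln 1 - ln q| <= e / 3 by apply: h2; rewrite /= gtr0_norm//; lra.
  by rewrite ln1 sub0r normrN ler_norml => /andP[].
have d0 : 0 < s * (1 - q) ^+ 2 / 2 by rewrite divr_gt0// mulr_gt0// exprn_gt0.
exists (s * (1 - q) ^+ 2 / 2) => // x xs.
have hN := hN0 N x (leq_maxl _ _) xs.
have key : Ex rho s (fun y => kN s q N x y + (ln q - e / 3)) <= Ex rho s (Lker (s * (1 - q) ^+ 2 / 2) x).
  apply: Ex_le; [|exact: continuous_Lker|].
    by apply: continuousD2; [exact: continuous_kN|exact: continuous_cst].
  move=> y ys; apply: le_trans _ (kN_le_Lker N s0 q01 xs ys); rewrite addrA lerD2l lerN2.
  by move: hN'; rewrite mulrAC.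
move: key; rewrite ExD; [|exact: continuous_kN|exact: continuous_cst]; rewrite Ex_cst//.
by move: hN; rewrite ler_norml => /andP[+ _]; lra.
Qed.

(** Evenness of V annihilates the odd coefficients; as a sign rule it lets the sign of x be dropped
    termwise. *)
Lemma fcos_parity n : (-1) ^+ n * c n = c n.
Proof.
rewrite /fcos mulrCA; congr (_ * _).
have cc : continuous (fun t => Vcos V s t * cos (n%:R * t)).
  have cv := continuous_Vcos pot (r := s); cont.
rewrite -[RHS]Av_refl// -AvZ//; apply: Av_eq => t.
rewrite /Vcos -[cos (n%:R * (pi - t))]chebT_cos cosB cospi sinpi mul0r addr0 mulN1r.
by rewrite chebT_opp chebT_cos mulrN Veven; ring.
Qed.

(** The boolean b reduces negative x to positive x by reflecting y to z. The square root of (|x| -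
    z)^2 + d^2 is at most |x| - z + d, and writing |x| + d in terms of p turns this into s / (2 p) *
    poisD p t, whose logarithm is expanded. *)
Lemma Lker_outside d x y p N (b : bool) : 0 < d -> `|x| = (-1) ^+ b * x -> s < `|x| -> `|y| <= s ->
  0 < p < 1 -> `|x| + d = s * (p + p^-1) / 2 ->
  ln (2 / s) + ln p + \sum_(1 <= n < N.+2) 2 * (p ^+ n * (-1) ^+ b ^+ n) / n%:R * chebT n (y / s)
   - 4 * p ^+ N / (1 - p) ^+ 2 <= Lker d x y.
Proof.
move=> d0 xb sx ys /andP[p0 p1] xp.
have p01 : 0 <= p < 1 by rewrite ltW.
pose z := (-1) ^+ b * y.
have zs : `|z| <= s by rewrite normrM normrX normrN1 expr1n mul1r.
pose t := acos (z / s).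
have zs1 : `|z / s| <= 1 by rewrite normrM normfV (gtr0_norm s0) ler_pdivrMr// mul1r.
have ct : cos t = z / s by rewrite acosK// in_itv/= -ler_norml.
have D0 := poisD_gt0 t p01.
have xz : `|x| + d - z = s / 2 * p^-1 * poisD p t.
  by rewrite xp /poisD ct; field; rewrite !gt_eqF.
have xz0 : 0 < `|x| + d - z by rewrite xz !mulr_gt0// ?invr_gt0.
have L1 : - ln (`|x| + d - z) <= Lker d x y.
  have xy : (x - y) ^+ 2 = (`|x| - z) ^+ 2.
    rewrite xb /z -mulrBr exprMn -[X in _ = X * _]/((-1) ^+ b ^+ 2) sqrr_sign mul1r //.
  have xz1 : 0 <= `|x| - z.
    by rewrite subr_ge0; apply: le_trans (ltW sx); apply: le_trans zs; exact: ler_norm.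
  rewrite /Lker xy.
  have -> : - ln (`|x| + d - z) = - 2^-1 * ln ((`|x| + d - z) ^+ 2).
    by rewrite lnXn// mulr2n; field.
  rewrite !mulNr lerN2 ler_pM2l// ler_ln ?posrE ?exprn_gt0//; last first.
    by rewrite ltr_wpDl ?sqr_ge0// exprn_gt0.
  have := mulr_ge0 xz1 (ltW d0); nra.
apply: le_trans L1.
have -> : ln (`|x| + d - z) = - ln (2 / s) - ln p + ln (poisD p t).
  rewrite xz lnM ?posrE ?mulr_gt0 ?invr_gt0// lnM ?posrE ?mulr_gt0 ?invr_gt0//.
  by rewrite !lnM ?posrE ?invr_gt0// !lnV ?posrE//; ring.
have -> : \sum_(1 <= n < N.+2) 2 * (p ^+ n * (-1) ^+ b ^+ n) / n%:R * chebT n (y / s) =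
  2 * \sum_(1 <= n < N.+2) p ^+ n / n%:R * cos (n%:R * t).
  rewrite mulr_sumr; apply: eq_bigr => n _.
  rewrite -chebT_cos ct /z; case: (b).
    by rewrite expr1 mulN1r mulNr chebT_opp; ring.
  by rewrite expr0 mul1r expr1n; ring.
have := lnpoisD_sum t N p01; rewrite ler_norml => /andP[h1 h2].
have -> : 4 * p ^+ N / (1 - p) ^+ 2 = 2 * (2 * p ^+ N / (1 - p) ^+ 2) by ring.
lra.
Qed.

(** Integrating [Lker_outside] produces the sum of p^n c_n, which [outside_sum] bounds at the point
    |x| + d; hence V is evaluated there and not at x. *)
Lemma Ex_Lker_ge_out d x : Smean W s = 1 -> 0 < d -> s < `|x| ->
  Ceq - V (`|x| + d) <= Ex rho s (Lker d x).
Proof.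
move=> S1 d0 sx; apply/ler_addgt0Pr => e e0.
have e2 : 0 < e / 2 by rewrite divr_gt0.
have sxd : s < `|x| + d by rewrite ltr_pwDr// ltW.
have [p p01 xp] := joukowski s0 sxd.
have [p0 p1] := andP p01.
have p01' : 0 <= p < 1 by rewrite ltW.
have [N0 hN0] := outside_sum pot s0 S1 (introT andP (conj p0 (ltW p1))) e2.
have A0 : 0 <= 4 / (1 - p) ^+ 2 by rewrite divr_ge0// sqr_ge0.
have [N1 hN1] := geo_small p01' A0 e2.
pose N := maxn N0 N1.
have hN' := hN1 N (leq_maxr _ _).
have hN := hN0 N.+2 (leq_trans (leq_maxl _ _) (leq_trans (leqnSn _) (leqnSn _))).
have [b xb] : exists b : bool, `|x| = (-1) ^+ b * x.
  have [x0|x0] := leP 0 x; first by exists false; rewrite expr0 mul1r ger0_norm.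
  by exists true; rewrite expr1 mulN1r ltr0_norm.
pose G y := \sum_(1 <= n < N.+2) 2 * (p ^+ n * (-1) ^+ b ^+ n) / n%:R * chebT n (y / s).
have cn n : continuous (fun y : R => 2 * (p ^+ n * (-1) ^+ b ^+ n) / n%:R * chebT n (y / s)).
  by apply: continuousM2; [exact: continuous_cst|exact: continuous_chebTr].
have cG : continuous G by exact: continuous_sum.
have EG : Ex rho s G = - \sum_(1 <= n < N.+2) p ^+ n * c n.
  rewrite /G Ex_sum// -sumrN; apply: eq_big_nat => n /andP[n0 _].
  rewrite ExZ; last exact: continuous_chebTr.
  rewrite moments_fcos//; congr (- _); rewrite -mulrA; congr (_ * _).
  by case: (b); [rewrite expr1 fcos_parity|rewrite expr0 expr1n mul1r].
have key : Ex rho s (fun y => G y + (ln (2 / s) + ln p - e / 2)) <= Ex rho s (Lker d x).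
  apply: Ex_le; [|exact: continuous_Lker|].
    by apply: continuousD2 => //; exact: continuous_cst.
  move=> y ys; apply: le_trans _ (Lker_outside N d0 xb sx ys p01 xp).
  have -> : 4 * p ^+ N / (1 - p) ^+ 2 = 4 / (1 - p) ^+ 2 * p ^+ N by rewrite mulrAC.
  rewrite -/(G y); lra.
move: key; rewrite ExD//; last exact: continuous_cst.
rewrite Ex_cst// EG; move: hN; rewrite -xp big_ltn// expr0 mul1r /Ceq.
set X := \sum_(_ <= _ < _) _; lra.
Qed.

(** The disjunction covers both phases: either no point of [-r, r] lies outside [-s, s], or the
    critical equation holds at s. Local Lipschitz continuity of V absorbs the shift by d. *)
Lemma Ex_Lker_ge r e : s <= r -> s = r \/ Smean W s = 1 -> 0 < e -> exists2 d, 0 < d &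
  forall x, `|x| <= r -> Ceq - V x - e <= Ex rho s (Lker d x).
Proof.
move=> sr [<-|S1] e0; first exact: Ex_Lker_ge_in.
have [d1 d10 h1] := Ex_Lker_ge_in e0.
have [L L0 hL] := derive_lipschitz (r + 1) dV cW.
have L1 : 0 < L + 1 by rewrite ltr_wpDl.
pose d := Num.min d1 (Num.min 1 (e / (L + 1))).
have d0 : 0 < d by rewrite !lt_min d10 ltr01 divr_gt0.
have dd1 : d <= d1 by rewrite ge_min lexx.
have dd2 : d <= 1 by rewrite !ge_min lexx orbT.
have dd3 : d <= e / (L + 1) by rewrite !ge_min lexx !orbT.
exists d => // x xr; have [xs|xs] := leP `|x| s.
  apply: le_trans (h1 x xs) _; apply: Ex_le; [exact: continuous_Lker|exact: continuous_Lker|].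
  by move=> y _; exact: Lker_mono.
apply: le_trans _ (Ex_Lker_ge_out S1 d0 xs).
have VE : V x = V `|x|.
  have [x0|x0] := leP 0 x; first by rewrite ger0_norm.
  by rewrite ltr0_norm// Veven.
have := hL (`|x| + d) `|x|; rewrite normr_id ger0_norm; last by rewrite addr_ge0// ltW.
have a1 : `|x| + d <= r + 1 by lra.
have a2 : `|x| <= r + 1 by lra.
rewrite (_ : `|x| + d - `|x| = d); last by ring.
move=> /(_ a1 a2); rewrite (gtr0_norm d0) ler_norml => /andP[_ h].
have : d * (L + 1) <= e by rewrite -ler_pdivlMr.
rewrite VE; nra.
Qed.

End EquilibriumPotential.

(** * Logarithmic energy *)

Section Energy.
Variable R : realType.
Implicit Types (mu nu : probability R R) (r : R) (f : R -> \bar R) (g V : R -> R).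

Lemma measurable_logK d (T : measurableType d) (a b : T -> R) :
  measurable_fun setT a -> measurable_fun setT b ->
  measurable_fun setT (fun t => logK (a t) (b t)).
Proof.
move=> ma mb; rewrite /logK; apply: measurable_fun_ifT.
- exact: measurable_fun_eqr.
- exact: measurable_cst.
- apply/measurable_EFinP.
  apply: (measurableT_comp (f := fun u : R => - ln `|u|)); last exact: measurable_funB.
  apply: measurable_funN; apply: measurableT_comp; first exact: measurable_ln.
  exact: normr_measurable.
Qed.

(** [logK] changes sign, so Tonelli's theorem is applied to its positive and negative parts
    separately. *)
Lemma measurable_logK_int mu :
  measurable_fun setT (fun x => \int[mu]_y logK x y)%E.
Proof.
pose F (p : R * R) := logK p.1 p.2.
have mF : measurable_fun setT F.
  by apply: measurable_logK; [exact: measurable_fst|exact: measurable_snd].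
rewrite (_ : (fun x => _) = fun x => (\int[mu]_y (F^\+ (x, y)) - \int[mu]_y (F^\- (x, y)))%E); last first.
  by apply/funext => x; rewrite [LHS]integralE; congr (_ - _)%E; apply: eq_integral => y _; rewrite ?funeposE ?funenegE.
apply: emeasurable_funB.
  apply: (@measurable_fun_fubini_tonelli_F _ _ R R R mu (F^\+)%E) => //.
  exact: measurable_funepos.
apply: (@measurable_fun_fubini_tonelli_F _ _ R R R mu (F^\-)%E) => //.
exact: measurable_funeneg.
Qed.

Lemma integral_support mu r f : supported_in r mu -> measurable_fun setT f ->
  (\int[mu]_x f x = \int[mu]_(x in `[(- r)%R, r]) f x)%E.
Proof.
move=> mr mf; rewrite [RHS]integral_mkcond; apply: ae_eq_integral => //.
  by apply/(measurable_restrictT _ (measurable_itv `[(- r), r])); exact: measurable_funTS.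
exists (~` `[- r, r]%classic); split => //; first exact: measurableC.
move=> x /= h xI; apply: h => _.
by rewrite patchE mem_set.
Qed.

Definition logE mu r : \bar R :=
  (\int[mu]_(x in `[(- r)%R, r]) \int[mu]_(y in `[(- r)%R, r]) logK x y)%E.

Lemma logE_full mu r : supported_in r mu -> (\int[mu]_x \int[mu]_y logK x y = logE mu r)%E.
Proof.
move=> mr; rewrite (integral_support mr (measurable_logK_int mu)).
apply: eq_integral => x _; apply: integral_support => //.
by apply: measurable_logK; [exact: measurable_cst|exact: measurable_id].
Qed.

Lemma Ex_fine mu r g : continuous g ->
  (\int[mu]_(x in `[(- r)%R, r]) (g x)%:E = (Ex mu r g)%:E)%E.
Proof.
by move=> cg; rewrite /Ex /Rintegral fineK//; apply: integrable_fin_num => //; exact: prob_integrable.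
Qed.

Lemma energy_itv V mu r : continuous V -> supported_in r mu ->
  energy V mu = ((2^-1)%:E * logE mu r + (Ex mu r V)%:E)%E.
Proof.
move=> cV mr; rewrite /energy (logE_full mr); congr (_ + _)%E.
rewrite (integral_support mr) ?Ex_fine//.
by apply/measurable_EFinP; exact: continuous_measurable_fun.
Qed.

Lemma supported_in_le mu s r : s <= r -> supported_in s mu -> supported_in r mu.
Proof.
move=> sr ms; apply: (@subset_measure0 _ _ _ mu (~` `[- r, r]%classic) (~` `[- s, s]%classic)) => //.
- exact: measurableC.
- exact: measurableC.
- by apply: subsetC => x /=; rewrite !in_itv/= => /andP[? ?]; apply/andP; split; lra.
Qed.

Lemma Ex_support mu s r g : s <= r -> supported_in s mu -> continuous g ->
  Ex mu r g = Ex mu s g.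
Proof.
move=> sr ms cg.
have mg : measurable_fun setT (EFin \o g).
  by apply/measurable_EFinP; exact: continuous_measurable_fun.
by rewrite /Ex /Rintegral -(integral_support ms mg) -(integral_support (supported_in_le sr ms) mg).
Qed.

(** Comparing positive and negative parts separately avoids integrability, which fails for [logK]
    under a measure of infinite energy. *)
Lemma le_integral_meas mu (D : set R) (f1 f2 : R -> \bar R) : measurable D ->
  measurable_fun D f1 -> measurable_fun D f2 ->
  (forall x, D x -> f1 x <= f2 x)%E ->
  (\int[mu]_(x in D) f1 x <= \int[mu]_(x in D) f2 x)%E.
Proof.
move=> mD m1 m2 h; rewrite integralE [leRHS]integralE; apply: leeB.
- apply: ge0_le_integral => //.
  + exact: measurable_funepos.
  + exact: measurable_funepos.
  + by move=> x Dx; apply: (@funepos_le _ _ D) => //; [move=> y /set_mem; exact: h|rewrite inE].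
- apply: ge0_le_integral => //.
  + exact: measurable_funeneg.
  + exact: measurable_funeneg.
  + by move=> x Dx; apply: (@funeneg_le _ _ D) => //; [move=> y /set_mem; exact: h|rewrite inE].
Qed.

Lemma Ex_le_integral mu r g f : continuous g -> measurable_fun `[(- r), r] f ->
  (forall x, `|x| <= r -> ((g x)%:E <= f x)%E) ->
  ((Ex mu r g)%:E <= \int[mu]_(x in `[(- r)%R, r]) f x)%E.
Proof.
move=> cg mf h; rewrite -Ex_fine//; apply: le_integral_meas => //.
  by apply/measurable_EFinP; apply: measurable_funTS; exact: continuous_measurable_fun.
by move=> x; rewrite /= in_itv/= -ler_norml; exact: h.
Qed.

Lemma integral_le_Ex mu r g f : continuous g -> measurable_fun `[(- r), r] f ->
  (forall x, `|x| <= r -> (f x <= (g x)%:E)%E) ->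
  (\int[mu]_(x in `[(- r)%R, r]) f x <= (Ex mu r g)%:E)%E.
Proof.
move=> cg mf h; rewrite -Ex_fine//; apply: le_integral_meas => //.
  by apply/measurable_EFinP; apply: measurable_funTS; exact: continuous_measurable_fun.
by move=> x; rewrite /= in_itv/= -ler_norml; exact: h.
Qed.

Lemma measurable_logK_itv x r : measurable_fun `[(- r), r]%classic (fun y : R => logK x y).
Proof.
apply: measurable_funTS.
by apply: measurable_logK; [exact: measurable_cst|exact: measurable_id].
Qed.

Lemma measurable_logK_int_itv mu r : supported_in r mu ->
  measurable_fun `[(- r), r] (fun x => \int[mu]_(y in `[(- r)%R, r]) logK x y)%E.
Proof.
move=> mr; apply: measurable_funTS.
rewrite (_ : (fun x => _) = fun x => \int[mu]_y logK x y)%E; first exact: measurable_logK_int.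
apply/funext => x; rewrite (integral_support mr)//.
by apply: measurable_logK; [exact: measurable_cst|exact: measurable_id].
Qed.

Definition moment mu r n : R := Ex mu r (fun x => chebT n (x / r)).

Lemma Ex_kN_moment mu r q N x : supported_in r mu ->
  Ex mu r (kN r q N x) =
  ln (2 / r) + \sum_(1 <= n < N.+2) 2 * q ^+ n / n%:R * chebT n (x / r) * moment mu r n.
Proof.
move=> mr.
have cn n : continuous (fun y : R => 2 * q ^+ n / n%:R * chebT n (x / r) * chebT n (y / r)).
  by apply: continuousM2; [exact: continuous_cst|exact: continuous_chebTr].
rewrite /kN ExD; [|exact: continuous_cst|exact: continuous_sum].
rewrite Ex_cst// Ex_sum//; congr (_ + _).
by apply: eq_bigr => n _; rewrite ExZ//; exact: continuous_chebTr.
Qed.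

Lemma continuous_Ex_kN mu r q N : supported_in r mu ->
  continuous (fun x => Ex mu r (kN r q N x)).
Proof.
move=> mr; rewrite (_ : (fun x => _) = fun x =>
  ln (2 / r) + \sum_(1 <= n < N.+2) 2 * q ^+ n / n%:R * chebT n (x / r) * moment mu r n).
  apply: continuousD2; first exact: continuous_cst.
  apply: continuous_sum => n; apply: continuousM2; last exact: continuous_cst.
  by apply: continuousM2; [exact: continuous_cst|exact: continuous_chebTr].
by apply/funext => x; rewrite Ex_kN_moment.
Qed.

Lemma Ex_Ex_kN mu nu r q N : supported_in r mu -> supported_in r nu ->
  Ex nu r (fun x => Ex mu r (kN r q N x)) =
  ln (2 / r) + \sum_(1 <= n < N.+2) 2 * q ^+ n / n%:R * moment nu r n * moment mu r n.
Proof.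
move=> mr nr.
have cn n : continuous (fun x : R => 2 * q ^+ n / n%:R * moment mu r n * chebT n (x / r)).
  by apply: continuousM2; [exact: continuous_cst|exact: continuous_chebTr].
rewrite (@Ex_eq _ nu r _ (fun x => ln (2 / r) + \sum_(1 <= n < N.+2) 2 * q ^+ n / n%:R * moment mu r n * chebT n (x / r))).
  rewrite ExD; [|exact: continuous_cst|exact: continuous_sum].
  rewrite Ex_cst// Ex_sum//; congr (_ + _).
  apply: eq_bigr => n _; rewrite ExZ; last exact: continuous_chebTr.
  by rewrite -/(moment nu r n); ring.
by move=> x _; rewrite Ex_kN_moment//; congr (_ + _); apply: eq_bigr => n _; ring.
Qed.

(** The kernel is bounded below by a finite sum whose double integral is a weighted sum of squared
    moments; the bound makes sense also for infinite energy. *)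
Lemma logE_ge mu r q N : 0 < r -> 0 < q < 1 -> supported_in r mu ->
  ((ln q - 4 * q ^+ N / (1 - q) ^+ 2 + ln (2 / r) +
    \sum_(1 <= n < N.+2) 2 * q ^+ n / n%:R * moment mu r n ^+ 2)%:E <= logE mu r)%E.
Proof.
move=> r0 q01 mr; have [q0 q1] := andP q01.
set K := ln q - 4 * q ^+ N / (1 - q) ^+ 2.
have d0 : 0 < r * (1 - q) ^+ 2 / 2 by rewrite divr_gt0// mulr_gt0// exprn_gt0// subr_gt0.
have -> : K + ln (2 / r) + \sum_(1 <= n < N.+2) 2 * q ^+ n / n%:R * moment mu r n ^+ 2 =
  Ex mu r (fun x => Ex mu r (kN r q N x) + K).
  rewrite ExD; [|exact: continuous_Ex_kN|exact: continuous_cst].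
  rewrite Ex_cst// Ex_Ex_kN// -[LHS]addrA [LHS]addrC; congr (_ + _ + _).
  by apply: eq_bigr => n _; rewrite expr2 mulrA.
apply: Ex_le_integral; [|exact: measurable_logK_int_itv|].
  by apply: continuousD2; [exact: continuous_Ex_kN|exact: continuous_cst].
move=> x xr; rewrite -(Ex_cst K mr) -ExD; [|exact: continuous_kN|exact: continuous_cst].
apply: Ex_le_integral; [|exact: measurable_logK_itv|].
  by apply: continuousD2; [exact: continuous_kN|exact: continuous_cst].
move=> y yr; apply: le_trans _ (Lker_logK x y d0).
by rewrite lee_fin; have := kN_le_Lker N r0 q01 xr yr; rewrite /K; lra.
Qed.

End Energy.

(** * Minimality and uniqueness *)

Section Minimiser.
Variables (R : realType) (V W W2 W3 : R -> R).
Hypothesis pot : potential V W W2 W3.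
Hypothesis Veven : forall x, V (- x) = V x.
Variables (s : R) (rho : probability R R).
Hypothesis s0 : 0 < s.
Hypothesis rhos : supported_in s rho.
Hypothesis rho_moments : forall n, (0 < n)%N ->
  Ex rho s (fun x => chebT n (x / s)) = - fsin (Gsin W s) n / 2.

Let dV := pot_V pot.
Let cV : continuous V := is_derive_cont dV.
Local Notation Ceq := (Ceq V s).

(** The bounds on [Lker] lie below the true kernel, the wrong side for an upper estimate. Monotone
    convergence along d = 1 / (k + 1) recovers the kernel itself. *)
Lemma logK_potential_le x : `|x| <= s ->
  (\int[rho]_(y in `[(- s)%R, s]) logK x y <= (Ceq - V x)%:E)%E.
Proof.
move=> xs.
(* On [-s, s] with d <= 1 the argument (x - y)^2 + d^2 is at most 4 s^2 + 1, so adding B makes all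
   the integrands nonnegative. *)
pose B := 2^-1 * ln (4 * s ^+ 2 + 1).
pose dk k : R := k.+1%:R^-1.
have dk0 k : 0 < dk k by rewrite invr_gt0.
have dk1 k : dk k <= 1 by rewrite invf_le1 ?ler1n.
pose gk k y := (Lker (dk k) x y + B)%:E.
have xyB y : `|y| <= s -> (x - y) ^+ 2 <= 4 * s ^+ 2.
  move=> ys; have : `|x - y| <= 2 * s by apply: le_trans (ler_normB _ _) _; lra.
  rewrite -(real_normK (num_real (x - y))) => h.
  by rewrite (_ : 4 * s ^+ 2 = (2 * s) ^+ 2); [rewrite lerXn2r// nnegrE mulr_ge0// ltW|ring].
have gk0 k y : `[(- s), s]%classic y -> (0 <= gk k y)%E.
  rewrite /= in_itv/= -ler_norml => ys; rewrite lee_fin /Lker /B mulNr addrC -mulrBr.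
  rewrite mulr_ge0// subr_ge0 ler_ln ?posrE ?Lker_arg_gt0//.
    by rewrite lerD ?xyB// expr_le1// ltW.
  by rewrite ltr_wpDl// mulr_ge0// sqr_ge0.
have mgk k : measurable_fun `[(- s), s]%classic (gk k).
  apply/measurable_EFinP; apply: measurable_funTS; apply: continuous_measurable_fun.
  by apply: continuousD2; [exact: continuous_Lker|exact: continuous_cst].
have ndgk y : `[(- s), s]%classic y -> {homo gk^~ y : n m / (n <= m)%N >-> (n <= m)%E}.
  move=> _ n m nm; rewrite lee_fin lerD2r; apply: Lker_mono => //.
  by rewrite lef_pV2 ?posrE// ler_nat.
have cvdk : dk k @[k --> \oo] --> (0 : R).
  apply/cvgrPdist_le => e e0; have [K K0 hK] := exists_inv_le (ler01 : 0 <= 1 :> R) e0.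
  exists K => // k /= Kk; rewrite sub0r normrN gtr0_norm//.
  apply: le_trans hK; rewrite mul1r lef_pV2 ?posrE ?ltr0n//.
  by rewrite ler_nat ltnW.
(* On the diagonal [Lker (dk k)] is ln(k + 1), which tends to the value +oo of [logK]. *)
have limgk y : limn (gk^~ y) = (logK x y + B%:E)%E.
  apply/cvg_lim => //; rewrite /logK; case: eqVneq => [<-|xy].
    rewrite addye//; apply/cvgeyPge => A.
    have [K _ hK] : exists2 K : nat, (0 < K)%N & expR (A - B) <= K%:R.
      by exists (Num.truncn (expR (A - B))).+1 => //; apply: ltW; exact: truncnS_gt.
    exists K => // k /= Kk; rewrite lee_fin -lerBlDr /Lker subrr expr0n/= add0r.
    rewrite lnXn// mulr2n /dk lnV ?posrE//.
    have -> : - 2^-1 * (- ln k.+1%:R + - ln k.+1%:R) = ln k.+1%:R :> R by field.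
    rewrite -[leLHS]expRK ler_ln ?posrE ?expR_gt0//.
    by apply: le_trans hK _; rewrite ler_nat ltnW.
  have xy0 : 0 < `|x - y| by rewrite normr_gt0 subr_eq0.
  rewrite -EFinD; apply/cvg_EFin; first by apply: nearW.
  rewrite (_ : fine \o _ = fun k => Lker (dk k) x y + B)//.
  apply: cvgD; last exact: cvg_cst.
  have -> : - ln `|x - y| = - 2^-1 * ln ((x - y) ^+ 2 + 0 ^+ 2).
    by rewrite expr0n/= addr0 -(real_normK (num_real (x - y))) lnXn// mulr2n; field.
  apply: cvgM; first exact: cvg_cst.
  apply: (cvg_comp _ (@ln R)); last first.
    by apply: continuous_ln; rewrite expr0n/= addr0 -(real_normK (num_real (x - y))) exprn_gt0.
  apply: cvgD; first exact: cvg_cst.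
  by rewrite !expr2; apply: cvgM.
have h := monotone_convergence rho (measurable_itv `[(- s), s]) mgk gk0 ndgk.
have hle : (\int[rho]_(y in `[(- s)%R, s]) (logK x y + B%:E) <= (Ceq - V x + B)%:E)%E.
  rewrite (_ : (fun y => _) = fun y => limn (gk^~ y)); last first.
    by apply/funext => y; rewrite limgk.
  rewrite h; apply: lime_le.
    apply: ereal_nondecreasing_is_cvgn => n m nm.
    apply: ge0_le_integral => //; first exact: gk0.
    by move=> y ys; exact: ndgk.
  apply: nearW => k; rewrite /gk Ex_fine; last first.
    by apply: continuousD2; [exact: continuous_Lker|exact: continuous_cst].
  rewrite ExD; [|exact: continuous_Lker|exact: continuous_cst].
  by rewrite Ex_cst// lee_fin lerD2r; exact: (Ex_Lker_le pot).
have mlog : measurable_fun `[(- s), s]%classic (fun y : R => logK x y) by exact: measurable_logK_itv.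
have logB0 y : `[(- s), s]%classic y -> (0 <= logK x y + B%:E)%E.
  by move=> ys; rewrite -limgk; apply: lime_ge; [exact: ereal_nondecreasing_is_cvgn (ndgk y ys)|apply: nearW => k; exact: gk0].
have intB : rho.-integrable `[(- s), s] (fun y => logK x y + B%:E)%E.
  apply/integrableP; split.
    by apply: emeasurable_funD => //; exact: measurable_cst.
  rewrite (eq_integral (fun y => logK x y + B%:E)%E).
    by apply: le_lt_trans hle _; rewrite ltry.
  by move=> y; rewrite inE => ys; rewrite gee0_abs// logB0.
have intC : rho.-integrable `[(- s), s] (cst B%:E).
  exact: (@prob_integrable _ rho _ s (@cst_continuous R R B)).
rewrite (eq_integral (fun y => (logK x y + B%:E) - B%:E)%E); last first.
  by move=> y _; rewrite addeK.
rewrite (integralB _ intB intC)//.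
rewrite (Ex_fine rho s (@continuous_cst R B)) Ex_cst//.
by rewrite leeBlDr// -EFinD.
Qed.

Lemma logE_rho_le : (logE rho s <= (Ceq - Ex rho s V)%:E)%E.
Proof.
have -> : Ceq - Ex rho s V = Ex rho s (fun x => Ceq - V x).
  by rewrite ExB//; [rewrite Ex_cst|exact: continuous_cst].
apply: integral_le_Ex.
- by apply: continuousB2 => //; exact: continuous_cst.
- exact: measurable_logK_int_itv.
- by move=> x xs; exact: logK_potential_le.
Qed.

(* Cauchy-Schwarz for the positive definite log kernel, with its defect kept: the square
   of the moments of nu is expanded around those of rho. *)
Lemma logE_cross_ge r nu N e : s <= r -> s = r \/ Smean W s = 1 -> supported_in r nu -> 0 < e ->
  ((2 * (Ceq - Ex nu r V) - (Ceq - Ex rho s V) +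
    \sum_(1 <= n < N.+2) 2 / n%:R * (moment nu r n - moment rho r n) ^+ 2 - e)%:E <= logE nu r)%E.
Proof.
move=> sr hs nr e0.
have r0 : 0 < r by exact: lt_le_trans sr.
have rr := supported_in_le sr rhos.
pose I0 := Ceq - Ex rho s V; rewrite -/I0.
pose S := \sum_(1 <= n < N.+2) 2 / n%:R * (moment nu r n - moment rho r n) ^+ 2; rewrite -/S.
have S0 : 0 <= S by apply: sumr_ge0 => n _; rewrite mulr_ge0// ?sqr_ge0// divr_ge0.
have e8 : 0 < e / 16 by rewrite divr_gt0.
have [d d0 hd] := Ex_Lker_ge pot Veven s0 rhos rho_moments sr hs e8.
have /cvgrPdist_le /(_ _ e8) [d2 /= d20 h2] : ln x @[x --> (1 : R)] --> ln (1 : R).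
  exact: continuous_ln.
(* Replacing q^n by 1 in S costs at most (N + 2) (1 - q) S, since 1 - q^n <= n (1 - q). *)
pose K : R := N.+2%:R * S + 1.
have K0 : 0 < K by rewrite ltr_wpDl// mulr_ge0.
have r2 : 0 < 2 * r by rewrite mulr_gt0.
(* Order of choices: d from e, then q from d and e, and last the truncation M from q. *)
pose q := 1 - Num.min (1 / 2) (Num.min (d / (2 * r)) (Num.min (d2 / 2) (e / 16 / K))).
have q3 : 0 < 1 - q by rewrite /q opprB addrC subrK !lt_min !divr_gt0.
have q4 : 1 - q <= 1 / 2 by rewrite /q opprB addrC subrK ge_min lexx.
have q1 : 1 - q <= d / (2 * r) by rewrite /q opprB addrC subrK !ge_min lexx orbT.
have q2 : 1 - q <= d2 / 2 by rewrite /q opprB addrC subrK !ge_min lexx !orbT.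
have q5 : 1 - q <= e / 16 / K by rewrite /q opprB addrC subrK !ge_min lexx !orbT.
have q01 : 0 < q < 1 by apply/andP; split; lra.
have [q0 q1'] := andP q01.
have q01' : 0 <= q < 1 by have /andP[/ltW -> ->] := q01.
have A0 : 0 <= 4 / (1 - q) ^+ 2 by rewrite divr_ge0// sqr_ge0.
have [N1 hN1] := geo_small q01' A0 e8.
pose M := maxn N N1.
have hM := hN1 M (leq_maxr _ _); rewrite mulrAC in hM.
have lnq : - (e / 16) <= ln q.
  have : `|ln 1 - ln q| <= e / 16 by apply: h2; rewrite /= gtr0_norm//; lra.
  by rewrite ln1 sub0r normrN ler_norml => /andP[].
have cross : Ceq - Ex nu r V - e / 16 - e / 16 <=
   ln (2 / r) + \sum_(1 <= n < M.+2) 2 * q ^+ n / n%:R * moment nu r n * moment rho r n.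
  rewrite -Ex_Ex_kN//.
  have -> : Ceq - Ex nu r V - e / 16 - e / 16 = Ex nu r (fun x => (Ceq - e / 16 - e / 16) - V x).
    by rewrite ExB; [rewrite Ex_cst//; ring|exact: continuous_cst|].
  apply: Ex_le; [|exact: continuous_Ex_kN|].
    by apply: continuousB2 => //; exact: continuous_cst.
  move=> x xr.
  have h1 := hd x xr.
  have h3 : Ex rho r (Lker d x) <= Ex rho r (fun y => kN r q M x y + e / 16).
    apply: Ex_le; [exact: continuous_Lker| |].
      by apply: continuousD2; [exact: continuous_kN|exact: continuous_cst].
    move=> y yr; apply: (@le_trans _ _ (Lker (2 * r * (1 - q)) x y)).
      apply: Lker_mono; first by rewrite mulr_gt0.
      by rewrite mulrC -ler_pdivlMr.
    by apply: le_trans (Lker_le_kN M r0 q01 xr yr) _; rewrite lerD2l.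
  move: h3; rewrite ExD; [|exact: continuous_kN|exact: continuous_cst].
  rewrite Ex_cst// (Ex_support sr rhos); last exact: continuous_Lker.
  lra.
have rhoI : ln q - 4 * q ^+ M / (1 - q) ^+ 2 + ln (2 / r) +
    \sum_(1 <= n < M.+2) 2 * q ^+ n / n%:R * moment rho r n ^+ 2 <= I0.
  rewrite -lee_fin; apply: le_trans (logE_ge M r0 q01 rr) _.
  by rewrite -logE_full// (logE_full rhos); exact: logE_rho_le.
apply: le_trans _ (logE_ge M r0 q01 nr); rewrite lee_fin.
have qS : S - e / 16 <= \sum_(1 <= n < M.+2) 2 * q ^+ n / n%:R * (moment nu r n - moment rho r n) ^+ 2.
  rewrite (big_cat_nat (n := N.+2))//=; last by rewrite !ltnS leq_maxl.
  apply: (@le_trans _ _ (\sum_(1 <= n < N.+2) 2 * q ^+ n / n%:R * (moment nu r n - moment rho r n) ^+ 2)); last first.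
    rewrite lerDl; apply: sumr_ge0 => n _; rewrite mulr_ge0// ?sqr_ge0//.
    by rewrite divr_ge0// mulr_ge0// exprn_ge0// ltW.
  apply: (@le_trans _ _ ((1 - N.+2%:R * (1 - q)) * S)).
    have : K * (1 - q) <= e / 16 by rewrite mulrC -ler_pdivlMr.
    by rewrite /K; have := ltW q3; nra.
  rewrite /S mulr_sumr big_nat [leRHS]big_nat; apply: ler_sum => n /andP[n0 nN].
  have -> : 2 * q ^+ n / n%:R * (moment nu r n - moment rho r n) ^+ 2 =
     q ^+ n * (2 / n%:R * (moment nu r n - moment rho r n) ^+ 2) by ring.
  apply: ler_wpM2r; first by rewrite mulr_ge0// ?sqr_ge0// divr_ge0.
  have /andP[_ h] := one_sub_exp n (introT andP (conj (ltW q0) (ltW q1'))).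
  have : n%:R * (1 - q) <= N.+2%:R * (1 - q) by rewrite ler_wpM2r ?(ltW q3)// ler_nat ltnW.
  lra.
have expand : \sum_(1 <= n < M.+2) 2 * q ^+ n / n%:R * (moment nu r n - moment rho r n) ^+ 2 =
  \sum_(1 <= n < M.+2) 2 * q ^+ n / n%:R * moment nu r n ^+ 2
  + \sum_(1 <= n < M.+2) 2 * q ^+ n / n%:R * moment rho r n ^+ 2
  - 2 * \sum_(1 <= n < M.+2) 2 * q ^+ n / n%:R * moment nu r n * moment rho r n.
  rewrite mulr_sumr -big_split/= -sumrB; apply: eq_bigr => n _; ring.
(* The terms ln(2 / r) cancel and nine errors of size e / 16 remain: one from [qS], four from twice
   [cross], four from ln q and the geometric term occurring twice. *)
move: qS cross rhoI hM; rewrite expand.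
set X := \sum_(_ <= _ < _) _; set Y := \sum_(_ <= _ < _) _; set Z := \sum_(_ <= _ < _) _.
lra.
Qed.

Definition Emin : R := 2^-1 * (Ceq + Ex rho s V).

Lemma energy_ge r nu N : s <= r -> s = r \/ Smean W s = 1 -> supported_in r nu ->
  ((Emin + \sum_(1 <= n < N.+2) n%:R^-1 * (moment nu r n - moment rho r n) ^+ 2)%:E <= energy V nu)%E.
Proof.
move=> sr hs nr; rewrite (energy_itv cV nr).
apply/lee_addgt0Pr => e e0.
have e2 : 0 < 2 * e by rewrite mulr_gt0.
have h := logE_cross_ge N sr hs nr e2.
have {}h : (2^-1%:E * (2 * (Ceq - Ex nu r V) - (Ceq - Ex rho s V) +
    \sum_(1 <= n < N.+2) 2 / n%:R * (moment nu r n - moment rho r n) ^+ 2 - 2 * e)%:E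
    <= 2^-1%:E * logE nu r)%E by rewrite lee_pmul2l// lte_fin.
have {}h := leeD2r ((Ex nu r V)%:E + e%:E) h.
rewrite -addeA; apply: le_trans _ h.
rewrite -EFinM -!EFinD lee_fin.
have -> : \sum_(1 <= n < N.+2) n%:R^-1 * (moment nu r n - moment rho r n) ^+ 2 =
  2^-1 * \sum_(1 <= n < N.+2) 2 / n%:R * (moment nu r n - moment rho r n) ^+ 2.
  by rewrite mulr_sumr; apply: eq_bigr => n _; rewrite !mulrA mulVf// mul1r.
rewrite /Emin; lra.
Qed.

Lemma energy_rho : energy V rho = Emin%:E.
Proof.
apply/eqP; rewrite eq_le; apply/andP; split; last first.
  have := @energy_ge s rho 0 (lexx s) (or_introl erefl) rhos.
  by rewrite big_nat1 subrr expr0n/= mulr0 addr0.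
rewrite (energy_itv cV rhos).
have h : (2^-1%:E * logE rho s <= 2^-1%:E * (Ceq - Ex rho s V)%:E)%E.
  by rewrite lee_pmul2l ?logE_rho_le// lte_fin.
apply: le_trans (leeD2r _ h) _; rewrite -EFinM -EFinD lee_fin /Emin; lra.
Qed.

Lemma energy_inf r : s <= r -> s = r \/ Smean W s = 1 ->
  ereal_inf [set energy V nu | nu in [set nu | supported_in r nu]] = Emin%:E.
Proof.
move=> sr hs; apply/eqP; rewrite eq_le; apply/andP; split.
  by apply: ge_ereal_inf; exists (Emin%:E) => //; exists rho; [exact: supported_in_le rhos|exact: energy_rho].
apply: le_ereal_inf_tmp => _ [nu /= nr <-].
apply: le_trans (energy_ge 0 sr hs nr); rewrite lee_fin lerDl sumr_ge0// => n _.
by rewrite mulr_ge0// ?sqr_ge0// invr_ge0.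
Qed.

Lemma rho_minimiser r : s <= r -> s = r \/ Smean W s = 1 -> constrained_minimiser V r rho.
Proof.
move=> sr hs; split; first exact: supported_in_le rhos.
by rewrite energy_inf// energy_rho.
Qed.

(** A minimiser leaves no room for the defect in [energy_ge], so each of its moments agrees with
    that of rho. *)
Lemma minimiser_unique r mu : s <= r -> s = r \/ Smean W s = 1 ->
  constrained_minimiser V r mu -> forall A, measurable A -> mu A = rho A.
Proof.
move=> sr hs [mr]; rewrite energy_inf// => mE.
have r0 : 0 < r by exact: lt_le_trans sr.
have rr := supported_in_le sr rhos.
apply: (moments_unique r0 mr rr) => -[|n].
  rewrite !(@Ex_eq _ _ r _ (fun=> 1)) ?Ex_cst//.
have := energy_ge n sr hs mr; rewrite mE lee_fin gerDl => h.
have t0 k : 0 <= k%:R^-1 * (moment mu r k - moment rho r k) ^+ 2.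
  by rewrite mulr_ge0// ?sqr_ge0// invr_ge0.
move: h; rewrite big_nat_recr//= => h.
have h1 : n.+1%:R^-1 * (moment mu r n.+1 - moment rho r n.+1) ^+ 2 <= 0.
  apply: le_trans h; rewrite lerDr; exact: sumr_ge0.
have : (moment mu r n.+1 - moment rho r n.+1) ^+ 2 <= 0.
  by rewrite -(@pmulr_rle0 _ n.+1%:R^-1)// invr_gt0.
rewrite le_eqVlt ltNge sqr_ge0 orbF sqrf_eq0 subr_eq0 => /eqP.
by rewrite /moment.
Qed.

End Minimiser.

(** * The equilibrium density *)

Definition clamp (R : realType) (s x : R) : R := (`|x + s| - `|x - s|) / 2.

Section Clamp.
Variable R : realType.
Implicit Types s x : R.

Lemma clamp_norm s x : 0 < s -> `|clamp s x| <= s.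
Proof.
move=> s0; rewrite /clamp ler_norml.
case: (ger0P (x + s)) => ?; case: (ger0P (x - s)) => ?; apply/andP; split; lra.
Qed.

Lemma clamp_id s x : `|x| <= s -> clamp s x = x.
Proof.
rewrite ler_norml /clamp => /andP[h1 h2].
by rewrite ger0_norm ?ler0_norm; [field|lra|lra].
Qed.

Lemma continuous_clamp s : continuous (clamp s).
Proof.
have cn (k : R) : continuous (fun x : R => `|x + k|).
  move=> x; apply: (cvg_comp (fun x => x + k) (@Num.norm R R)); last exact: norm_continuous.
  by apply: cvgD; [exact: cvg_id|exact: cvg_cst].
by apply: continuousM2; [apply: continuousB2|exact: continuous_cst].
Qed.

End Clamp.

Section Density.
Variables (R : realType) (V W W2 W3 : R -> R).
Hypothesis pot : potential V W W2 W3.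
Hypothesis Veven : forall x, V (- x) = V x.
Implicit Types r s x : R.

Let cV : continuous V := is_derive_cont (pot_V pot).
Local Notation h r := (fsin (Gsin W r)).

Lemma P_partialE r x N :
  P_partial V r x N = \sum_(1 <= n < N) h r n * chebT n (x / r).
Proof.
rewrite /P_partial big_nat [RHS]big_nat; apply: eq_bigr => n /andP[n0 _].
by rewrite cheb_coefE// -(fcos_fsin pot).
Qed.

Lemma S_partialE r N : S_partial V r N = \sum_(1 <= n < N) h r n * cos (n%:R * 0).
Proof.
rewrite /S_partial big_nat [RHS]big_nat; apply: eq_bigr => n /andP[n0 _].
by rewrite cheb_coefE// -(fcos_fsin pot)// mulr0 cos0 mulr1.
Qed.

Lemma chebT_div_norm r x n : 0 < r -> `|x| <= r -> `|chebT n (x / r)| <= 1.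
Proof. by move=> r0 xr; rewrite chebT_acos// cos_max. Qed.

Lemma P_partial_cvg r x : 0 < r -> `|x| <= r -> cvgn (P_partial V r x).
Proof.
move=> r0 xr; have [M M0 hM] := Gsin_decay pot r.
rewrite (_ : P_partial V r x = fun N => \sum_(1 <= n < N) h r n * chebT n (x / r)).
  by apply: (quad_decay_cvg (hM r r0 (lexx r)) M0) => n; exact: chebT_div_norm.
by apply/funext => N; exact: P_partialE.
Qed.

Lemma S_partial_cvg r : 0 < r -> S_partial V r @ \oo --> Smean W r.
Proof.
move=> r0; have [M M0 hM] := Gsin_decay pot r.
have cv : cvgn (S_partial V r).
  rewrite (_ : S_partial V r = fun N => \sum_(1 <= n < N) h r n * cos (n%:R * 0)).
    by apply: (quad_decay_cvg (hM r r0 (lexx r)) M0) => n; exact: cos_max.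
  by apply/funext => N; exact: S_partialE.
rewrite -(Smean_lim (l := limn (S_partial V r)) pot r0)//.
by rewrite (_ : (fun N => _) = S_partial V r)//; apply/funext => N; rewrite S_partialE.
Qed.

Lemma crit_eqE r : 0 < r -> crit_eq V r <-> Smean W r = 1.
Proof.
move=> r0; have Sr := S_partial_cvg r0.
have lS : limn (S_partial V r) = Smean W r by exact: cvg_lim Sr.
rewrite /crit_eq lS; split => [[]//|S1]; split=> //.
Qed.

Lemma P_R_opp r x : P_R V r (- x) = P_R V r x.
Proof.
suff e : P_partial V r (- x) = P_partial V r x by rewrite /P_R e.
apply/funext => N; rewrite !P_partialE.
rewrite big_nat [RHS]big_nat; apply: eq_bigr => n /andP[n0 _].
rewrite mulNr chebT_opp mulrA; congr (_ * _).
by rewrite -(fcos_fsin pot)// -mulrA [X in _ * X]mulrC (fcos_parity pot Veven).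
Qed.

(** For x >= 0 the angle acos(x / r) has nonnegative cosine, as [Smean_decrease] requires; negative
    x follow by parity. *)
Lemma P_R_ge0 r x : 0 < r -> Smean W r <= 1 -> `|x| <= r -> 0 <= P_R V r x.
Proof.
move=> r0 S1; wlog x0 : x / 0 <= x => [hw|xr].
  by have [/hw//|x0 xr] := leP 0 x; rewrite -P_R_opp hw ?normrN// oppr_ge0 ltW.
rewrite subr_ge0; apply: le_trans S1; apply: (@Smean_decrease _ _ _ _ _ pot r _ _ (acos (x / r))) => //.
- rewrite acosK ?divr_ge0 ?(ltW r0)//.
  by rewrite in_itv/= -ler_norml normrM normfV (gtr0_norm r0) ler_pdivrMr// mul1r.
- rewrite (_ : (fun N => _) = S_partial V r); first exact: S_partial_cvg.
  by apply/funext => N; rewrite S_partialE.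
- rewrite (_ : (fun N => _) = P_partial V r x); first exact: P_partial_cvg.
  by apply/funext => N; rewrite P_partialE; apply: eq_bigr => n _; rewrite chebT_acos.
Qed.

Lemma P_R_left_cvg r0 x : `|x| < r0 -> P_R V r x @[r --> r0^'-] --> P_R V r0 x.
Proof.
move=> xr0; have r00 : 0 < r0 by apply: le_lt_trans xr0.
apply: cvgB; first exact: cvg_cst.
apply/cvgrPdist_le => e e0.
(* Only for r >= |x| are the values T_n(x / r) bounded by 1. *)
pose D r := `|x| < r <= r0.
have Dr r : D r -> 0 < r <= r0 by move=> /andP[h1 ->]; rewrite (le_lt_trans _ h1).
have [||||d d0 hd] := @series_continuous _ _ _ _ _ pot D r0 (fun n r => chebT n (x / r))
    (fun r => limn (P_partial V r x)) r0 e Dr _ _ _ _ e0.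
- by rewrite /D xr0 lexx.
- move=> r n rD; have /andP[rp _] := Dr _ rD; apply: chebT_div_norm => //.
  by move: rD => /andP[/ltW].
- move=> n; apply: (cvg_comp (fun r => x / r) (chebT n)); last exact: continuous_chebT.
  by apply: cvgM; [exact: cvg_cst|apply: cvgV; [rewrite gt_eqF|exact: cvg_id]].
- move=> r rD; have /andP[rp _] := Dr _ rD.
  rewrite (_ : (fun N => _) = P_partial V r x).
    by apply: P_partial_cvg => //; move: rD => /andP[/ltW].
  by apply/funext => N; rewrite P_partialE.
near=> r; apply: hd.
  rewrite /D; apply/andP; split; last by apply: ltW; near: r; exact: nbhs_left_lt.
  by near: r; exact: nbhs_left_gt.
have rr0 : r < r0 by near: r; exact: nbhs_left_lt.
rewrite gtr0_norm ?subr_gt0// ltrBlDl -ltrBlDr.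
by near: r; apply: nbhs_left_gt; rewrite gtrBl.
Unshelve. all: by end_near.
Qed.

Lemma Q_cvg r0 x : `|x| < r0 ->
  (fun r => P_R V r x / (r ^+ 2 - x ^+ 2)) @ r0^'- --> P_R V r0 x / (r0 ^+ 2 - x ^+ 2).
Proof.
move=> xr0; apply: cvgM; first exact: P_R_left_cvg.
apply: cvgV; first by rewrite gt_eqF// subr_gt0 -(real_normK (num_real x)) ltrXn2r// ?nnegrE ?(ltW (le_lt_trans _ xr0)).
apply: cvgB; last exact: cvg_cst.
by apply: cvg_at_left_filter; rewrite expr2; under eq_fun do rewrite expr2; apply: cvgM; exact: cvg_id.
Qed.

(* Extends the density numerator continuously to the whole line: the Chebyshev series
   defining [P_R V s x] is only controlled for |x| <= s. *)
Definition Pclamp s x : R := P_R V s (clamp s x).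

Lemma Pclamp_approx s : 0 < s -> exists2 M, 0 <= M & forall K x, (0 < K)%N ->
  `|Pclamp s x - (1 - \sum_(1 <= n < K.+1) h s n * chebT n (clamp s x / s))| <= M / K%:R.
Proof.
move=> s0; have [M M0 hM] := Gsin_decay pot s; exists M => // K x K0.
have sub1 (a b : R) : - (1 - a - (1 - b)) = a - b by ring.
rewrite /Pclamp /P_R -normrN sub1.
apply: (quad_decay_lim (hM s s0 (lexx s)) M0 _ _ K0).
  by move=> n; apply: chebT_div_norm => //; exact: clamp_norm.
rewrite (_ : (fun N => _) = P_partial V s (clamp s x)).
  by apply: P_partial_cvg => //; exact: clamp_norm.
by apply/funext => N; rewrite P_partialE.
Qed.

Lemma continuous_Pclamp s : 0 < s -> continuous (Pclamp s).
Proof.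
move=> s0 x0; have [M M0 hM] := Pclamp_approx s0.
apply/cvgrPdist_le => e e0; have e3 : 0 < e / 3 by rewrite divr_gt0.
have [K K0 hK] := exists_inv_le M0 e3.
pose F x := 1 - \sum_(1 <= n < K.+1) h s n * chebT n (clamp s x / s).
have cF : continuous F.
  apply: continuousB2; first exact: continuous_cst.
  apply: continuous_sum => n; apply: continuousM2; first exact: continuous_cst.
  by apply: (@continuous_comp2 _ (fun x => chebT n (x / s))); [exact: continuous_chebTr|exact: continuous_clamp].
have /cvgrPdist_le /(_ _ e3) := cF x0.
apply: filterS => x hx.
have h1 := hM K x0 K0; have h2 := hM K x K0; rewrite -/(F x0) -/(F x) in h1 h2.
move: hx h1 h2; rewrite !ler_norml => /andP[? ?] /andP[? ?] /andP[? ?].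
by apply/andP; split; lra.
Qed.

(** Orthogonality of the cosines, applied to finite sums that approximate [Pclamp] uniformly. The
    case n = 0 is the total mass of the density. *)
Lemma Av_Pclamp_cosn s n : 0 < s ->
  Av (fun t => cos (n%:R * t) * Pclamp s (s * cos t)) =
  if n == 0%N then 1 else - h s n / 2.
Proof.
move=> s0; have [M M0 hM] := Pclamp_approx s0.
have cs (t : R) m : chebT m (clamp s (s * cos t) / s) = cos (m%:R * t).
  rewrite clamp_id; last by rewrite normrM (gtr0_norm s0) ger_pMr// cos_max.
  by rewrite mulrAC divff ?gt_eqF// mul1r chebT_cos.
have cP : continuous (fun t : R => cos (n%:R * t) * Pclamp s (s * cos t)).
  apply: continuousM2; first exact: continuous_cosn.
  by apply: (@continuous_comp2 _ (Pclamp s)); [exact: continuous_Pclamp|exact: continuous_rcos].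
set a := if _ then _ else _.
apply/eqP; rewrite -subr_eq0 -normr_le0; apply/ler_addgt0Pr => e e0; rewrite add0r.
have [K K0 hK] := exists_inv_le M0 e0.
pose N := maxn n K; have N0 : (0 < N)%N by rewrite leq_max K0 orbT.
have hN : M / N%:R <= e.
  by apply: le_trans hK; rewrite ler_wpM2l// lef_pV2 ?posrE ?ltr0n// ler_nat leq_maxr.
(* Since N >= n, the truncated sum already contains the only term that pairs with cos(n t). *)
have cSum : continuous (fun t : R => \sum_(1 <= m < N.+1) h s m * (cos (m%:R * t) * cos (n%:R * t))).
  apply: continuous_sum => m; apply: continuousM2; first exact: continuous_cst.
  by apply: continuousM2; exact: continuous_cosn.
have -> : a = Av (fun t => cos (n%:R * t) - \sum_(1 <= m < N.+1) h s m * (cos (m%:R * t) * cos (n%:R * t))).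
  rewrite AvB//; last exact: continuous_cosn.
  rewrite Av_sum; last first.
    move=> m; apply: continuousM2; first exact: continuous_cst.
    by apply: continuousM2; exact: continuous_cosn.
  rewrite /a; case: eqP => [->|/eqP]; last rewrite -lt0n => n0.
    rewrite big_nat big1 ?subr0 => [|m /andP[m0 _]].
      by rewrite (Av_eq (g := fun=> 1)) ?Av_cst// => t; rewrite mul0r cos0.
    rewrite AvZ; last by apply: continuousM2; exact: continuous_cosn.
    rewrite (Av_eq (g := fun t => cos (m%:R * t))) ?Av_cosn ?mulr0//.
    by move=> t; rewrite mul0r cos0 mulr1.
  rewrite Av_cosn// sub0r mulNr; congr (- _).
  rewrite -(@sum_delta _ (fun m => h s m / 2) 1 n N) ?n0 ?leq_maxl//.
  apply: eq_bigr => m _; rewrite AvZ; last by apply: continuousM2; exact: continuous_cosn.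
  have := fcos_cosn R m n; rewrite /fcos gtn_eqF// eq_sym => h2.
  by rewrite mulrA [_ * h s m]mulrC -mulrA -h2; congr (_ * _); field.
rewrite -AvB//; last by apply: continuousB2 => //; exact: continuous_cosn.
apply: Av_norm; first by apply: continuousB2 => //; apply: continuousB2 => //; exact: continuous_cosn.
move=> t _; apply: le_trans hN; apply: le_trans (hM N (s * cos t) N0).
rewrite [in leRHS](eq_bigr (fun m => h s m * cos (m%:R * t))); last by move=> m _; rewrite cs.
rewrite [in leLHS](eq_bigr (fun m => cos (n%:R * t) * (h s m * cos (m%:R * t)))); last by move=> m _; ring.
rewrite -mulr_sumr -[X in _ - (X - _)]mulr1 -!mulrBr normrM.
by rewrite ler_piMl// cos_max.
Qed.

Definition eqdens s x : R := if `|x| < s then pi^-1 * (P_R V s x / Num.sqrt (s ^+ 2 - x ^+ 2)) else 0.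

Section EquilibriumDensity.
Variable s : R.
Hypotheses (s0 : 0 < s) (P0 : forall x, `|x| <= s -> 0 <= P_R V s x).
Local Notation leb := (@lebesgue_measure R).

Lemma eqdens_ge0 x : 0 <= eqdens s x.
Proof.
rewrite /eqdens; case: ifPn => // xs.
by rewrite mulr_ge0 ?invr_ge0 ?pi_ge0// divr_ge0 ?sqrtr_ge0// P0// ltW.
Qed.

Lemma eqdens_patch (g : R -> R) :
  (fun x => g x * eqdens s x) =
  (fun x => pi^-1 * g x * Pclamp s x / Num.sqrt (s ^+ 2 - x ^+ 2)) \_ `](- s), s[%classic.
Proof.
apply/funext => x; rewrite patchE mem_setE in_itv/= -ltr_norml /eqdens.
case: ifPn => xs; last by rewrite mulr0.
by rewrite /Pclamp clamp_id ?ltW// !mulrA; congr (_ * _ / _); rewrite mulrC.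
Qed.

Lemma continuous_PclampM (g : R -> R) : continuous g -> continuous (fun x => pi^-1 * g x * Pclamp s x).
Proof.
move=> cg; apply: continuousM2; last exact: continuous_Pclamp.
by apply: continuousM2 => //; exact: continuous_cst.
Qed.

Lemma measurable_eqdens : measurable_fun setT (eqdens s).
Proof.
rewrite (_ : eqdens s = fun x => 1 * eqdens s x); last by apply/funext => x; rewrite mul1r.
rewrite (eqdens_patch (fun=> 1)).
apply/(measurable_restrictT _ (measurable_itv `](- s), s[)).
by apply: measurable_weight => //; apply: continuous_PclampM; exact: continuous_cst.
Qed.

Lemma integral_eqdens (g : R -> R) (D : set R) : continuous g -> `](- s), s[ `<=` D ->
  (\int[leb]_(x in D) (g x * eqdens s x)%:E =
   (Av (fun t => g (s * cos t) * Pclamp s (s * cos t)))%:E)%E.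
Proof.
move=> cg sD.
pose F x := pi^-1 * g x * Pclamp s x.
have -> : (\int[leb]_(x in D) (g x * eqdens s x)%:E =
  \int[leb]_(x in `](- s)%R, s[) (F x / Num.sqrt (s ^+ 2 - x ^+ 2))%:E)%E.
  rewrite integral_mkcond [RHS]integral_mkcond; congr (integral _ _ _).
  apply/funext => x; rewrite !patchE.
  have /(congr1 (fun f => f x)) /= -> := eqdens_patch g.
  rewrite patchE -/(F x).
  by case: (ifPn (x \in `](- s), s[%classic)) => [/set_mem xs|_]; [rewrite mem_set//; exact: sD|rewrite if_same].
rewrite integral_weight//; last exact: continuous_PclampM.
congr (_%:E); rewrite /F (Av_eq (g := fun t => pi^-1 * (g (s * cos t) * Pclamp s (s * cos t)))).
  rewrite AvZ; last first.
    apply: (@continuous_comp2 _ (fun x => g x * Pclamp s x)); last exact: continuous_rcos.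
    by apply: continuousM2 => //; exact: continuous_Pclamp.
  by rewrite mulrA divff ?mul1r// gt_eqF// pi_gt0.
by move=> t; rewrite mulrA.
Qed.

Lemma integral_eqdens1 : (\int[leb]_x (eqdens s x)%:E = 1)%E.
Proof.
have := @integral_eqdens (fun=> 1) setT (@continuous_cst _ _) (@subsetT _ _).
under eq_integral do rewrite mul1r.
move=> ->; congr (_%:E); rewrite -[RHS](@Av_Pclamp_cosn s 0 s0).
by apply: Av_eq => t; rewrite mul0r cos0.
Qed.

Definition equilibrium : pdensity R := PDensity eqdens_ge0 measurable_eqdens integral_eqdens1.

Lemma equilibrium_support : supported_in s (densP equilibrium).
Proof.
rewrite /supported_in densPE; apply: integral0_eq => x /=; rewrite in_itv/= -ler_norml.
by move=> /negP; rewrite -ltNge => xs; rewrite /eqdens ltNge ltW.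
Qed.

Lemma equilibrium_moments n : (0 < n)%N ->
  Ex (densP equilibrium) s (fun x => chebT n (x / s)) = - h s n / 2.
Proof.
move=> n0; rewrite /Ex /Rintegral integral_densP; last exact: continuous_chebTr.
rewrite integral_eqdens; [|exact: continuous_chebTr|exact: subset_itvW].
have := @Av_Pclamp_cosn s n s0; rewrite gtn_eqF//= => <-.
by apply: Av_eq => t; rewrite mulrAC divff ?gt_eqF// mul1r chebT_cos.
Qed.

End EquilibriumDensity.

End Density.

Theorem theorem1 (R : realType) (V : R -> R)
  (hC3 : C3 V) (hsym : forall x, V (- x) = V x)
  (hconv : strictly_convex V) (hgrowth : growth_gt_log V) :
  exists Rs : R,
    (* R_star is the smallest positive solution of sum_{n>=1} n c_n(R_star) = 1 *)
    [/\ 0 < Rs, crit_eq V Rs & forall r, 0 < r < Rs -> ~ crit_eq V r] /\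
    (* the series defining P_R converges on [-R,R] *)
    (forall r x, 0 < r -> `|x| <= r -> cvgn (P_partial V r x)) /\
    (* P_R >= 0 on [-R,R] in the pushed phase *)
    (forall r x, 0 < r -> r < Rs -> `|x| <= r -> 0 <= P_R V r x) /\
    (* Q is well defined by the limit and nonnegative *)
    (forall x, `|x| < Rs ->
       cvg ((fun r => P_R V r x / (r ^+ 2 - x ^+ 2)) @ at_left Rs) /\
       0 <= Q_fun V Rs x) /\
    (* existence, uniqueness and explicit form of the constrained minimiser *)
    (forall r, 0 < r ->
       (exists mu : probability R R, constrained_minimiser V r mu) /\
       (forall mu : probability R R, constrained_minimiser V r mu ->
          forall A : set R, measurable A ->
            mu A = (\int[lebesgue_measure]_(x in A) (eq_density V Rs r x)%:E)%E)).
Proof.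
have [pot W1] := potential_of_C3 hC3 hsym hconv.
have [Rs [Rs0 SRs Slt]] := critical_radius pot W1.
have Sle r : 0 < r -> r <= Rs -> Smean (derive1 V) r <= 1.
  move=> r0; rewrite le_eqVlt => /predU1P[->|rRs]; first by rewrite SRs.
  by rewrite ltW// Slt// (ltW r0).
have Qlim x : `|x| < Rs -> Q_fun V Rs x = P_R V Rs x / (Rs ^+ 2 - x ^+ 2).
  by move=> xRs; apply: cvg_lim => //; exact: (Q_cvg pot).
exists Rs; split; [|split; [|split; [|split]]].
- split=> //; first exact/(crit_eqE pot Rs0).
  move=> r /andP[r0 rRs] /(crit_eqE pot r0) S1.
  by have := Slt r; rewrite (ltW r0) rRs S1 ltxx => /(_ isT).
- exact: (P_partial_cvg pot).
- by move=> r x r0 rRs; apply: (P_R_ge0 pot) => //; rewrite Sle// ltW.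
- move=> x xRs; split; first by apply/cvg_ex; eexists; exact: (Q_cvg pot xRs).
  rewrite Qlim// divr_ge0//; first by apply: (P_R_ge0 pot) => //; rewrite ?SRs// ltW.
  by rewrite subr_ge0 -(real_normK (num_real x)) lerXn2r ?nnegrE ?(ltW xRs) ?(ltW Rs0).
- move=> r r0; pose s := if r < Rs then r else Rs.
  have s0 : 0 < s by rewrite /s; case: ifP.
  have sr : s <= r by rewrite /s; case: ltP.
  have sRs : s <= Rs by rewrite /s; case: ifPn => // /ltW.
  (* Either the walls are active and s = r, or s is the critical radius: the alternative required by
     the minimality lemmas. *)
  have hs : s = r \/ Smean (derive1 V) s = 1 by rewrite /s; case: ifP; [left|right].
  have P0 x : `|x| <= s -> 0 <= P_R V s x by move=> xs; apply: (P_R_ge0 pot) => //; exact: Sle.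
  pose rho := densP (equilibrium pot s0 P0).
  have rhos := equilibrium_support pot s0 P0.
  have rhom := equilibrium_moments pot s0 P0.
  split; first by exists rho; exact: (rho_minimiser pot hsym s0 rhos rhom sr hs).
  move=> mu hmu A mA.
  rewrite (minimiser_unique pot hsym s0 rhos rhom sr hs hmu mA) densPE.
  apply: eq_integral => x _; congr (_%:E).
  rewrite /= /eq_density /eqdens /s; case: (boolP (r < Rs)) => // _.
  (* At |x| = Rs the stated density vanishes through its square root, while [eqdens] is 0 by
     definition. Inside, P / sqrt(D) equals (P / D) * sqrt(D) with D = Rs^2 - x^2. *)
  case: (ltgtP `|x| Rs) => // xRs; last first.
    by rewrite -(real_normK (num_real x)) xRs subrr sqrtr0 !mulr0.
  rewrite Qlim//; congr (_ * _).
  have d0 : 0 < Rs ^+ 2 - x ^+ 2.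
    by rewrite subr_gt0 -(real_normK (num_real x)) ltrXn2r ?nnegrE ?(ltW Rs0).
  rewrite -mulrA; congr (_ * _); rewrite -{2}(sqr_sqrtr (ltW d0)).
  by rewrite expr2 invfM -mulrA mulVf ?mulr1// gt_eqF// sqrtr_gt0.
Qed.
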